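(* Let $k$ be an algebraically closed field of characteristic $5$, let $\Gamma\subset\mathbb{P}^2$ be a $k$-Hermitian curve, and let $\mathcal{D}$ be the set of connected components of the graph $G$ on the set $\mathcal{Q}$ of non-singular conics totally tangent to $\Gamma$. Let $\mathcal{C}_1,\mathcal{C}_2,\mathcal{C}_3$ be the vertex sets of the three connected components of the graph $H$ on $\mathcal{D}$, and let $\mathcal{E}_1$ be the set of edges of $H|\mathcal{C}_1$, with the relation $\sim$ on $\mathcal{E}_1$. Let $H''$ be the graph whose set of vertices is $\mathcal{E}_1\cup\mathcal{C}_2\cup\mathcal{C}_3$, and whose set of edges consists of - $\{E,E'\}$, where $E,E'\in\mathcal{E}_1$ are distinct and satisfy $E\sim E'$, - $\{E,D\}$, where $E=\{D_1,D_2\}\in\mathcal{E}_1$, $D\in\mathcal{C}_2\cup\mathcal{C}_3$, and both of $T(D_1,D)$ and $T(D_2,D)$ are $\alpha^{3}\gamma^{18}$, and - $\{D,D'\}$, where $D,D'\in\mathcal{C}_2\cup\mathcal{C}_3$ are distinct and satisfy $T(D,D')=\alpha^{15}\gamma^{6}$ or $\alpha^{3}\gamma^{18}$. Then $H''$ is (isomorphic to) the McLaughlin graph.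
   Context: Work over an algebraically closed field $k$ of characteristic $5$. A $k$-Hermitian curve is a projective plane curve $\Gamma\subset\mathbb{P}^2$ of degree $6$ that is projectively isomorphic (via $\mathrm{PGL}_3(k)$) to the Fermat curve $\Gamma_5: x^6+y^6+z^6=0$. $\mathcal{P}$ denotes the set of Weierstrass points of $\Gamma$; equivalently, the set of points $P\in\Gamma$ whose tangent line meets $\Gamma$ at $P$ with intersection multiplicity $6$ (for $\Gamma=\Gamma_5$, the $\mathbb{F}_{25}$-rational points). One has $|\mathcal{P}|=126$. A line of $\mathbb{P}^2$ is a special secant line of $\Gamma$ if it passes through two distinct points of $\mathcal{P}$. A non-singular conic $Q\subset\mathbb{P}^2$ is totally tangent to $\Gamma$ if $Q$ meets $\Gamma$ at six distinct points, each with intersection multiplicity $2$. $\mathcal{Q}$ denotes the set of all such conics; one has $|\mathcal{Q}|=3150$ and $Q\cap\Gamma\subset\mathcal{P}$ for $Q\in\mathcal{Q}$. For $Q\in\mathcal{Q}$, $\mathcal{S}(Q)$ is the set of the $15$ special secant lines of $\Gamma$ passing through two distinct points of $Q\cap\Gamma$. $G$ is the graph with vertex set $\mathcal{Q}$ in which distinct $Q,Q'$ are adjacent if and only if $|Q\cap Q'|=4$ and $|\mathcal{S}(Q)\cap\mathcal{S}(Q')|=3$. $\mathcal{D}$ is the set of connected components of $G$ (there are $150$ of them); each $D\in\mathcal{D}$ is regarded as a subset of $\mathcal{Q}$, consisting of $21$ conics. For $Q\in\mathcal{Q}$ and $D'\in\mathcal{D}$ with $Q\notin D'$, the type $t(Q,D')\in\{\alpha,\beta,\gamma\}$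 is defined by the values of $|Q\cap Q'\cap\Gamma|$ as $Q'$ runs over the $21$ conics of $D'$: $t(Q,D')=\alpha$ if the value is $2$ for $3$ conics and $0$ for $18$; $t(Q,D')=\beta$ if it is $2$ for $1$ conic, $1$ for $4$ conics and $0$ for $16$; $t(Q,D')=\gamma$ if it is $1$ for $6$ conics and $0$ for $15$. (One of these three cases always occurs.) For distinct $D,D'\in\mathcal{D}$, the type $T(D,D')$ is: $\beta^{21}$ if $t(Q,D')=\beta$ for all $Q\in D$; $\gamma^{21}$ if $t(Q,D')=\gamma$ for all $Q\in D$; $\alpha^{15}\gamma^{6}$ if $t(Q,D')=\alpha$ for $15$ conics $Q\in D$ and $\gamma$ for the other $6$; $\alpha^{3}\gamma^{18}$ if $t(Q,D')=\alpha$ for $3$ conics $Q\in D$ and $\gamma$ for the other $18$. (One of these four cases always occurs, and $T(D,D')=T(D',D)$.) $H$ is the graph with vertex set $\mathcal{D}$ in which distinct $D,D'$ are adjacent if and only if $T(D,D')=\alpha^{15}\gamma^{6}$. It has exactly three connected components, with vertex sets $\mathcal{C}_1,\mathcal{C}_2,\mathcal{C}_3$ of size $50$ each. Put $$\mathcal{E}_1:=\{\{D_1,D_2\}\mid D_1,D_2\in\mathcal{C}_1,\ T(D_1,D_2)=\alpha^{15}\gamma^{6}\},$$ the set of edges of the induced subgraph $H|\mathcal{C}_1$. The symmetric relation $\sim$ on $\mathcal{E}_1$ is defined by: $\{D_1,D_2\}\sim\{D_1',D_2'\}$ if and only if these two edges are disjoint and there exists an edge $\{D_1'',D_2''\}\in\mathcal{E}_1$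 that has a common vertex with each of the edges $\{D_1,D_2\}$ and $\{D_1',D_2'\}$. The McLaughlin graph is the unique strongly regular graph of parameters $(v,k,\lambda,\mu)=(275,112,30,56)$. *)

(* Defs.v *)
From HB Require Import structures.
From mathcomp Require Import all_boot all_algebra.
From mathcomp Require Import boolp classical_sets functions cardinality.
From mathcomp Require Import mpoly.
From Stdlib Require Import Relation_Operators.

Set Implicit Arguments.
Unset Strict Implicit.
Unset Printing Implicit Defensive.

Import GRing.Theory.
Local Open Scope ring_scope.
Local Open Scope classical_set_scope.

Definition has_card (T : Type) (A : set T) (n : nat) : Prop :=
  (A #= `I_n)%card.

(** * Graphs *)

Record graph (T : Type) := Graph { vertices : set T; adj : T -> T -> Prop }.

Inductive induced_adj (T : Type) (G : graph T) (x y : T) : Prop :=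
  InducedAdj of vertices G x & vertices G y & adj G x y.

Definition component (T : Type) (G : graph T) (x : T) : set T :=
  [set y | vertices G y /\ clos_refl_sym_trans T (induced_adj G) x y].

Definition components (T : Type) (G : graph T) : set (set T) :=
  [set C | exists2 x, vertices G x & C = component G x].

Definition common_neighbors (T : Type) (G : graph T) (x y : T) : set T :=
  [set z | [/\ vertices G z, adj G x z & adj G y z]].

Record strongly_regular (T : Type) (G : graph T) (v k l m : nat) : Prop :=
  StronglyRegular {
    srg_irrefl : forall x, vertices G x -> ~ adj G x x;
    srg_sym : forall x y, vertices G x -> vertices G y ->
      adj G x y -> adj G y x;
    srg_order : has_card (vertices G) v;
    srg_degree : forall x, vertices G x ->
      has_card [set y | vertices G y /\ adj G x y] k;
    srg_adj : forall x y, vertices G x -> vertices G y ->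
      adj G x y -> has_card (common_neighbors G x y) l;
    srg_nonadj : forall x y, vertices G x -> vertices G y ->
      x <> y -> ~ adj G x y -> has_card (common_neighbors G x y) m }.

(** The McLaughlin graph is, up to isomorphism, the unique strongly regular
    graph with these parameters. *)
Definition is_McLaughlin_graph (T : Type) (G : graph T) : Prop :=
  strongly_regular G 275 112 30 56.

(** * Plane projective geometry *)

(** The projective space of lines (through the origin) of [V]; [rep] chooses
    a non-zero vector of such a line. *)
Definition proj (k : fieldType) (V : vectType k) :=
  {U : {vspace V} | \dim U == 1%N}.

Definition rep (k : fieldType) (V : vectType k) (U : proj V) : V :=
  vpick (val U).

Notation ppoint k := (proj 'rV[k]_3).

(** A plane curve of degree [d] is a non-zero form of degree [d] up to
    scalars. *)
Notation pcurve k d := (proj (dhomog 3 k d)).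

Section Plane.

Variable k : closedFieldType.

Local Notation poly3 := {mpoly k[3]}.
Local Notation point := (ppoint k).
Local Notation curve d := (pcurve k d).
Local Notation "x %:F" := (@FracField.tofrac _ x).

(** The value at [rep P]; for homogeneous [f], its vanishing depends only
    on [P]. *)
Definition evalp (f : poly3) (P : point) : k := f.@[fun i => rep P 0 i].

Definition form (d : nat) (C : curve d) : poly3 := mpoly_of_dhomog (rep C).

Definition points (d : nat) (C : curve d) : set point :=
  [set P | evalp (form C) P = 0].

(** The local ring of the plane at [P], inside the fraction field of
    [k[x0, x1, x2]]. *)
Definition local_ring (P : point) : set {fraction poly3} :=
  [set h | exists (m : nat) (a b : poly3),
    [/\ a \is m.-homog, b \is m.-homog, evalp b P != 0 & h = a%:F / b%:F]].

(** The ideal of [local_ring P] generated by the local equations at [P] of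
    the curves [f = 0] and [g = 0]. *)
Definition local_ideal (P : point) (f g : poly3) : set {fraction poly3} :=
  [set h | exists (m : nat) (a b : poly3),
    [/\ a \is m.-homog, b \is m.-homog, evalp b P != 0, h = a%:F / b%:F
      & exists u v, a = u * f + v * g]].

(** [dim_k (local_ring P / local_ideal P f g) = n], expressed by the
    existence of a basis [e] of the quotient. *)
Definition intersection_mult (P : point) (f g : poly3) (n : nat) : Prop :=
  exists e : 'I_n -> {fraction poly3},
    (forall i, local_ring P (e i)) /\
    (forall h, local_ring P h ->
      exists! c : {ffun 'I_n -> k},
        local_ideal P f g (h - \sum_(i < n) (c i)%:MP%:F * e i)).

Definition linear_subst (A : 'M[k]_3) (f : poly3) : poly3 :=
  f \mPo [tuple \sum_(j < 3) A i j *: 'X_j | i < 3].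

Definition fermat_sextic : poly3 := \sum_(i < 3) 'X_i ^+ 6.

Definition is_hermitian (Gamma : curve 6) : Prop :=
  exists A : 'M[k]_3, exists c : k,
    [/\ A \in unitmx, c != 0
      & linear_subst A (form Gamma) = c *: fermat_sextic].

Definition nonsingular (d : nat) (C : curve d) : Prop :=
  forall P, points C P -> exists i : 'I_3, evalp (form C)^`M(i) P != 0.

Definition tangent_form (d : nat) (C : curve d) (P : point) : poly3 :=
  \sum_(i < 3) evalp (form C)^`M(i) P *: 'X_i.

End Plane.

(** * Graphs of totally tangent conics of a Hermitian curve *)

Section Hermitian.

Variables (k : closedFieldType) (Gamma : pcurve k 6).

Local Notation point := (ppoint k).
Local Notation line := (pcurve k 1).
Local Notation conic := (pcurve k 2).

Definition weierstrass : set point :=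
  [set P | points Gamma P /\
     intersection_mult P (tangent_form Gamma P) (form Gamma) 6].

Definition joins (A : set point) (L : line) : Prop :=
  exists P P', [/\ P <> P', A P, A P', points L P & points L P'].

Definition special_secant : set line := [set L | joins weierstrass L].

Definition totally_tangent (Q : conic) : Prop :=
  has_card (points Q `&` points Gamma) 6 /\
  (forall P, (points Q `&` points Gamma) P ->
     intersection_mult P (form Q) (form Gamma) 2).

Definition tangent_conics : set conic :=
  [set Q | nonsingular Q /\ totally_tangent Q].

Definition secants (Q : conic) : set line :=
  [set L | special_secant L /\ joins (points Q `&` points Gamma) L].

Definition graphG : graph conic :=
  Graph tangent_conics (fun Q Q' =>
    [/\ Q <> Q', has_card (points Q `&` points Q') 4
      & has_card (secants Q `&` secants Q') 3]).

Definition calD : set (set conic) := components graphG.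

(** Exactly [n] conics [Q'] of [D'] satisfy [|Q & Q' & Gamma| = m]. *)
Definition meet_count (Q : conic) (D' : set conic) (m n : nat) : Prop :=
  has_card [set Q' | D' Q' /\
    has_card (points Q `&` points Q' `&` points Gamma) m] n.

Inductive conic_type := Alpha | Beta | Gam.

Definition t_is (Q : conic) (D' : set conic) (t : conic_type) : Prop :=
  match t with
  | Alpha => meet_count Q D' 2 3 /\ meet_count Q D' 0 18
  | Beta => [/\ meet_count Q D' 2 1, meet_count Q D' 1 4
              & meet_count Q D' 0 16]
  | Gam => meet_count Q D' 1 6 /\ meet_count Q D' 0 15
  end.

Inductive pair_type := Beta21 | Gam21 | Alpha15Gam6 | Alpha3Gam18.

Definition T_is (D D' : set conic) (T : pair_type) : Prop :=
  let count t n := has_card [set Q | D Q /\ t_is Q D' t] n in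
  match T with
  | Beta21 => forall Q, D Q -> t_is Q D' Beta
  | Gam21 => forall Q, D Q -> t_is Q D' Gam
  | Alpha15Gam6 => count Alpha 15 /\ count Gam 6
  | Alpha3Gam18 => count Alpha 3 /\ count Gam 18
  end.

Definition graphH : graph (set conic) :=
  Graph calD (fun D D' => D <> D' /\ T_is D D' Alpha15Gam6).

Section McLaughlin.

Variables C1 C2 C3 : set (set conic).

Definition edges1 : set (set (set conic)) :=
  [set E | exists D1 D2, [/\ C1 D1, C1 D2, adj graphH D1 D2
                           & E = [set D1; D2]]].

Definition edge_rel (E E' : set (set conic)) : Prop :=
  E `&` E' = set0 /\
  exists2 E'', edges1 E'' & E'' `&` E !=set0 /\ E'' `&` E' !=set0.

Definition edge_vertex (E : set (set conic)) (D : set conic) : Prop :=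
  exists D1 D2, [/\ E = [set D1; D2], T_is D1 D Alpha3Gam18
                  & T_is D2 D Alpha3Gam18].

Definition graphH'' : graph (set (set conic) + set conic) :=
  Graph ([set inl E | E in edges1] `|` [set inr D | D in C2 `|` C3])
    (fun x y =>
       match x, y with
       | inl E, inl E' => E <> E' /\ edge_rel E E'
       | inl E, inr D | inr D, inl E => edge_vertex E D
       | inr D, inr D' =>
           D <> D' /\ (T_is D D' Alpha15Gam6 \/ T_is D D' Alpha3Gam18)
       end).

End McLaughlin.

End Hermitian.

(* Main.v *)
(* All k-Hermitian curves are equivalent to the zero locus of the Hermitian
   form x0 x2^5 - 2 x1^6 + x2 x0^5, and the conics totally tangent to this curve
   are exactly the images of the conic x0 x2 = x1^2 under its unitary group,
   whose matrices have entries in the field with 25 elements.  Common secants and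
   the types T can be read off the 126 rational points of the curve, which the
   unitary matrices permute, and |Q & Q'| off a binary quartic form.  Five
   generators of the unitary group act transitively on the 150 components of G;
   the types of all pairs of components therefore follow from the pairs
   containing the component of one conic, and the strong regularity of H''
   becomes a finite computation with permutations of 126 points and of 150
   partitions of these points into 21 conics. *)

From Stdlib Require Import BinNums Relation_Operators.
From HB Require Import structures.
From mathcomp Require Import all_boot all_algebra.
From mathcomp Require Import boolp classical_sets functions cardinality.
From mathcomp Require Import mpoly ring zify.
Require Import Defs.

Set Implicit Arguments.
Unset Strict Implicit.
Unset Printing Implicit Defensive.

Import GRing.Theory.
Local Open Scope ring_scope.
Local Open Scope classical_set_scope.

Local Notation "x %:F" := (@FracField.tofrac _ x).

(** Tangency is defined through dimensions of local rings; rationality makes it computable. A conic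
    and a tangent line are parametrised by polynomials, and the multiplicity is the order of
    vanishing of the sextic along the parametrisation. This takes both the existence of a basis of
    the local quotient and the uniqueness of its size. All coordinates refer to a frame, a matrix
    [B] pulling the equation of [Gamma] back to the Hermitian form. A unitary [M] acts by replacing
    [B] with [M *m B]; statements quantify over all frames, so equivariance becomes a change of
    frame, and induction along generators replaces any enumeration of the group. Six points of
    contact determine a totally tangent conic, so conics can be replaced by blocks of rational
    points. The condition |Q & Q'| = 4 is the exception, as it may involve points off the curve; it
    has to be decided only for conics sharing three secants with the base conic. The naming of the
    components of H is arbitrary, and the last frame is chosen to place the base component in
    [C1]. *)

Lemma mmap_dhomog (n d : nat) (R S : comNzRingType) (f : {rmorphism R -> S})
    (p : {mpoly R[n]}) (c : S) (u : 'I_n -> S) :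
  p \is d.-homog -> mmap f (fun i => c * u i) p = c ^+ d * mmap f u p.
Proof.
move=> /dhomogP hp; rewrite /mmap mulr_sumr; apply: eq_big_seq => m /hp <-.
rewrite mulrCA; congr (_ * _); rewrite /= mdegE /mmap1 -prodrXr -big_split /=.
by apply: eq_bigr => i _; rewrite exprMn.
Qed.

Lemma rmorph_mmap (n : nat) (R S T : comNzRingType) (f : {rmorphism R -> S})
    (g : {rmorphism S -> T}) (u : 'I_n -> S) (p : {mpoly R[n]}) :
  g (mmap f u p) = mmap (g \o f) (g \o u) p.
Proof.
rewrite /mmap rmorph_sum; apply: eq_bigr => m _.
by rewrite rmorphM rmorph_prod; congr (_ * _); apply: eq_bigr => i _; rewrite rmorphXn.
Qed.

(** Congruence modulo the ideal generated by [h] passes from the arguments to powers, products and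
    sums; [h] will be the equation of the curve. *)
Lemma mmap_congr (n : nat) (R S : comNzRingType) (f : {rmorphism R -> S})
    (u v r : 'I_n -> S) (h : S) (p : {mpoly R[n]}) :
  (forall i, u i - v i = r i * h) ->
  exists q, mmap f u p - mmap f v p = q * h.
Proof.
move=> uv.
have prod_congr (m : 'X_{1..n}) (s : seq 'I_n) : exists q,
    \prod_(i <- s) u i ^+ m i - \prod_(i <- s) v i ^+ m i = q * h.
  elim: s => [|i s [q IH]]; first by exists 0; rewrite !big_nil subrr mul0r.
  rewrite !big_cons.
  have [t ht] : exists t, u i ^+ m i - v i ^+ m i = t * h.
    by rewrite subrXX uv; exists (r i * \sum_(j < m i) u i ^+ ((m i).-1 - j) * v i ^+ j);
      rewrite mulrAC.
  exists (t * \prod_(j <- s) u j ^+ m j + v i ^+ m i * q).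
  by rewrite mulrDl mulrAC -ht -mulrA -IH; ring.
rewrite /mmap /mmap1; elim: (msupp p) => [|m s [q IH]].
  by exists 0; rewrite !big_nil subrr mul0r.
have [t ht] := prod_congr m (index_enum 'I_n).
rewrite !big_cons; exists (f p@_m * t + q).
by rewrite mulrDl -IH -mulrA -ht; ring.
Qed.

(** * Evaluation of ternary forms along polynomial curves *)

Section Eval.

Variable k : fieldType.
Local Notation poly3 := {mpoly k[3]}.

Definition ev (phi : 'I_3 -> {poly k}) : poly3 -> {poly k} :=
  mmap (@polyC k) phi.

HB.instance Definition _ phi := GRing.RMorphism.copy (ev phi) (ev phi).

Lemma evZ phi c p : ev phi (c *: p) = c%:P * ev phi p.
Proof. exact: mmapZ. Qed.

Lemma evX phi i : ev phi 'X_i = phi i.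
Proof. by rewrite /ev mmapX mmap1U. Qed.

Lemma horner_ev phi p t : (ev phi p).[t] = p.@[fun i => (phi i).[t]].
Proof.
rewrite -[LHS]/(horner_eval t (ev phi p)) rmorph_mmap /meval.
by rewrite /mmap; apply: eq_bigr => m _; rewrite /= /horner_eval hornerC.
Qed.

Lemma ev_const (u : 'I_3 -> k) p : ev (fun i => (u i)%:P) p = (p.@[u])%:P.
Proof. by rewrite /meval rmorph_mmap. Qed.

Lemma meval_dhomog d (p : poly3) c (u : 'I_3 -> k) :
  p \is d.-homog -> p.@[fun i => c * u i] = c ^+ d * p.@[u].
Proof. exact: mmap_dhomog. Qed.

Lemma size_ev d e (p : poly3) (phi : 'I_3 -> {poly k}) :
  p \is d.-homog -> (forall i, (size (phi i) <= e.+1)%N) ->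
  (size (ev phi p) <= (e * d).+1)%N.
Proof.
move=> /dhomogP hp hphi; rewrite /ev /mmap big_seq.
apply: (big_ind (fun q : {poly k} => (size q <= (e * d).+1)%N)) => [|a b ha hb|m hm].
- by rewrite size_poly0.
- by rewrite (leq_trans (size_polyD _ _)) // geq_max ha.
rewrite mul_polyC (leq_trans (size_scale_leq _ _)) //.
rewrite -(hp _ hm) /= mdegE /mmap1.
elim/big_ind2: _ => [|n1 q1 n2 q2 h1 h2|i _]; first by rewrite size_poly1.
  rewrite (leq_trans (size_polyMleq _ _)) //.
  by rewrite mulnDr -subn1 leq_subLR (leq_trans (leq_add h1 h2)) // addSn addnS.
rewrite (leq_trans (size_poly_exp_leq _ _)) // ltnS leq_mul2r.
by rewrite -ltnS; move: (hphi i); lia.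
Qed.

End Eval.

(** * Intersection multiplicity as order of vanishing *)

Lemma sub_sum_ratio (F : fieldType) n (a b x y : F) (c : 'I_n -> F) :
  b != 0 -> x != 0 ->
  a / b - \sum_(i < n) c i * (y ^+ i / x ^+ i) =
  (a * x ^+ n - b * \sum_(i < n) c i * (y ^+ i * x ^+ (n - i))) / (b * x ^+ n).
Proof.
move=> b0 x0; have xn0 : x ^+ n != 0 by rewrite expf_neq0.
rewrite mulrBl -!mulf_div divff // mulr1 divff // mul1r; congr (_ - _).
rewrite mulr_suml; apply: eq_bigr => i _; rewrite -!mulrA; congr (_ * (_ * _)).
by rewrite expfB_cond ?(negbTE x0) ?(ltnW (ltn_ord i)) // mulrAC divff ?mul1r.
Qed.

Section LocalIntersection.

Variable k : closedFieldType.
Local Notation poly3 := {mpoly k[3]}.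

Variables (P : ppoint k) (phi : 'I_3 -> {poly k}) (rho : k).
Hypotheses (hrho : rho != 0) (hP : forall i, rep P 0 i = rho * (phi i).[0]).

Lemma evalp_ev m (a : poly3) : a \is m.-homog ->
  evalp a P = rho ^+ m * (ev phi a).[0].
Proof.
move=> ha; rewrite /evalp horner_ev -meval_dhomog //.
by congr (_.@[_]); apply/funext.
Qed.

Lemma evalp_eq0 m (a : poly3) : a \is m.-homog ->
  (evalp a P == 0) = ((ev phi a).[0] == 0).
Proof.
by move=> ha; rewrite (evalp_ev ha) mulf_eq0 expf_eq0 (negbTE hrho) andbF.
Qed.

Variables (X Y f : poly3).
Hypotheses (hX : X \is 1.-homog) (hY : Y \is 1.-homog).
Hypotheses (evX1 : ev phi X = 1) (evYX : ev phi Y = 'X).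
Hypothesis size_phi : forall i, (size (phi i) <= 3)%N.

(** This is X^N p(Y/X). As [X] and [Y] restrict to 1 and to the parameter, restricting it to the
    curve gives back [p] when the degree of [p] is at most [N]. *)
Definition homogenize N (p : {poly k}) : poly3 :=
  \sum_(s < N.+1) p`_s *: (X ^+ (N - s) * Y ^+ s).

Let X0 : X != 0.
Proof.
apply/eqP => h; move: evX1; rewrite h rmorph0 => /esym/eqP.
by rewrite oner_eq0.
Qed.

Let hXi m : X ^+ m \is m.-homog.
Proof. by have := dhomogMn m hX; rewrite mul1n. Qed.

Let hYi m : Y ^+ m \is m.-homog.
Proof. by have := dhomogMn m hY; rewrite mul1n. Qed.

Let frac_const : {rmorphism k -> {fraction poly3}} :=
  (@FracField.tofrac poly3 : {rmorphism _ -> _}) \o (@mpolyC 3 k).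

Lemma homogenize_homog N p : homogenize N p \is N.-homog.
Proof.
apply: rpred_sum => s _; apply: rpredZ.
have hs : (s <= N)%N by rewrite -ltnS.
by have := dhomogM (hXi (N - s)) (hYi s); rewrite subnK.
Qed.

(** In the fraction field homogenization is evaluation at [Y / X] up to a power of [X], hence
    multiplicative; the identities that follow are proved there and pulled back by injectivity. *)
Lemma frac_homogenize N (p : {poly k}) : (size p <= N.+1)%N ->
  (homogenize N p)%:F = X%:F ^+ N * (map_poly frac_const p).[Y%:F / X%:F].
Proof.
move=> hp; rewrite (@horner_coef_wide _ N.+1) ?size_map_poly //.
rewrite rmorph_sum mulr_sumr; apply: eq_bigr => s _.
rewrite -mul_mpolyC !rmorphM !rmorphXn /= coef_map /= [RHS]mulrCA; congr (_ * _).
rewrite exprMn [RHS]mulrCA [LHS]mulrC; congr (_ * _).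
have XF0 : X%:F != 0 by rewrite tofrac_eq0.
by rewrite exprVn expfB_cond // (negbTE XF0) add0n -ltnS.
Qed.

Lemma homogenize_addX N n (p : {poly k}) : (size p <= N.+1)%N ->
  homogenize (N + n) p = X ^+ n * homogenize N p.
Proof.
move=> hp; apply/eqP; rewrite -tofrac_eq rmorphM rmorphXn /=.
rewrite !frac_homogenize ?exprD //; last by rewrite (leq_trans hp) // ltnS leq_addr.
by apply/eqP; ring.
Qed.

Lemma homogenize_mulXn N n (p : {poly k}) : (size p <= N.+1)%N ->
  homogenize (N + n) ('X^n * p) = Y ^+ n * homogenize N p.
Proof.
move=> hp; apply/eqP; rewrite -tofrac_eq rmorphM rmorphXn /=.
have XF0 : X%:F != 0 by rewrite tofrac_eq0.
rewrite !frac_homogenize //; last first.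
  rewrite (leq_trans (size_polyMleq _ _)) // size_polyXn addSn /=.
  by rewrite addnC -addSn leq_add2r.
rewrite rmorphM hornerM /= map_polyXn hornerXn exprMn exprVn exprD.
rewrite -[X in _ == X]mul1r -(divff (expf_neq0 n XF0)).
by apply/eqP; ring.
Qed.

Lemma meval_homogenize N (p : {poly k}) : (ev phi (homogenize N p)).[0] = p.[0].
Proof.
rewrite rmorph_sum horner_sum big_ord_recl /= [X in _ + X]big1 ?addr0 => [|i _].
  by rewrite evZ rmorphM !rmorphXn /= evX1 expr1n !mulr1 hornerC horner_coef0.
rewrite evZ rmorphM !rmorphXn /= evYX evX1 expr1n mul1r hornerM hornerXn.
by rewrite expr0n mulr0.
Qed.

Hypothesis evf : ev phi f = 0.
Hypothesis congr_phi : forall i, exists r, X * 'X_i - homogenize 2 (phi i) = r * f.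

Lemma homogenize_ev m (a : poly3) : a \is m.-homog ->
  homogenize (2 * m) (ev phi a) = mmap (@mpolyC 3 k) (fun i => homogenize 2 (phi i)) a.
Proof.
move=> ha; apply/eqP; rewrite -tofrac_eq; apply/eqP.
rewrite frac_homogenize ?(size_ev ha) //.
have E (p : {poly k}) : (map_poly frac_const p).[Y%:F / X%:F] =
  (horner_eval (Y%:F / X%:F) \o map_poly frac_const) p by [].
rewrite E /ev [in LHS]rmorph_mmap [in RHS]rmorph_mmap exprM -(mmap_dhomog _ _ _ ha) /=.
rewrite /mmap; apply: eq_bigr => i _; congr (_ * _).
  by rewrite /= map_polyC /horner_eval hornerC.
rewrite /mmap1; apply: eq_bigr => j _; congr (_ ^+ _).
by rewrite /= frac_homogenize.
Qed.

(** Replacing each variable by [X * 'X_i] multiplies a form of degree [m] by [X ^+ m], so the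
    congruences assumed for the coordinates yield one for every form. *)
Lemma homogenize_ev_mod m (a : poly3) : a \is m.-homog ->
  exists r, X ^+ m * a - homogenize (2 * m) (ev phi a) = r * f.
Proof.
move=> ha; have [r hr] := choice congr_phi.
have [q hq] := mmap_congr (@mpolyC 3 k) a hr.
exists q; rewrite homogenize_ev // -hq (mmap_dhomog _ _ _ ha); congr (_ * _ - _).
by rewrite [LHS]mpolyE /mmap; apply: eq_bigr => i _; rewrite mmap1_id mul_mpolyC.
Qed.

Variables (g : poly3) (d n : nat) (G : {poly k}).
Hypotheses (hg : g \is d.-homog) (evg : ev phi g = 'X^n * G) (hG : G.[0] != 0).

Lemma ev_mulXn_mod m (a : poly3) A : a \is m.-homog -> ev phi a = 'X^n * A ->
  exists r, X ^+ (m + n) * a - Y ^+ n * homogenize (2 * m) A = r * f.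
Proof.
move=> ha hA; have [r hr] := homogenize_ev_mod ha.
have sA : (size A <= (2 * m).+1)%N.
  have [->|A0] := eqVneq A 0; first by rewrite size_poly0.
  apply: leq_trans (size_ev ha size_phi).
  rewrite hA mulrC size_mulXn //; exact: leq_addl.
exists (X ^+ n * r); rewrite -homogenize_mulXn // -hA homogenize_addX.
  by rewrite -mulrA -hr exprD; ring.
exact: (size_ev ha).
Qed.

Lemma coprime_Xn m (b : poly3) : b \is m.-homog -> evalp b P != 0 ->
  coprimep 'X^n (ev phi b).
Proof.
move=> hb; rewrite (evalp_eq0 hb) => b0.
by rewrite coprimep_sym; apply: coprimep_expr; rewrite coprimepX rootE.
Qed.

Lemma nz_evalp (b : poly3) : evalp b P != 0 -> b != 0.
Proof. by apply: contraNneq => ->; rewrite /evalp meval0. Qed.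

(** From left to right, restrict to the curve: [f] vanishes, [g] is divisible by ['X^n], and the
    denominators are prime to it. Conversely both [a] and [g] are, up to powers of [X], congruent
    modulo [f] to [Y ^+ n] times a form, and the form obtained from [g] is a unit at [P];
    cross-multiplication then puts a unit multiple of [a] in the ideal. *)
Lemma local_ideal_ord m (a b : poly3) :
  a \is m.-homog -> b \is m.-homog -> evalp b P != 0 ->
  local_ideal P f g (a%:F / b%:F) <-> ('X^n %| ev phi a)%R.
Proof.
move=> ha hb b0; split.
  move=> [m' [a' [b' [ha' hb' b0' eqab [u [v a'E]]]]]].
  have : a * b' = a' * b.
    apply/eqP; rewrite -tofrac_eq !rmorphM /= -eqr_div ?eqab //.
      by rewrite tofrac_eq0 nz_evalp.
    by rewrite tofrac_eq0 nz_evalp.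
  move=> /(congr1 (ev phi)); rewrite !rmorphM /= => eqev.
  rewrite -(Gauss_dvdpl _ (coprime_Xn hb' b0')) eqev a'E rmorphD !rmorphM /= evf evg.
  by rewrite mulr0 add0r mulrCA -mulrA dvdp_mulr.
move=> /dvdpP [A]; rewrite mulrC => hA.
have [r hr] := ev_mulXn_mod ha hA.
have [t ht] := ev_mulXn_mod hg evg.
have hc : X ^+ (m + n) * homogenize (2 * d) G \is (m + n + 2 * d).-homog.
  by apply: dhomogM (homogenize_homog _ _).
(* [c] is a unit at [P]: along the parametrisation [X] is 1, and the cofactor of [g] takes the value
   [G.[0]] at the parameter 0. *)
set c := X ^+ (m + n) * _ in hc.
have c0 : evalp c P != 0.
  by rewrite (evalp_eq0 hc) rmorphM rmorphXn /= evX1 expr1n mul1r meval_homogenize.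
exists (m + (m + n + 2 * d))%N, (a * c), (b * c); split.
- exact: dhomogM.
- exact: dhomogM.
- by rewrite /evalp mevalM mulf_neq0.
- have cF0 : c%:F != 0 by rewrite tofrac_eq0 nz_evalp.
  by rewrite (tofracM a) (tofracM b) -mulf_div (divff cF0) mulr1.
exists (homogenize (2 * d) G * r - homogenize (2 * m) A * t), (X ^+ (d + n) * homogenize (2 * m) A).
rewrite mulrBl -[_ * r * f]mulrA -hr -[_ * t * f]mulrA -ht /c.
by ring.
Qed.

(* Modulo [f], a form [a] becomes, after multiplication by a power of [X], a form
   in [X] and [Y] only; so the local ring of [f] at [P] is that of the line with
   coordinate [Y / X], and [g] generates the n-th power of its maximal ideal. *)
Theorem intersection_mult_ord : intersection_mult P f g n.
Proof.
have XF0 : X%:F != 0 by rewrite tofrac_eq0.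
have XP0 : evalp X P != 0 by rewrite (evalp_eq0 hX) evX1 hornerC oner_neq0.

(* The powers below [n] of the local coordinate [Y / X] form the basis. *)
exists (fun i : 'I_n => (Y ^+ i)%:F / (X ^+ i)%:F); split.
  move=> i; exists i, (Y ^+ i), (X ^+ i); split => //.
  by rewrite /evalp rmorphXn expf_neq0.
move=> h [m [a [b [ha hb b0 ->]]]].
pose num (c : {ffun 'I_n -> k}) :=
  a * X ^+ n - b * \sum_(i < n) c i *: (Y ^+ i * X ^+ (n - i)).
have numE (c : {ffun _ -> k}) : a%:F / b%:F - \sum_(i < n) (c i)%:MP%:F * ((Y ^+ i)%:F / (X ^+ i)%:F) =
              (num c)%:F / (b * X ^+ n)%:F.
  have bF0 : b%:F != 0 by rewrite tofrac_eq0 nz_evalp.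
  rewrite (tofracM b) tofracXn /num tofracB (tofracM a) (tofracM b) tofracXn.
  under eq_bigr do rewrite !tofracXn.
  rewrite (sub_sum_ratio _ _ _ bF0 XF0); congr ((_ - _ * _) / _).
  rewrite rmorph_sum; apply: eq_bigr => i _.
  by rewrite /= -mul_mpolyC !tofracM !tofracXn.
have hsum (c : {ffun _ -> k}) : \sum_(i < n) c i *: (Y ^+ i * X ^+ (n - i)) \is n.-homog.
  apply: rpred_sum => i _; apply: rpredZ.
  by have := dhomogM (hYi i) (hXi (n - i)%N); rewrite subnKC // ltnW.
have hnum (c : {ffun _ -> k}) : num c \is (m + n).-homog.
  by apply: rpredB; apply: dhomogM.
have hden : b * X ^+ n \is (m + n).-homog by apply: dhomogM.
have den0 : evalp (b * X ^+ n) P != 0.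
  by rewrite /evalp rmorphM rmorphXn mulf_neq0 ?expf_neq0.
(* The coordinates become the coefficients of a polynomial, and membership in the ideal says that
   this polynomial agrees with a/b to order [n] at the parameter 0. *)
have crit (c : {ffun _ -> k}) : local_ideal P f g (a%:F / b%:F - \sum_(i < n) (c i)%:MP%:F *
     ((Y ^+ i)%:F / (X ^+ i)%:F)) <->
   'X^n %| ev phi a - ev phi b * \poly_(i < n) (if insub i is Some j then c j else 0).
  rewrite numE (local_ideal_ord (hnum c) hden den0) /num rmorphB !rmorphM /=.
  rewrite rmorphXn /= evX1 expr1n mulr1 rmorph_sum poly_def.
  suff -> : \sum_(i < n) ev phi (c i *: (Y ^+ i * X ^+ (n - i))) =
     \sum_(i < n) (if insub (val i) is Some j then c j else 0) *: 'X^i by [].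
  apply: eq_bigr => i _; rewrite valK evZ rmorphM !rmorphXn /= evX1 evYX expr1n.
  by rewrite mulr1 mul_polyC.
have cop := coprime_Xn hb b0.
(* [v] inverts the restriction of [b] modulo ['X^n], so the remainder [w] is the truncated expansion
   of a/b, whose coefficients are the coordinates sought. *)
have [[u v] /= huv] := (Bezout_eq1_coprimepP _ _ cop).
pose w := (v * ev phi a) %% 'X^n.
have h1 : 'X^n %| u * 'X^n * ev phi a by rewrite dvdp_mulr // dvdp_mull.
have h2 : 'X^n %| ev phi b * (v * ev phi a - w).
  by rewrite dvdp_mull // {1}(divp_eq (v * ev phi a) 'X^n) addrK dvdp_mull.
have sw : (size w <= n)%N.
  by rewrite -ltnS -(size_polyXn k n) ltn_modp monic_neq0 ?monicXn.
exists [ffun i : 'I_n => w`_i]; split.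
  apply/crit.
  have -> : \poly_(i < n) (if insub i is Some j then [ffun i : 'I_n => w`_i] j else 0) = w.
    apply/polyP => i; rewrite coef_poly; case: ltnP => hi.
      by rewrite insubT ffunE.
    by rewrite nth_default // (leq_trans sw).
  have -> : ev phi a - ev phi b * w = u * 'X^n * ev phi a
      + ev phi b * (v * ev phi a - w).
    by rewrite mulrBr addrA; congr (_ - _); rewrite -[LHS]mul1r -huv; ring.
  exact: dvdp_add.
move=> c /crit hc; apply/ffunP => i; rewrite ffunE.
set pc := \poly_(i < n) _ in hc.
have spc : (size pc <= n)%N by apply: size_poly.
have : 'X^n %| pc - w.
  have : 'X^n %| ev phi b * (pc - w).
    have -> : ev phi b * (pc - w) = u * 'X^n * ev phi a + ev phi b * (v * ev phi a - w)
       - (ev phi a - ev phi b * pc).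
      have -> : u * 'X^n * ev phi a = ev phi a - ev phi b * (v * ev phi a).
        by rewrite -[X in _ = X - _]mul1r -huv; ring.
      by ring.
    by apply: dvdp_sub hc; apply: dvdp_add.
  by rewrite Gauss_dvdpr.
have [h0|h0] := eqVneq (pc - w) 0.
  move=> _; have := congr1 (fun p : {poly k} => p`_i) (subr0_eq h0).
  by rewrite /= coef_poly ltn_ord valK.
move=> /(dvdp_leq h0); rewrite size_polyXn ltnNge => /negP [];
by rewrite (leq_trans (size_polyD _ _)) // size_polyN geq_max spc sw.
Qed.

End LocalIntersection.

(** * Uniqueness of the intersection multiplicity *)

Section IntersectionUnique.

Variables (k : closedFieldType) (P : ppoint k) (f g : {mpoly k[3]}).
Local Notation poly3 := {mpoly k[3]}.
Local Notation "c %:K" := (c%:MP_[3]%:F : {fraction poly3}).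

Lemma local_ideal0 : local_ideal P f g 0.
Proof.
exists 0%N, 0, 1; split; rewrite ?rpred0 ?dhomog1 //.
- by rewrite /evalp meval1 oner_neq0.
- by rewrite tofrac0 mul0r.
by exists 0, 0; rewrite !mul0r addr0.
Qed.

Lemma local_idealD x y :
  local_ideal P f g x -> local_ideal P f g y -> local_ideal P f g (x + y).
Proof.
move=> [m [a [b [ha hb b0 -> [u [v aE]]]]]] [m' [a' [b' [ha' hb' b0' -> [u' [v' aE']]]]]].
exists (m + m')%N, (a * b' + a' * b), (b * b'); split.
- by apply: rpredD; [exact: dhomogM | rewrite addnC; exact: dhomogM].
- exact: dhomogM.
- by rewrite /evalp mevalM mulf_neq0.
- by rewrite addf_div ?tofrac_eq0 ?(nz_evalp b0) ?(nz_evalp b0') // tofracD !tofracM.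
exists (u * b' + u' * b), (v * b' + v' * b); rewrite aE aE'; ring.
Qed.

Lemma local_idealZ c x : local_ideal P f g x -> local_ideal P f g (c%:K * x).
Proof.
move=> [m [a [b [ha hb b0 -> [u [v aE]]]]]].
exists m, (c *: a), b; split => //; first exact: dhomogZ.
  by rewrite -mul_mpolyC tofracM mulrA.
by exists (c *: u), (c *: v); rewrite aE scalerDr -!scalerAl.
Qed.

Lemma local_ideal_sum (I : finType) (F : I -> {fraction poly3}) :
  (forall i, local_ideal P f g (F i)) -> local_ideal P f g (\sum_i F i).
Proof.
by move=> h; elim/big_ind: _ => //; [exact: local_ideal0 | exact: local_idealD].
Qed.

(** Expanding each family in the other gives matrices whose product is the identity, because
    expansions in the second family are unique; the rank of this product is at most [n]. *)
Lemma intersection_mult_leq n n' :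
  intersection_mult P f g n -> intersection_mult P f g n' -> (n' <= n)%N.
Proof.
move=> [e [he e_basis]] [e' [he' e'_basis]].
have [A hA] := choice (fun j => e_basis _ (he' j)).
have [B hB] := choice (fun i => e'_basis _ (he i)).
pose MA : 'M[k]_(n', n) := \matrix_(j, i) A j i.
pose MB : 'M[k]_(n, n') := \matrix_(i, j) B i j.
suff AB : MA *m MB = 1%:M.
  by rewrite -(mxrank1 k n') -AB (leq_trans (mxrankM_maxl _ _)) ?rank_leq_col.
apply/row_matrixP => j.
have [c [_ c_unique]] := e'_basis _ (he' j).
have c1 : c = [ffun l => (j == l)%:R].
  apply: c_unique; rewrite (bigD1 j) //= ffunE eqxx mpolyC1 tofrac1 mul1r.
  rewrite opprD addrA subrr add0r big1 ?oppr0; last first.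
    by move=> i ij; rewrite ffunE eq_sym (negbTE ij) mpolyC0 tofrac0 mul0r.
  exact: local_ideal0.
have c2 : c = [ffun l => \sum_i A j i * B i l].
  apply: c_unique.
  have -> : e' j - \sum_l ([ffun l => \sum_i A j i * B i l] l)%:K * e' l =
     (e' j - \sum_i (A j i)%:K * e i) +
     \sum_i (A j i)%:K * (e i - \sum_l (B i l)%:K * e' l).
    rewrite -addrA; congr (_ + _).
    under [X in _ = - _ + X]eq_bigr do rewrite mulrBr.
    rewrite sumrB addKr; congr (- _).
    under [RHS]eq_bigr do rewrite mulr_sumr.
    rewrite exchange_big; apply: eq_bigr => l _.
    rewrite ffunE rmorph_sum /= rmorph_sum mulr_suml; apply: eq_bigr => i _.
    by rewrite mulrA -tofracM -mpolyCM.
  apply: local_idealD; first by case: (hA j).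
  by apply: local_ideal_sum => i; apply: local_idealZ; case: (hB i).
apply/rowP => l; rewrite !mxE.
have := congr1 (fun c : {ffun _ -> k} => c l) c2; rewrite c1 !ffunE => ->.
by apply: eq_bigr => i _; rewrite !mxE.
Qed.

Lemma intersection_mult_unique n n' :
  intersection_mult P f g n -> intersection_mult P f g n' -> n = n'.
Proof.
by move=> h h'; apply/eqP; rewrite eqn_leq !(intersection_mult_leq h, intersection_mult_leq h').
Qed.

End IntersectionUnique.

(** * Finite cardinalities *)

Lemma has_card_image (I : eqType) (T : Type) (f : I -> T) (s : seq I) :
  uniq s -> {in s &, injective f} -> has_card (f @` [set` s]) (size s).
Proof.
move=> us fI; have [/size0nil ->|] := posnP (size s).
  by rewrite set_nil image_set0 /has_card II0 card_eq0.
case E : {1}s => [//|x0 s0] _ {E s0}.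
have -> : f @` [set` s] = (f \o nth x0 s) @` `I_(size s).
  apply/seteqP; split => [_ [i /= si <-]|_ [n /= hn <-]].
    exists (index i s); first by move: si; rewrite -index_mem.
    by rewrite /= nth_index.
  by exists (nth x0 s n) => //=; rewrite mem_nth.
apply: inj_card_eq => m n; rewrite !inE => hm hn /= /fI e.
by apply/eqP; rewrite -(nth_uniq x0 hm hn us); apply/eqP/e; rewrite mem_nth.
Qed.

Lemma has_card_inj (T : Type) (A : set T) n m :
  has_card A n -> has_card A m -> n = m.
Proof. by move=> /card_esym An Am; apply/card_eq_II; apply: card_eq_trans An Am. Qed.

Lemma has_card_seq (T : eqType) (A : set T) n : has_card A n ->
  exists s : seq T, [/\ uniq s, size s = n & A = [set` s]].
Proof.
elim: n A => [|n IH] A.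
  rewrite /has_card II0 card_eq0 => /eqP ->.
  by exists [::]; split => //; rewrite set_nil.
move=> /eq_cardSP [x Ax /IH [s [us <- As]]]; exists (x :: s); split => //=.
  rewrite us andbT; apply/negP => xs.
  by have [_ []] : (A `\ x) x by rewrite As.
apply/seteqP; split => y /=; rewrite inE.
  move=> Ay; have [->//|yx] := eqVneq y x.
  by have : (A `\ x) y by [split => //; apply/eqP]; rewrite As.
case/orP => [/eqP ->//|ys]; have : [set` s] y by [].
by rewrite -As => -[].
Qed.

(** * Points and curves given by representatives *)

Section Projective.

Variables (k : fieldType) (V : vectType k).
Implicit Types U W : proj V.

Lemma rep_neq0 U : rep U != 0.
Proof.
by rewrite vpick0; apply/eqP => h; have := valP U; rewrite /= h dimv0.
Qed.

Lemma val_rep U : val U = <[rep U]>%VS.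
Proof.
apply/eqP; rewrite eq_sym eqEdim (eqP (valP U)) dim_vline rep_neq0 andbT.
by rewrite -memvE memv_pick.
Qed.

Lemma proj_inj U W c : rep U = c *: rep W -> U = W.
Proof.
move=> e; apply/val_inj; rewrite (val_rep W); apply/eqP.
rewrite eqEdim (eqP (valP U)) dim_vline rep_neq0 andbT val_rep -memvE.
by apply/vlineP; exists c.
Qed.

Lemma proj_exists (v : V) : v != 0 ->
  exists U : proj V, exists2 c, c != 0 & rep U = c *: v.
Proof.
move=> v0; have h : \dim <[v]>%VS == 1 by rewrite dim_vline v0.
pose U : proj V := exist (fun U : {vspace V} => is_true (\dim U == 1%N)) _ h.
exists U; have := memv_pick <[v]>%VS => /vlineP [c hc].
exists c => //; apply: contra_neq (rep_neq0 U) => c0.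
by rewrite /rep /= hc c0 scale0r.
Qed.

End Projective.

Section Points.

Variable k : closedFieldType.
Local Notation poly3 := {mpoly k[3]}.
Local Notation rV3 := 'rV[k]_3.

Definition mev (f : poly3) (u : rV3) : k := f.@[fun i => u 0 i].

Lemma mevZ d (f : poly3) c u : f \is d.-homog -> mev f (c *: u) = c ^+ d * mev f u.
Proof.
by move=> hf; rewrite /mev -meval_dhomog //; apply: meval_eq => i; rewrite mxE.
Qed.

Lemma const_mx1_neq0 : const_mx 1 != 0 :> rV3.
Proof.
by apply/eqP => /rowP /(_ 0); rewrite !mxE => /eqP; rewrite oner_eq0.
Qed.

(* Junk value at [u = 0]: some fixed point. *)
Definition pt (u : rV3) : ppoint k :=
  if pselect (u != 0) is left h then projT1 (cid (proj_exists h))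
  else projT1 (cid (proj_exists const_mx1_neq0)).

Lemma rep_pt u : u != 0 -> exists2 c, c != 0 & rep (pt u) = c *: u.
Proof. by rewrite /pt; case: pselect => // h _; case: cid. Qed.

Lemma pt_eq u w c : u != 0 -> u = c *: w -> pt u = pt w.
Proof.
move=> u0 uw; have w0 : w != 0 by apply: contra_neq u0; rewrite uw => ->; rewrite scaler0.
have [a a0 ha] := rep_pt u0; have [b b0 hb] := rep_pt w0.
apply: (@proj_inj _ _ _ _ (a * c / b)).
by rewrite ha hb uw !scalerA divfK.
Qed.

Lemma pt_eqP u w : u != 0 -> w != 0 -> pt u = pt w -> exists2 c, c != 0 & u = c *: w.
Proof.
move=> u0 w0 e; have [a a0 ha] := rep_pt u0; have [b b0 hb] := rep_pt w0.
exists (a^-1 * b); first by rewrite mulf_neq0 ?invr_eq0.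
by rewrite -scalerA -hb -e ha scalerA mulVf ?scale1r.
Qed.

Lemma pt_rep P : pt (rep P) = P.
Proof.
have [c c0 hc] := rep_pt (rep_neq0 P); exact: proj_inj hc.
Qed.

Lemma form_homog d (C : pcurve k d) : form C \is d.-homog.
Proof. exact: dhomog_is_dhomog. Qed.

Lemma form_neq0 d (C : pcurve k d) : form C != 0.
Proof.
by apply: contra_neq (rep_neq0 C) => h; apply/val_inj; exact: h.
Qed.

Lemma evalp_pt d (f : poly3) u : f \is d.-homog -> u != 0 ->
  (evalp f (pt u) == 0) = (mev f u == 0).
Proof.
move=> hf /rep_pt [c c0 hc]; rewrite -[evalp _ _]/(mev f _) hc (mevZ _ _ hf).
by rewrite mulf_eq0 expf_eq0 (negbTE c0) andbF.
Qed.

Lemma points_pt d (C : pcurve k d) (u : rV3) : u != 0 ->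
  points C (pt u) <-> mev (form C) u = 0.
Proof.
move=> u0; have := evalp_pt (form_homog C) u0; rewrite /points /=.
by move=> h; split=> /eqP h'; apply/eqP; rewrite ?h // -h.
Qed.

Lemma curve_exists d (f : poly3) : f \is d.-homog -> f != 0 ->
  exists C : pcurve k d, exists2 c, c != 0 & form C = c *: f.
Proof.
move=> hf f0; have F0 : DHomog hf != 0.
  by apply: contra_neq f0 => /(congr1 val).
have [C [c c0 hc]] := proj_exists F0.
by exists C, c => //; rewrite /form hc.
Qed.

Lemma curve_eq d (C C' : pcurve k d) c : form C = c *: form C' -> C = C'.
Proof. by move=> h; apply: (@proj_inj _ _ _ _ c); apply/val_inj. Qed.

End Points.

(** * Conics *)

Notation i0 := (@Ordinal 3 0 isT).
Notation i1 := (@Ordinal 3 1 isT).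
Notation i2 := (@Ordinal 3 2 isT).

Lemma ord3_ind (P : 'I_3 -> Prop) : P i0 -> P i1 -> P i2 -> forall i, P i.
Proof.
move=> P0 P1 P2 [[|[|[|//]]] h].
- by rewrite (_ : Ordinal h = i0) //; apply/val_inj.
- by rewrite (_ : Ordinal h = i1) //; apply/val_inj.
- by rewrite (_ : Ordinal h = i2) //; apply/val_inj.
Qed.

Lemma sum3E (V : nmodType) (F : 'I_3 -> V) : \sum_i F i = F i0 + F i1 + F i2.
Proof.
rewrite !big_ord_recl big_ord0 addr0 addrA.
by congr (F _ + F _ + F _); apply/val_inj.
Qed.

Lemma row3P (T : Type) (u w : 'rV[T]_3) :
  u 0 i0 = w 0 i0 -> u 0 i1 = w 0 i1 -> u 0 i2 = w 0 i2 -> u = w.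
Proof. by move=> ? ? ?; apply/rowP; apply: ord3_ind. Qed.

Definition quad (R : comNzRingType) (x : 'rV[R]_3) : R :=
  x 0 i0 * x 0 i2 - x 0 i1 ^+ 2.

Lemma mdeg2_split (m : 'X_{1..3}) : mdeg m = 2 -> exists i j, m = (U_(i) + U_(j))%MM.
Proof.
move=> hm; have [i hi] : exists i, m i != 0.
  apply/existsP; apply: contraTT isT; rewrite negb_exists => /forallP h.
  move: hm; rewrite mdegE big1 // => i _; exact/eqP/negPn/h.
have le_im : (U_(i) <= m)%MM by rewrite lep1mP.
have : mdeg (m - U_(i)) == 1.
  by rewrite -(eqn_add2r (mdeg U_(i))) -mdegD submK // hm mdeg1.
by move=> /mdeg1P [j /eqP hj]; exists i, j; rewrite addmC -hj submK.
Qed.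

Lemma row_unitmx_neq0 (F : fieldType) n (N : 'M[F]_n) i : N \in unitmx -> row i N != 0.
Proof.
move=> uN; apply/eqP => h; have := congr1 (fun r => (r *m invmx N) 0 i) h.
rewrite -row_mul mulmxV // mul0mx !mxE eqxx => /eqP.
by rewrite oner_eq0.
Qed.

Definition rows3 (T : Type) (a b c : 'rV[T]_3) : 'M[T]_3 :=
  \matrix_(i, j) nth c [:: a; b] i 0 j.

Lemma row_rows3 (T : Type) (a b c : 'rV[T]_3) i : row i (rows3 a b c) = nth c [:: a; b] i.
Proof. by apply/rowP => j; rewrite !mxE. Qed.

Section Conics.

Variable k : closedFieldType.
Local Notation poly3 := {mpoly k[3]}.
Local Notation rV3 := 'rV[k]_3.
Implicit Types (N : 'M[k]_3) (f : poly3) (u : rV3).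

Lemma dhomog2_expand f : f \is 2.-homog ->
  exists a : 'I_3 -> 'I_3 -> k, f = \sum_i \sum_j a i j *: ('X_i * 'X_j).
Proof.
move=> /dhomogP hf; rewrite {1}(mpolyE f) big_seq.
apply: (big_ind (fun p : poly3 => exists a : 'I_3 -> 'I_3 -> k,
  p = \sum_i \sum_j a i j *: ('X_i * 'X_j))) => [|p q [a ->] [b ->]|m /hf hm].
- exists (fun _ _ => 0); rewrite big1 // => i _; rewrite big1 // => j _.
  exact: scale0r.
- exists (fun i j => a i j + b i j); rewrite -big_split; apply: eq_bigr => i _ /=.
  by rewrite -big_split; apply: eq_bigr => j _ /=; rewrite scalerDl.
have [i [j ->]] := mdeg2_split hm.
exists (fun i' j' => f@_(U_(i) + U_(j)) *+ ((i' == i) && (j' == j))).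
rewrite (bigD1 i) //= (bigD1 j) //= !eqxx mulr1n -mpolyXD.
rewrite big1 ?addr0 => [|j' /negbTE ->]; last by rewrite scale0r.
rewrite big1 ?addr0 // => i' /negbTE ->; rewrite big1 // => j' _.
by rewrite scale0r.
Qed.

Lemma dhomog1_expand f : f \is 1.-homog ->
  exists a : 'I_3 -> k, f = \sum_i a i *: 'X_i.
Proof.
move=> /dhomogP hf; rewrite {1}(mpolyE f) big_seq.
apply: (big_ind (fun p : poly3 => exists a : 'I_3 -> k,
  p = \sum_i a i *: 'X_i)) => [|p q [a ->] [b ->]|m /hf /eqP /mdeg1P [i /eqP ->]].
- by exists (fun _ => 0); rewrite big1 // => i _; exact: scale0r.
- exists (fun i => a i + b i); rewrite -big_split; apply: eq_bigr => i _ /=.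
  by rewrite scalerDl.
exists (fun i' => f@_(U_(i)) *+ (i' == i)).
rewrite (bigD1 i) //= eqxx mulr1n big1 ?addr0 // => i' /negbTE ->.
by rewrite scale0r.
Qed.

(** The linear forms dual to the rows of [N]: the value at [u] is the coefficient of row [j] in
    [u]. *)
Definition coord N (j : 'I_3) : poly3 := \sum_i invmx N i j *: 'X_i.

Lemma coord_homog N j : coord N j \is 1.-homog.
Proof. by apply: rpred_sum => i _; apply: rpredZ; rewrite dhomogX /= mdeg1. Qed.

Lemma mev_coord N j u : mev (coord N j) u = (u *m invmx N) 0 j.
Proof.
rewrite /mev rmorph_sum mxE; apply: eq_bigr => i _ /=.
by rewrite mevalZ mevalXU mulrC.
Qed.

Lemma ev_coord N j (phi : 'rV[{poly k}]_3) :
  ev (fun i => phi 0 i) (coord N j) = (phi *m map_mx polyC (invmx N)) 0 j.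
Proof.
rewrite rmorph_sum mxE; apply: eq_bigr => i _ /=.
by rewrite evZ evX mxE mulrC.
Qed.

Lemma coordK N : N \in unitmx -> forall i, 'X_i = \sum_j N j i *: coord N j.
Proof.
move=> uN i; under eq_bigr do rewrite scaler_sumr.
rewrite exchange_big /= (bigD1 i) //= [X in _ + X]big1 ?addr0.
  under eq_bigr do rewrite scalerA mulrC.
  rewrite -scaler_suml; have := congr1 (fun M : 'M_3 => M i i) (mulVmx uN).
  by rewrite !mxE eqxx => ->; rewrite scale1r.
move=> l li; under eq_bigr do rewrite scalerA mulrC.
rewrite -scaler_suml; have := congr1 (fun M : 'M_3 => M l i) (mulVmx uN).
by rewrite !mxE (negbTE li) => ->; rewrite scale0r.
Qed.

Definition conic_form N : poly3 := coord N i0 * coord N i2 - coord N i1 ^+ 2.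

Lemma conic_form_homog N : conic_form N \is 2.-homog.
Proof.
apply: rpredB; first exact: (dhomogM (coord_homog N _) (coord_homog N _)).
exact: (dhomogMn 2 (coord_homog N _)).
Qed.

Lemma mev_conic_form N u : mev (conic_form N) u = quad (u *m invmx N).
Proof.
by rewrite /quad -!mev_coord /conic_form /mev rmorphB rmorphM rmorphXn.
Qed.

Lemma ev_conic_form N (phi : 'rV[{poly k}]_3) :
  ev (fun i => phi 0 i) (conic_form N) = quad (phi *m map_mx polyC (invmx N)).
Proof.
by rewrite /quad -!ev_coord /conic_form rmorphB rmorphM rmorphXn.
Qed.

Definition veronese : 'rV[{poly k}]_3 := \row_j 'X^j.

Lemma quad_veronese : quad veronese = 0.
Proof. by rewrite /quad !mxE /= expr0 mul1r expr1 subrr. Qed.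

(** The curve (1, t, t^2) carried by [N]: parameter 0 is row 0, and infinity is row 2. *)
Definition conic_param N : 'rV[{poly k}]_3 := veronese *m map_mx polyC N.

Lemma conic_paramE N i : conic_param N 0 i = \poly_(j < 3) N (inord j) i.
Proof.
rewrite mxE poly_def; apply: eq_bigr => j _; rewrite !mxE inord_val.
by rewrite mulrC mul_polyC.
Qed.

Lemma size_conic_param N i : (size (conic_param N 0%R i) <= 3)%N.
Proof. by rewrite conic_paramE size_poly. Qed.

Lemma conic_param0 N i : (conic_param N 0 i).[0] = N i0 i.
Proof.
rewrite conic_paramE horner_coef0 coef_poly /=.
by congr (N _ _); apply/val_inj; rewrite /= inordK.
Qed.

Lemma conic_paramMV N : N \in unitmx ->
  conic_param N *m map_mx polyC (invmx N) = veronese.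
Proof. by move=> uN; rewrite -mulmxA -map_mxM mulmxV // map_mx1 mulmx1. Qed.

Lemma ev_param_coord N j : N \in unitmx ->
  ev (fun i => conic_param N 0 i) (coord N j) = 'X^j.
Proof. by move=> uN; rewrite ev_coord conic_paramMV // mxE. Qed.

(** The contributions of rows 0 and 1 cancel; in row 2 the product of the outer coordinates faces
    the square of the middle one. *)
Lemma homogenize_conic_param N i : N \in unitmx ->
  coord N i0 * 'X_i - homogenize (coord N i0) (coord N i1) 2 (conic_param N 0 i) =
  (N i2 i)%:MP * conic_form N.
Proof.
move=> uN; rewrite (coordK uN) /homogenize !sum3E /= conic_paramE !coef_poly /=.
have -> : inord 0 = i0 by apply/val_inj; rewrite /= inordK.
have -> : inord 1 = i1 by apply/val_inj; rewrite /= inordK.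
have -> : inord 2 = i2 by apply/val_inj; rewrite /= inordK.
by rewrite -!mul_mpolyC /conic_form; ring.
Qed.

Definition param_by (Q : pcurve k 2) N : Prop :=
  N \in unitmx /\ ev (fun i => conic_param N 0 i) (form Q) = 0.

(** In the coordinates of [N], the restriction of a quadratic form to (1, t, t^2) is a quartic
    polynomial. The vanishing of its five coefficients leaves a single free parameter among the six
    of the form. *)
Lemma dhomog2_param N f : N \in unitmx -> f \is 2.-homog ->
  ev (fun i => conic_param N 0 i) f = 0 -> exists c, f = c *: conic_form N.
Proof.
move=> uN /dhomog2_expand [a fE].
pose b i j := \sum_l \sum_m a l m * N i l * N j m.
have -> : f = \sum_i \sum_j b i j *: (coord N i * coord N j).
  transitivity (\sum_i \sum_j a i j *:
     ((\sum_l N l i *: coord N l) * (\sum_m N m j *: coord N m))).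
    by rewrite fE; apply: eq_bigr => i _; apply: eq_bigr => j _; rewrite -!coordK.
  pose T i j l m := (a i j * N l i * N m j) *: (coord N l * coord N m).
  transitivity (\sum_i \sum_j \sum_l \sum_m T i j l m).
    apply: eq_bigr => i _; apply: eq_bigr => j _; rewrite big_distrlr scaler_sumr /=.
    apply: eq_bigr => l _; rewrite scaler_sumr; apply: eq_bigr => m _.
    by rewrite -scalerAl -scalerAr !scalerA.
  under eq_bigr do rewrite exchange_big /=; rewrite exchange_big /=; apply: eq_bigr => l _.
  under eq_bigr do rewrite exchange_big /=; rewrite exchange_big /=; apply: eq_bigr => m _.
  rewrite /b scaler_suml; apply: eq_bigr => i _; by rewrite scaler_suml.
(* The matrix [b] is not assumed symmetric, so the coefficient of the product of coordinates 0 and 2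
   is a sum of two entries. *)
rewrite rmorph_sum => hb; exists (b i0 i2 + b i2 i0).
have coefb s : \sum_i \sum_j b i j *+ (s == i + j)%N = 0.
  have := congr1 (fun p : {poly k} => p`_s) hb.
  rewrite /= coef0 coef_sum => e; rewrite -[RHS]e; apply: eq_bigr => i _.
  rewrite rmorph_sum coef_sum; apply: eq_bigr => j _.
  rewrite /= evZ rmorphM /= !ev_param_coord // -exprD coefCM coefXn.
  by rewrite mulr_natr.
have := coefb 0; have := coefb 1; have := coefb 2; have := coefb 3; have := coefb 4.
rewrite !sum3E /= !mulr0n !mulr1n ?addr0 ?add0r => h4 h3 h2 h1 h0.
have -> : b i1 i1 = - (b i0 i2 + b i2 i0).
  by apply/eqP; rewrite -addr_eq0 -[X in _ == X]h2; apply/eqP; ring.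
have -> : b i1 i0 = - b i0 i1 by apply/eqP; rewrite -addr_eq0 addrC h1.
have -> : b i2 i1 = - b i1 i2 by apply/eqP; rewrite -addr_eq0 addrC h3.
rewrite h0 h4 /conic_form -!mul_mpolyC !rmorphN !rmorphD /= mpolyC0; ring.
Qed.

Lemma param_by_form Q N : param_by Q N ->
  exists2 c, c != 0 & form Q = c *: conic_form N.
Proof.
move=> [uN hQ]; have [c hc] := dhomog2_param uN (form_homog Q) hQ.
by exists c => //; apply: contra_neq (form_neq0 Q) => c0; rewrite hc c0 scale0r.
Qed.

Lemma param_by_unique Q Q' N : param_by Q N -> param_by Q' N -> Q = Q'.
Proof.
move=> /param_by_form [c c0 hc] /param_by_form [c' c0' hc'].
by apply: (@curve_eq _ _ _ _ (c / c')); rewrite hc hc' scalerA divfK.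
Qed.

Lemma param_by_points Q N u : param_by Q N -> u != 0 ->
  points Q (pt u) <-> quad (u *m invmx N) = 0.
Proof.
move=> /param_by_form [c c0 hc] u0; rewrite points_pt // hc -mev_conic_form.
rewrite /mev mevalZ; split => [/eqP|->]; last by rewrite mulr0.
by rewrite mulf_eq0 (negbTE c0) => /eqP.
Qed.

Lemma param_by_exists N : N \in unitmx -> exists Q, param_by Q N.
Proof.
move=> uN; have f0 : conic_form N != 0.
  apply/eqP => /(congr1 (fun f => mev f (\row_j (j != i1)%:R *m N))).
  rewrite mev_conic_form mulmxK // /quad !mxE /= mul1r expr0n subr0.
  by rewrite /mev meval0 => /eqP; rewrite oner_eq0.
have [Q [c c0 hc]] := curve_exists (conic_form_homog N) f0.
exists Q; split => //; rewrite hc evZ ev_conic_form conic_paramMV //.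
by rewrite quad_veronese mulr0.
Qed.

Lemma param_by_reparam Q N S : S \in unitmx -> quad (conic_param S) = 0 ->
  param_by Q N -> param_by Q (S *m N).
Proof.
move=> uS hS hQ; have [uN _] := hQ; have [c c0 hc] := param_by_form hQ.
split; first by rewrite unitmx_mul uS.
rewrite hc evZ ev_conic_form /conic_param map_mxM mulmxA -[_ *m _ *m map_mx _ (invmx N)]mulmxA.
by rewrite -map_mxM mulmxV // map_mx1 mulmx1 hS mulr0.
Qed.

Theorem conic_intersection_mult Q N d n (g : poly3) (G : {poly k}) :
  param_by Q N -> g \is d.-homog -> G.[0] != 0 ->
  ev (fun i => conic_param N 0 i) g = 'X^n * G ->
  intersection_mult (pt (row i0 N)) (form Q) g n.
Proof.
move=> hQ hg hG evg; have [uN hQ0] := hQ.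
have [c c0 hc] := param_by_form hQ.
have row0 : row i0 N != 0 by exact: row_unitmx_neq0.
have [rho rho0 hrho] := rep_pt row0.
apply: (@intersection_mult_ord k _ (fun i => conic_param N 0 i) rho rho0 _
  (coord N i0) (coord N i1) _ _ _ _ _ _ hQ0 _ _ d n G hg evg hG).
- by move=> i; rewrite hrho conic_param0 !mxE.
- exact: coord_homog.
- exact: coord_homog.
- by rewrite ev_param_coord.
- by rewrite ev_param_coord.
- exact: size_conic_param.
move=> i; exists ((N i2 i / c)%:MP); rewrite homogenize_conic_param // hc.
by rewrite -mul_mpolyC mulrA -rmorphM /= divfK.
Qed.

End Conics.

(** * Hermitian forms and totally tangent conics *)

Lemma det3E (R : comPzRingType) (M : 'M[R]_3) : \det M =
  M i0 i0 * (M i1 i1 * M i2 i2 - M i1 i2 * M i2 i1)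
  - M i0 i1 * (M i1 i0 * M i2 i2 - M i1 i2 * M i2 i0)
  + M i0 i2 * (M i1 i0 * M i2 i1 - M i1 i1 * M i2 i0).
Proof.
rewrite (expand_det_row _ i0) sum3E /cofactor.
rewrite !(expand_det_row _ 0) !big_ord_recl !big_ord0 /cofactor !det_mx11 !mxE /=.
have [F E] : exists F : nat -> nat -> R, forall a b, M a b = F (val a) (val b).
  by exists (fun i j => M (inord i) (inord j)) => a b; rewrite !inord_val.
rewrite !E /= /bump /= !addr0; ring.
Qed.

Lemma mul_row3E (R : pzRingType) (x : 'rV[R]_3) (M : 'M[R]_3) j :
  (x *m M) 0 j = x 0 i0 * M i0 j + x 0 i1 * M i1 j + x 0 i2 * M i2 j.
Proof. by rewrite mxE sum3E. Qed.

Lemma expr5D (R : comNzRingType) (x y : R) : 5%:R = 0 :> R ->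
  (x + y) ^+ 5 = x ^+ 5 + y ^+ 5.
Proof.
move=> h5; have -> : (x + y) ^+ 5 = x ^+ 5 + y ^+ 5 + 5%:R *
  (x ^+ 4 * y + 2%:R * x ^+ 3 * y ^+ 2 + 2%:R * x ^+ 2 * y ^+ 3 + x * y ^+ 4) by ring.
by rewrite h5 mul0r addr0.
Qed.

Lemma polyC_char5 (k : comNzRingType) : 5%:R = 0 :> k -> 5%:R = 0 :> {poly k}.
Proof. by move=> h; rewrite -polyC_natr h. Qed.

(* The Hermitian form with Gram matrix antidiag(1, -2, 1), for which
   the conic [quad = 0] is totally tangent to the curve of isotropic vectors. *)
Definition herm (R : comNzRingType) (x y : 'rV[R]_3) : R :=
  x 0 i0 * y 0 i2 ^+ 5 - 2%:R * x 0 i1 * y 0 i1 ^+ 5 + x 0 i2 * y 0 i0 ^+ 5.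

Definition gram (R : comNzRingType) (i j : 'I_3) : R :=
  if (i + j == 2)%N then if i == i1 then - 2%:R else 1 else 0.

Lemma hermE (R : comNzRingType) (x y : 'rV[R]_3) :
  herm x y = \sum_i \sum_j x 0 i * y 0 j ^+ 5 * gram R i j.
Proof. by rewrite !sum3E /gram /= /herm; ring. Qed.

(** The second argument enters through fifth powers, which are additive in characteristic 5, so the
    form is sesquilinear. *)
Lemma herm_mul (R : comNzRingType) (x y : 'rV[R]_3) (M : 'M[R]_3) : 5%:R = 0 :> R ->
  herm (x *m M) (y *m M) =
  \sum_i \sum_j x 0 i * y 0 j ^+ 5 * herm (row i M) (row j M).
Proof.
move=> h5; rewrite !sum3E /herm !mul_row3E !mxE !(expr5D _ _ h5) !exprMn.
by ring.
Qed.

Lemma herm_scale (R : comNzRingType) (a b : R) (x y : 'rV[R]_3) :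
  herm (a *: x) (b *: y) = a * b ^+ 5 * herm x y.
Proof. by rewrite /herm !mxE !exprMn; ring. Qed.

Definition unitary (R : comNzRingType) (mu : R) (M : 'M[R]_3) : Prop :=
  forall i j, herm (row i M) (row j M) = mu * gram R i j.

Lemma unitary_herm (R : comNzRingType) mu (M : 'M[R]_3) (x y : 'rV[R]_3) :
  5%:R = 0 :> R -> unitary mu M -> herm (x *m M) (y *m M) = mu * herm x y.
Proof.
move=> h5 hM; rewrite herm_mul // hermE mulr_sumr; apply: eq_bigr => i _.
by rewrite mulr_sumr; apply: eq_bigr => j _; rewrite hM; ring.
Qed.

Lemma herm_map (R S : comNzRingType) (f : {rmorphism R -> S}) (x y : 'rV[R]_3) :
  herm (map_mx f x) (map_mx f y) = f (herm x y).
Proof. by rewrite /herm !mxE rmorphD rmorphB !rmorphM rmorph_nat. Qed.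

Lemma gram_map (R S : comNzRingType) (f : {rmorphism R -> S}) i j :
  gram S i j = f (gram R i j).
Proof.
by rewrite /gram; case: ifP => _; [case: ifP => _|]; rewrite ?(rmorph1, rmorph0, rmorphN, rmorph_nat).
Qed.

Lemma unitary_map (R S : comNzRingType) (f : {rmorphism R -> S}) mu (M : 'M[R]_3) :
  unitary mu M -> unitary (f mu) (map_mx f M).
Proof.
by move=> h i j; rewrite -!map_row herm_map h rmorphM (gram_map f).
Qed.

Lemma root_exists (k : closedFieldType) n (c : k) : (0 < n)%N -> exists x, x ^+ n = c.
Proof.
case: n => // n _; have [x hx] := @solve_monicpoly k n.+1 (fun i => if i is 0 then c else 0) isT.
exists x; rewrite hx big_ord_recl /= expr0 mulr1 big1 ?addr0 // => i _.
by rewrite mul0r.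
Qed.

Lemma two_neq0 (k : fieldType) : 5%:R = 0 :> k -> 2%:R != 0 :> k.
Proof.
move=> h5; apply/eqP => h2; have /eqP : (5%:R - 2%:R * 2%:R : k) = 0 by rewrite h2 h5; ring.
by rewrite (_ : _ - _ = 1) ?oner_eq0 //; ring.
Qed.

Section HermitianFrames.

Variables (k : closedFieldType) (Gamma : pcurve k 6).
Hypothesis h5 : 5%:R = 0 :> k.
Implicit Types N : 'M[k]_3.

Let h5p : 5%:R = 0 :> {poly k}. Proof. exact: polyC_char5. Qed.

(** Stated for polynomial vectors, the condition specialises both to points and to parametrised
    curves. *)
Definition frame N : Prop :=
  N \in unitmx /\ exists2 c, c != 0 & forall phi : 'rV[{poly k}]_3,
    ev (fun i => (phi *m map_mx polyC N) 0 i) (form Gamma) = c%:P * herm phi phi.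

Lemma ev_linear_subst (A : 'M[k]_3) (f : {mpoly k[3]}) (phi : 'rV[{poly k}]_3) :
  ev (fun i => phi 0 i) (linear_subst A f) =
  ev (fun i => (phi *m map_mx polyC A^T) 0 i) f.
Proof.
rewrite /linear_subst /comp_mpoly /ev rmorph_mmap; congr (mmap _ _ _).
  by apply/funext => c /=; rewrite mmapC.
apply/funext => i /=; rewrite tnth_mktuple -[mmap _ _]/(ev (fun i => phi 0 i)).
rewrite rmorph_sum mxE; apply: eq_bigr => j _ /=.
by rewrite evZ evX !mxE mulrC.
Qed.

Lemma frame_exists : is_hermitian Gamma -> exists N, frame N.
Proof.
move=> [A [c [uA c0 hA]]].
have [d hd] := @root_exists k 6 (- 1) isT.
have [b hb] := @root_exists k 6 (- 2%:R) isT.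
have d0 : d != 0.
  by apply: contra_eq_neq hd => ->; rewrite expr0n eq_sym oppr_eq0 oner_eq0.
have b0 : b != 0.
  by apply: contra_eq_neq hb => ->; rewrite expr0n eq_sym oppr_eq0 (two_neq0 h5).
(* In these coordinates the Fermat form is u^6 + b^6 y^6 + d^6 v^6 with u = 3x + z and v = 3x - z.
   Since d^6 = -1 and fifth powers are additive, the outer terms give u^6 - v^6 = 6 (x z^5 + z x^5),
   and 6 = 1. *)
pose C : 'M[k]_3 := \matrix_(i, j)
  nth 0 (nth [::] [:: [:: 3%:R; 0; 3%:R * d]; [:: 0; b; 0]; [:: 1; 0; - d]] i) j.
have uC : C \in unitmx.
  rewrite unitmxE unitfE det3E !mxE /=.
  have -> : 3%:R * (b * - d - 0 * 0) - 0 * (0 * - d - 0 * 1) + 3%:R * d * (0 * 0 - b * 1)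
     = - (b * d) - 5%:R * (b * d) :> k by ring.
  by rewrite h5 mul0r subr0 oppr_eq0 mulf_neq0.
exists (C *m A^T); split; first by rewrite unitmx_mul uC unitmx_tr.
exists c => // phi; rewrite map_mxM mulmxA -ev_linear_subst hA evZ; congr (_ * _).
rewrite rmorph_sum sum3E !rmorphXn /= !evX !mul_row3E !mxE /=.
rewrite /herm.
have hd' : (d%:P : {poly k}) ^+ 6 = - 1 by rewrite -rmorphXn hd rmorphN rmorph1.
have hb' : (b%:P : {poly k}) ^+ 6 = - 2%:R by rewrite -rmorphXn hb rmorphN rmorph_nat.
rewrite !(rmorph0, rmorph1, rmorphM, rmorphN, rmorph_nat) /=.
set x := phi 0 i0; set y := phi 0 i1; set z := phi 0 i2.
have -> : x * 0 + y * b%:P + z * 0 = y * b%:P by ring.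
have -> : x * (3%:R * d%:P) + y * 0 + z * - d%:P = d%:P * (3%:R * x - z) by ring.
have -> : x * 3%:R + y * 0 + z * 1 = 3%:R * x + z by ring.
rewrite !exprMn hd' hb'.
have -> : (3%:R * x + z) ^+ 6 + y ^+ 6 * - 2%:R + - 1 * (3%:R * x - z) ^+ 6 =
  x * z ^+ 5 - 2%:R * y * y ^+ 5 + z * x ^+ 5
  + 5%:R * (7%:R * x * z ^+ 5 + 216%:R * x ^+ 3 * z ^+ 3 + 583%:R * x ^+ 5 * z) by ring.
by rewrite h5p mul0r addr0.
Qed.

End HermitianFrames.

(** A vector killed by [M] is orthogonal to everything, and the Hermitian form is nondegenerate
    because 2 is invertible. *)
Lemma unitary_unitmx (k : fieldType) mu (M : 'M[k]_3) : 5%:R = 0 :> k ->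
  mu != 0 -> unitary mu M -> M \in unitmx.
Proof.
move=> h5 mu0 hM; rewrite -row_free_unit; apply: inj_row_free => x xM.
have hx y : herm x y = 0.
  have /eqP := unitary_herm x y h5 hM.
  have -> : herm (x *m M) (y *m M) = 0 by rewrite xM /herm !mxE; ring.
  by rewrite eq_sym mulf_eq0 (negbTE mu0) => /eqP.
have two0 := two_neq0 h5.
have hd (j : 'I_3) : herm x (delta_mx 0 j) = 0 := hx _.
apply: row3P; rewrite [RHS]mxE.
- by rewrite -(hd i2) /herm !mxE /=; ring.
- have : 2%:R * x 0 i1 = - herm x (delta_mx 0 i1) by rewrite /herm !mxE /=; ring.
  rewrite hd oppr0 => /eqP.
  by rewrite mulf_eq0 (negbTE two0) => /eqP.
- by rewrite -(hd i0) /herm !mxE /=; ring.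
Qed.

Lemma polyC_map0 (k : comNzRingType) (u : 'rV[k]_3) (i : 'I_3) :
  (map_mx polyC u) 0 i = (u 0 i)%:P.
Proof. by rewrite mxE. Qed.

(** * Contact of the standard conic with the Hermitian curve *)

Section FramePoints.

Variables (k : closedFieldType) (Gamma : pcurve k 6).
Hypothesis char5 : 5%N \in [pchar k].
Let h5 : 5%:R = 0 :> k := pcharf0 char5.
Implicit Types (N : 'M[k]_3) (Q : pcurve k 2).

Lemma frame_unitary N M mu : mu != 0 -> unitary mu M ->
  frame Gamma N -> frame Gamma (M *m N).
Proof.
move=> mu0 hM [uN [c c0 hN]]; split.
  by rewrite unitmx_mul uN (unitary_unitmx h5 mu0 hM).
exists (c * mu); first exact: mulf_neq0.
move=> phi; rewrite map_mxM mulmxA hN.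
have hMp := unitary_map (polyC : {rmorphism k -> {poly k}}) hM.
by rewrite (unitary_herm _ _ (polyC_char5 h5) hMp) rmorphM mulrA.
Qed.

Lemma frame_mev N : frame Gamma N -> exists2 c, c != 0 &
  forall x : 'rV[k]_3, mev (form Gamma) (x *m N) = c * herm x x.
Proof.
move=> [uN [c c0 hN]]; exists c => // x; apply: (@polyC_inj k).
have := hN (map_mx polyC x); rewrite -map_mxM (herm_map (polyC : {rmorphism k -> {poly k}})).
rewrite rmorphM /= => <-; rewrite -ev_const; congr (ev _ _).
by apply/funext => i; rewrite polyC_map0.
Qed.

(** The points of the conic whose parameter lies in the projective line over the prime field; [None]
    is infinity. *)
Definition vrow (o : option nat) : 'rV[k]_3 :=
  if o is Some t then \row_j t%:R ^+ j else delta_mx 0 i2.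

Definition params : seq (option nat) := None :: [seq Some t | t <- iota 0 5].

Definition shift_mx (o : option nat) : 'M[k]_3 :=
  \matrix_(i, j) nth 0 (nth [::] (if o is Some t then
    [:: [:: 1; t%:R; t%:R ^+ 2]; [:: 0; 1; 2%:R * t%:R]; [:: 0; 0; 1]]
    else [:: [:: 0; 0; 1]; [:: 0; 1; 0]; [:: 1; 0; 0]]) i) j.

Lemma row_shift_mx o : row i0 (shift_mx o) = vrow o.
Proof.
case: o => [t|]; apply: row3P; rewrite !mxE //=.
Qed.

Lemma natr_expr5 t : (t%:R : k) ^+ 5 = t%:R.
Proof.
elim: t => [|t IH]; first by rewrite expr0n.
by rewrite -addn1 natrD expr5D // IH expr1n.
Qed.

Lemma unitary_shift_mx o : unitary 1 (shift_mx o).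
Proof.
case: o => [t|]; apply: ord3_ind; apply: ord3_ind;
  rewrite /herm !mxE /gram /= ?mul1r ?exprMn -?exprM ?natr_expr5.
all: rewrite ?(mulnC 2 5) ?exprM ?natr_expr5 ?expr0n ?expr1n /=; try ring.
Qed.

Lemma shift_mx_unit o : shift_mx o \in unitmx.
Proof. exact: unitary_unitmx h5 (oner_neq0 _) (unitary_shift_mx o). Qed.

Lemma quad_shift_mx o : quad (conic_param (shift_mx o)) = 0.
Proof.
by case: o => [t|]; rewrite /quad !mul_row3E !mxE /= ?(rmorph0, rmorph1, rmorphXn, rmorphM, rmorph_nat); ring.
Qed.

Lemma vrow_neq0 o : vrow o != 0.
Proof. by rewrite -row_shift_mx row_unitmx_neq0 ?shift_mx_unit. Qed.

Lemma mul_unitmx_neq0 (x : 'rV[k]_3) N : N \in unitmx -> x != 0 -> x *m N != 0.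
Proof.
by move=> uN; apply: contra_neq => h; rewrite -[x](mulmxK uN) h mul0mx.
Qed.

Lemma natr_inj5 s t : (s < 5)%N -> (t < 5)%N -> s%:R = t%:R :> k -> s = t.
Proof.
wlog st : s t / (s <= t)%N => [wl|hs ht].
  by have [/wl//|/ltnW /wl h] := leqP s t; move=> hs ht e; rewrite (h ht hs).
move=> /esym/eqP; rewrite -subr_eq0 -natrB // -(dvdn_pcharf char5) => h.
apply/eqP; rewrite eqn_leq st /= -subn_eq0; move: h.
by case E : (t - s)%N => [//|d] /dvdn_leq; move: ht E; clear; lia.
Qed.

Lemma vrow_inj : {in params &, forall o o' c, vrow o = c *: vrow o' -> o = o'}.
Proof.
have mem_params t : Some t \in params -> (t < 5)%N.
  by case: t => [|[|[|[|[|t]]]]].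
move=> [s|] [t|] //.
- move=> /mem_params hs /mem_params ht c /rowP e.
  have := e i0; have := e i1; rewrite !mxE /= !expr0 !expr1 mulr1 => e1 c1.
  by congr Some; apply: natr_inj5 => //; rewrite e1 -c1 mul1r.
- by move=> _ _ c /rowP /(_ i0); rewrite !mxE /= mulr0 => /eqP; rewrite oner_eq0.
move=> _ _ c /rowP e; have := e i0; have := e i2.
rewrite !mxE /= expr0 mulr1 => h h0; move: h; rewrite -h0 mul0r => /eqP.
by rewrite oner_eq0.
Qed.

Lemma natr_roots (x : k) : x ^+ 5 = x -> exists2 t, (t < 5)%N & x = t%:R.
Proof.
(* Modulo 5 this product is [x ^+ 5 - x]. *)
move=> hx; have : x * (x - 1) * (x - 2%:R) * (x - 3%:R) * (x - 4%:R) = 0.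
  have -> : x * (x - 1) * (x - 2%:R) * (x - 3%:R) * (x - 4%:R) =
    x ^+ 5 - x + 5%:R * (- 2%:R * x ^+ 4 + 7%:R * x ^+ 3 - 10%:R * x ^+ 2 + 5%:R * x) by ring.
  by rewrite h5 hx; ring.
move=> /eqP; rewrite !mulf_eq0 !subr_eq0 -!orbA.
by case/or4P => [||/eqP|/orP[]/eqP]; [move/eqP|move/eqP|..] => ->;
  [exists 0%N|exists 1%N|exists 2%N|exists 3%N|exists 4%N].
Qed.

Lemma quad_eq0 (x : 'rV[k]_3) : x != 0 -> quad x = 0 ->
  (exists c t, c != 0 /\ x = c *: \row_j t ^+ j) \/
  (exists2 c, c != 0 & x = c *: delta_mx 0 i2).
Proof.
move=> x0 /eqP; rewrite subr_eq0 => /eqP hx; have [x00|x00] := eqVneq (x 0 i0) 0.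
  have x01 : x 0 i1 = 0.
    by apply/eqP; have := expf_eq0 (x 0 i1) 2; rewrite -hx x00 mul0r eqxx.
  right; exists (x 0 i2).
    by apply: contra_neq x0 => x02; apply: row3P; rewrite ?x00 ?x01 ?x02 mxE.
  by apply: row3P; rewrite !mxE /= ?x00 ?x01 ?mulr0 ?mulr1.
left; exists (x 0 i0), (x 0 i1 / x 0 i0); split => //.
apply: row3P; rewrite !mxE /= ?expr0 ?mulr1 ?expr1 //.
  by rewrite mulrC divfK.
by rewrite expr_div_n -hx; field.
Qed.

Lemma herm_vrow o : o \in params -> herm (vrow o) (vrow o) = 0.
Proof.
move=> _; rewrite -row_shift_mx unitary_shift_mx /gram /=; exact: mulr0.
Qed.

(** The form restricted to the conic is a square with roots in the prime field: hence the double
    contact, and the absence of further common points. *)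
Lemma herm_row_exp (t : k) : herm (\row_j t ^+ j) (\row_j t ^+ j) = (t ^+ 5 - t) ^+ 2.
Proof.
rewrite /herm !mxE /= expr0 expr1.
have -> : (t ^+ 5 - t) ^+ 2 = 1 * (t ^+ 2) ^+ 5 - 2%:R * t * t ^+ 5 + t ^+ 2 * 1 ^+ 5 by ring.
by [].
Qed.

Lemma meet_points Q N : param_by Q N -> frame Gamma N ->
  points Q `&` points Gamma = (fun o => pt (vrow o *m N)) @` [set` params].
Proof.
move=> hQ hN; have [uN _] := hQ; have [c c0 hc] := frame_mev hN.
apply/seteqP; split => P.
  rewrite -(pt_rep P); have := rep_neq0 P; set u := rep P => u0 [].
  rewrite (param_by_points hQ u0) (points_pt _ u0).
  set x := u *m invmx N; have ux : u = x *m N by rewrite mulmxKV.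
  have x0 : x != 0 by rewrite mul_unitmx_neq0 ?unitmx_inv.
  move=> hx hG; have {}hG : c * herm x x = 0 by rewrite -hc -ux.
  have [[a [t [a0 xE]]]|[a a0 xE]] := quad_eq0 x0 hx.
    have /natr_roots [n n5 tn] : t ^+ 5 = t.
      have nz : c * (a * a ^+ 5) != 0 by rewrite !mulf_neq0 ?expf_neq0.
      have /eqP := hG; rewrite xE herm_scale herm_row_exp mulrA mulrI_eq0.
        by rewrite sqrf_eq0 subr_eq0 => /eqP.
      exact/lregP.
    exists (Some n); first by move: n n5 {tn} => [|[|[|[|[|n]]]]].
    apply: esym; apply: (@pt_eq _ _ _ a) => //.
    by rewrite scalemxAl ux xE tn.
  exists None => //; apply: esym; apply: (@pt_eq _ _ _ a) => //.
  by rewrite scalemxAl ux xE.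
move=> [o ho <-]; have v0 : vrow o *m N != 0 by rewrite mul_unitmx_neq0 ?vrow_neq0.
split; last by apply/points_pt => //; rewrite hc herm_vrow ?mulr0.
apply/(param_by_points hQ v0); rewrite mulmxK //.
by case: o ho v0 => [t|] _ _; rewrite /quad !mxE /=; ring.
Qed.

Lemma pt_vrow_inj N : N \in unitmx ->
  {in params &, injective (fun o => pt (vrow o *m N))}.
Proof.
move=> uN o o' ho ho' /pt_eqP []; rewrite ?mul_unitmx_neq0 ?vrow_neq0 // => c c0.
by rewrite scalemxAl => /(can_inj (mulmxK uN)) /(vrow_inj ho ho').
Qed.

Lemma ev_frame_param N : frame Gamma N -> exists2 c, c != 0 &
  ev (fun i => conic_param N 0 i) (form Gamma) = 'X^2 * (c *: ('X^4 - 1) ^+ 2).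
Proof.
move=> [_ [c c0 hN]]; exists c => //; rewrite hN /herm !mxE /= -mul_polyC; ring.
Qed.

Lemma param_by_shift Q N o : param_by Q N -> param_by Q (shift_mx o *m N).
Proof. exact: param_by_reparam (shift_mx_unit o) (quad_shift_mx o). Qed.

Lemma frame_shift N o : frame Gamma N -> frame Gamma (shift_mx o *m N).
Proof. exact: frame_unitary (oner_neq0 _) (unitary_shift_mx o). Qed.

(** The multiplicity is read off at the parameter 0 only; [shift_mx] moves any of the six points
    there while preserving both the conic and the Hermitian form. *)
Lemma totally_tangent_frame Q N : param_by Q N -> frame Gamma N ->
  totally_tangent Gamma Q.
Proof.
move=> hQ hN; rewrite /totally_tangent (meet_points hQ hN); split.
  by apply: (@has_card_image _ _ _ params) => //; apply: pt_vrow_inj; case: hQ.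
move=> _ [o _ <-]; have [c c0 hc] := ev_frame_param (frame_shift o hN).
rewrite -row_shift_mx -row_mul.
apply: conic_intersection_mult (param_by_shift o hQ) (form_homog Gamma) _ hc.
have -> : (c *: ('X^4 - 1) ^+ 2).[0] = c by rewrite hornerZ horner_exp hornerD hornerN hornerC hornerXn expr0n /=; ring.
by [].
Qed.

End FramePoints.

(** * Gradients, nonsingularity and Weierstrass points *)

Section Derivatives.

Variable k : closedFieldType.
Local Notation poly3 := {mpoly k[3]}.

(** The chain rule: the polynomials satisfying it are closed under sums and products, and contain
    the constants and the variables. *)
Lemma deriv_ev (phi : 'I_3 -> {poly k}) (p : poly3) :
  (ev phi p)^`() = \sum_i ev phi p^`M(i) * (phi i)^`().
Proof.
pose P p := (ev phi p)^`() = \sum_i ev phi p^`M(i) * (phi i)^`().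
have PC c : P c%:MP.
  rewrite /P /ev mmapC derivC big1 // => i _.
  by rewrite mderivC mmap0 mul0r.
have PD a b : P a -> P b -> P (a + b).
  move=> hp hq; rewrite /P rmorphD derivD hp hq -big_split; apply: eq_bigr => i _.
  by rewrite mderivD rmorphD mulrDl.
have PM a b : P a -> P b -> P (a * b).
  move=> hp hq; rewrite /P rmorphM derivM hp hq mulr_suml mulr_sumr -big_split.
  by apply: eq_bigr => i _; rewrite /= mderivM rmorphD !rmorphM /=; ring.
have PX i : P 'X_i.
  rewrite /P evX (bigD1 i) //= mderivX mnmE eqxx mulr1n.
  have -> : (U_(i) - U_(i) = 0)%MM by apply/mnmP => j; rewrite mnmBE subnn mnm0E.
  rewrite mpolyX0 scale1r rmorph1 mul1r big1 ?addr0 // => j ij.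
  by rewrite mderivX mnmE eq_sym (negbTE ij) scale0r rmorph0 mul0r.
rewrite -/(P p) (mpolyE p); apply: big_ind => [|//|m _].
  by rewrite -mpolyC0; apply: (PC).
rewrite -mul_mpolyC; apply: (PM); first exact: (PC).
rewrite mpolyXE_id; apply: (big_ind P) => [||i _].
- by rewrite -mpolyC1; apply: (PC).
- exact: (PM).
elim: (m i) => [|n IH]; first by rewrite expr0 -mpolyC1; apply: (PC).
by rewrite exprS; apply: (PM).
Qed.

(** Expresses a directional derivative as the linear coefficient along a line, so that gradients can
    be computed in the coordinates of a frame. *)
Lemma mev_mderiv (f : poly3) (u w : 'rV[k]_3) :
  \sum_i mev f^`M(i) u * w 0 i = (ev (fun i => (u 0 i)%:P + (w 0 i)%:P * 'X) f)`_1.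
Proof.
set p := ev _ _; have -> : p`_1 = p^`().[0] by rewrite horner_coef0 coef_deriv mulr1n.
rewrite deriv_ev horner_sum; apply: eq_bigr => i _.
rewrite hornerM horner_ev derivD derivC add0r derivM derivC mul0r add0r derivX mulr1 hornerC.
by congr (_ * _); apply: meval_eq => j; rewrite !hornerE.
Qed.

End Derivatives.

Section TangentConics.

Variables (k : closedFieldType) (Gamma : pcurve k 6).
Hypothesis char5 : 5%N \in [pchar k].
Let h5 : 5%:R = 0 :> k := pcharf0 char5.
Implicit Types (N : 'M[k]_3) (Q : pcurve k 2).

Lemma line_ev N (u w : 'rV[k]_3) : N \in unitmx ->
  (fun i : 'I_3 => (u 0 i)%:P + (w 0 i)%:P * 'X) =
  (fun i : 'I_3 => ((map_mx polyC (u *m invmx N) + map_mx polyC (w *m invmx N) *m 'X%:M)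
     *m map_mx polyC N) 0 i).
Proof.
move=> uN; apply/funext => i.
rewrite mul_mx_scalar mulmxDl -scalemxAl -!map_mxM !mulmxKV //.
by rewrite !mxE mulrC.
Qed.

(** A point with zero gradient is orthogonal to every vector for the polar form of x0 x2 - x1^2,
    which is nondegenerate because 2 is invertible. *)
Lemma nonsingular_param Q N : param_by Q N -> nonsingular Q.
Proof.
move=> hQ P hP; have [uN _] := hQ; have [c c0 hc] := param_by_form hQ.
apply: contrapT => /forallNP hder; have u0 := rep_neq0 P; set u := rep P in u0.
have {}hder i : mev (form Q)^`M(i) u = 0 by apply/eqP/negPn/negP/hder.
pose x := u *m invmx N.
have hdir (y : 'rV[k]_3) : x 0 i0 * y 0 i2 + y 0 i0 * x 0 i2 - 2%:R * x 0 i1 * y 0 i1 = 0.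
  have := mev_mderiv (form Q) u (y *m N); rewrite big1 => [|i _]; last by rewrite hder mul0r.
  rewrite (line_ev _ _ uN) hc evZ ev_conic_form -mulmxA -map_mxM mulmxV // map_mx1 mulmx1.
  rewrite mulmxK // -/x mul_mx_scalar /quad; clearbody x; rewrite !mxE.
  set p := (X in _ = (polyseq X)`_1).
  have -> : p = (c * quad x)%:P +
    (c * (x 0 i0 * y 0 i2 + y 0 i0 * x 0 i2 - 2%:R * x 0 i1 * y 0 i1))%:P * 'X +
    (c * quad y)%:P * 'X^2.
    rewrite /p /quad !(rmorphM, rmorphB, rmorphD, rmorphXn, rmorph_nat) /=; ring.
  rewrite !coefD coefC coefCM coefX coefCM coefXn /= mulr1 mulr0 add0r addr0.
  by move=> /esym/eqP; rewrite mulf_eq0 (negbTE c0) => /eqP.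
have two0 := two_neq0 h5.
have x0 : x = 0.
  apply: row3P; rewrite [RHS]mxE.
  - by rewrite -[RHS](hdir (delta_mx 0 i2)) !mxE /=; ring.
  - have : 2%:R * x 0 i1 = 0.
      by rewrite -[RHS]oppr0 -[in RHS](hdir (delta_mx 0 i1)) !mxE /=; ring.
    by move/eqP; rewrite mulf_eq0 (negbTE two0) => /eqP.
  - by rewrite -[RHS](hdir (delta_mx 0 i0)) !mxE /=; ring.
by move: u0; rewrite -(mulmxKV uN u) -/x x0 mul0mx eqxx.
Qed.

(** In the frame the point is (1, 0, 0) and its tangent line is x2 = 0. Along (1, t, 0) the
    Hermitian form is -2 t^6, which gives contact of order 6. *)
Lemma frame_weierstrass N : frame Gamma N -> weierstrass Gamma (pt (row i0 N)).
Proof.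
move=> hN; have [uN [c c0 hc]] := hN; have r0 := row_unitmx_neq0 i0 uN.
have [rho rho0 hrho] := rep_pt r0; set P := pt _ in hrho *.
have hrow : row i0 N = delta_mx 0 i0 *m N by rewrite rowE.
split.
  have [c' c'0 hc'] := frame_mev hN.
  by apply/points_pt => //; rewrite hrow hc' /herm !mxE /=; ring.
pose kappa := c * rho ^+ 5.
have kappa0 : kappa != 0 by rewrite mulf_neq0 ?expf_neq0.
have tangentE : tangent_form Gamma P = kappa *: coord N i2.
  rewrite /tangent_form /coord scaler_sumr; apply: eq_bigr => i _.
  rewrite scalerA; congr (_ *: _).
  have := mev_mderiv (form Gamma) (rep P) (delta_mx 0 i).
  rewrite (bigD1 i) //= mxE !eqxx mulr1 big1 ?addr0 => [|j ij]; last first.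
    by rewrite mxE eqxx (negbTE ij) mulr0.
  rewrite -[evalp _ _]/(mev _ _) => ->; rewrite (line_ev _ _ uN) hc hrho hrow -scalemxAl mulmxK //.
  set y := delta_mx 0 i *m invmx N.
  have -> : invmx N i i2 = y 0 i2 by rewrite /y -rowE mxE.
  clearbody y; rewrite mul_mx_scalar /herm !mxE /=.
  set p := (X in (polyseq X)`_1 = _).
  (* Fifth powers of the components of the direction start at order 5, so the linear term comes only
     from the constant part of the fifth power of coordinate 0. *)
  have -> : p = (kappa * y 0 i2)%:P * 'X + 'X^2 * (c%:P *
      (rho%:P * (y 0 i2)%:P ^+ 5 * 'X^3 + (y 0 i0)%:P * (y 0 i2)%:P ^+ 5 * 'X^4
       - 2%:R * (y 0 i1)%:P ^+ 6 * 'X^4 + (y 0 i2)%:P * (y 0 i0)%:P ^+ 5 * 'X^4)).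
    rewrite /p /kappa !(rmorphM, rmorphXn, rmorph0, rmorph1) /=.
    by rewrite !(expr5D _ _ (polyC_char5 h5)); ring.
  rewrite coefD coefCM coefX mulr1 coefXnM /= addr0; done.
rewrite tangentE.
pose lin : 'rV[{poly k}]_3 := \row_j nth 0 [:: 1; 'X; 0] j.
have linN : lin *m map_mx polyC N *m map_mx polyC (invmx N) = lin.
  by rewrite -mulmxA -map_mxM mulmxV // map_mx1 mulmx1.
pose phi i := (lin *m map_mx polyC N) 0 i.
have phiE i : phi i = (N i0 i)%:P + (N i1 i)%:P * 'X.
  by rewrite /phi mul_row3E !mxE /=; ring.
have evlin j : ev phi (coord N j) = lin 0 j by rewrite ev_coord linN.
have evg : ev phi (form Gamma) = 'X^6 * (- 2%:R * c)%:P.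
  by rewrite hc /herm !mxE /= rmorphM rmorphN rmorph_nat /=; ring.
apply: (@intersection_mult_ord k _ phi rho rho0 _ (coord N i0) (coord N i1) _
  _ _ _ _ _ _ _ _ 6 _ _ (form_homog Gamma) evg).
- by move=> i; rewrite hrho phiE !mxE !hornerE.
- exact: coord_homog.
- exact: coord_homog.
- by rewrite evlin mxE.
- by rewrite evlin mxE.
- move=> i; rewrite phiE (leq_trans (size_polyD _ _)) // geq_max.
  rewrite (leq_trans (size_polyC_leq1 _)) //= mul_polyC.
  by rewrite (leq_trans (size_scale_leq _ _)) // size_polyX.
- by rewrite evZ evlin mxE mulr0.
- move=> i; exists ((N i2 i / kappa)%:MP * coord N i0).
  rewrite (coordK uN) /homogenize !sum3E /= phiE !coefD !coefC !coefCM !coefX /=.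
  rewrite -!mul_mpolyC !(mulr0, mulr1, addr0, add0r) mulrA.
  have e : (N i2 i / kappa)%:MP_[3] * kappa%:MP_[3] = (N i2 i)%:MP_[3].
    by rewrite -rmorphM /= divfK.
  transitivity ((N i2 i / kappa)%:MP_[3] * kappa%:MP_[3] * coord N i0 * coord N i2); last by ring.
  by rewrite e mpolyC0 subnn; ring.
by rewrite hornerC mulf_neq0 ?oppr_eq0 ?(two_neq0 h5).
Qed.

Lemma tangent_conic_frame Q N : param_by Q N -> frame Gamma N -> tangent_conics Gamma Q.
Proof.
move=> hQ hN; split; first exact: nonsingular_param hQ.
exact: totally_tangent_frame hQ hN.
Qed.

(** All points of contact are Weierstrass points, so a line joining two of them is automatically a
    special secant. *)
Lemma secants_frame Q N : param_by Q N -> frame Gamma N ->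
  secants Gamma Q = [set L | joins (points Q `&` points Gamma) L].
Proof.
move=> hQ hN; apply/seteqP; split => L; first by case.
move=> hL; split => //; have [P [P' [PP' hP hP' LP LP']]] := hL.
exists P, P'; split => //.
  move: hP; rewrite (meet_points char5 hQ hN) => -[o _ <-].
  rewrite -row_shift_mx -row_mul; apply: frame_weierstrass; exact: frame_shift.
move: hP'; rewrite (meet_points char5 hQ hN) => -[o _ <-].
rewrite -row_shift_mx -row_mul; apply: frame_weierstrass; exact: frame_shift.
Qed.

End TangentConics.

(** * Normal form of a totally tangent conic *)

Lemma sqr_XsubC_dvd (k : fieldType) (s : seq k) (p : {poly k}) : uniq s ->
  (forall a, a \in s -> ('X - a%:P) ^+ 2 %| p) ->
  (\prod_(a <- s) ('X - a%:P)) ^+ 2 %| p.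
Proof.
elim: s => [|a s IH] /=; first by rewrite big_nil expr1n dvd1p.
move=> /andP [as_ us] h; rewrite big_cons exprMn Gauss_dvdp; last first.
  apply: coprimep_expr; apply: coprimep_expl; rewrite coprimep_sym coprimep_XsubC.
  by rewrite root_prod_XsubC.
rewrite h ?inE ?eqxx //=; apply: IH => // b bs; apply: h.
by rewrite inE bs orbT.
Qed.

Section ConicFrame.

Variables (k : closedFieldType).
Hypothesis char5 : 5%N \in [pchar k].
Let h5 : 5%:R = 0 :> k := pcharf0 char5.
Let two0 : 2%:R != 0 :> k := two_neq0 h5.
Implicit Types (N : 'M[k]_3) (Q : pcurve k 2).

Lemma conic_gram Q : exists S : 'M[k]_3, S^T = S /\
  (forall phi : 'rV[{poly k}]_3, 2%:R * ev (fun i => phi 0 i) (form Q) =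
     (phi *m map_mx polyC S *m phi^T) 0 0).
Proof.
have [a ha] := dhomog2_expand (form_homog Q).
exists (\matrix_(i, j) (a i j + a j i)); split.
  by apply/matrixP => i j; rewrite !mxE addrC.
move=> phi; rewrite ha !sum3E !(rmorphD, rmorphB) /= !evZ !rmorphM /= !evX.
by rewrite [RHS]mxE sum3E !mul_row3E !mxE !rmorphD /=; ring.
Qed.

(* The third vector is orthogonal to both points for the polar form of [Q]. *)
Lemma conic_frame_exists Q P1 P2 : nonsingular Q -> points Q P1 -> points Q P2 ->
  P1 <> P2 -> exists N, [/\ param_by Q N, pt (row i0 N) = P1 & pt (row i2 N) = P2].
Proof.
move=> nsQ QP1 QP2 P12; have [S [St hS]] := conic_gram Q.
pose b (u w : 'rV[k]_3) := (u *m S *m w^T) 0 0.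
have bC u w : b u w = b w u.
  by rewrite /b -[u *m S *m w^T]trmxK mxE !trmx_mul trmxK St mulmxA.
have hb u : 2%:R * mev (form Q) u = b u u.
  apply: (@polyC_inj k); have := hS (map_mx polyC u).
  rewrite rmorphM rmorph_nat /= -ev_const => e.
  have -> : (fun i : 'I_3 => (u 0 i)%:P) = (fun i => map_mx polyC u 0 i).
    by apply/funext => i; rewrite polyC_map0.
  by rewrite e map_trmx -!map_mxM mxE.
(* A kernel vector of the polar form would be a point of [Q] at which all derivatives vanish. *)
have uS : S \in unitmx.
  rewrite -row_free_unit; apply: inj_row_free => v vS.
  apply/eqP/negPn/negP => v0.
  have fv : mev (form Q) v = 0.
    by apply/eqP; rewrite -(mulrI_eq0 _ (mulfI two0)) hb /b vS mul0mx mxE.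
  have [i] := nsQ (pt v) ((points_pt Q v0).2 fv).
  have [c c0 hc] := rep_pt v0; have cv0 : mev (form Q) (rep (pt v)) = 0.
    by rewrite hc (mevZ _ _ (form_homog Q)) fv mulr0.
  rewrite -[evalp _ _]/(mev _ _) => /eqP; apply.
  have := mev_mderiv (form Q) (rep (pt v)) (delta_mx 0 i).
  rewrite (bigD1 i) //= mxE !eqxx mulr1 big1 ?addr0 => [->|j ij]; last first.
    by rewrite mxE eqxx (negbTE ij) mulr0.
  set w := delta_mx 0 i; set u := rep (pt v) in cv0 hc *.
  have -> : (fun j : 'I_3 => (u 0 j)%:P + (w 0 j)%:P * 'X) =
            (fun j => (map_mx polyC u + 'X *: map_mx polyC w) 0 j).
    by apply/funext => j; rewrite !mxE; ring.
  have pE : ev (fun j => (map_mx polyC u + 'X *: map_mx polyC w) 0 j) (form Q) =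
     (mev (form Q) w)%:P * 'X^2.
    have two0p : 2%:R != 0 :> {poly k} by rewrite -polyC_natr polyC_eq0.
    have uS0 : u *m S = 0 by rewrite hc -scalemxAl vS scaler0.
    have Su0 : S *m u^T = 0 by rewrite -[S *m _]trmxK trmx_mul trmxK St uS0 trmx0.
    apply: (mulfI two0p); rewrite hS [in LHS]mulmxDl -scalemxAl -!map_mxM uS0 map_mx0 add0r.
    rewrite linearD linearZ /= mulmxDr -scalemxAr -!scalemxAl !map_trmx -!map_mxM -!mulmxA Su0.
    rewrite mulmx0 map_mx0 scaler0 add0r mxE [X in _ * X]mxE [X in _ * (_ * X)]mxE.
    have := hb w; rewrite /b -mulmxA => <-.
    by rewrite rmorphM rmorph_nat /=; ring.
  by rewrite pE coefCM coefXn mulr0.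
pose u0 := rep P1; pose u2 := rep P2.
have b00 : b u0 u0 = 0 by rewrite -hb [mev _ _]QP1 mulr0.
have b22 : b u2 u2 = 0 by rewrite -hb [mev _ _]QP2 mulr0.
pose U : 'M[k]_(1 + 1, 3) := col_mx u0 u2.
have rU : \rank U = 2.
  apply/eqP; rewrite -[_ == _]/(row_free U); apply: inj_row_free => v.
  rewrite -[v]hsubmxK mul_row_col => e.
  have vE (x : 'rV[k]_1) (u : 'rV[k]_3) : x *m u = x 0 0 *: u.
    by apply/rowP => i; rewrite !mxE big_ord1.
  rewrite !vE in e; set x := lsubmx v 0 0 in e; set y := rsubmx v 0 0 in e.
  have x0 : x = 0.
    apply/eqP/negPn/negP => x0; apply: P12; apply: (@proj_inj _ _ _ _ (- (x^-1 * y))).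
    apply: (scalerI x0); rewrite scalerA mulrN mulrA divff // mul1r scaleNr.
    by apply/eqP; rewrite -addr_eq0 e.
  move/eqP: e; rewrite x0 scale0r add0r scaler_eq0 (negbTE (rep_neq0 P2)) orbF => /eqP y0.
  have -> : lsubmx v = 0 by apply/rowP => i; rewrite ord1 [LHS]x0 mxE.
  have -> : rsubmx v = 0 by apply/rowP => i; rewrite ord1 [LHS]y0 mxE.
  exact: row_mx0.
(* Otherwise the span of the two points would be totally isotropic, of dimension 2 in a
   nondegenerate space of dimension 3. *)
have beta0 : b u0 u2 != 0.
  apply/eqP => b02.
  have USU : U *m S *m U^T = 0.
    rewrite /U mul_col_mx tr_col_mx mul_col_row.
    have z (w w' : 'rV[k]_3) : b w w' = 0 -> w *m S *m w'^T = 0.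
      by move=> e; apply/matrixP => i j; rewrite !ord1 [LHS]e mxE.
    by rewrite !z ?block_mx0 // bC.
  have := mxrank_mul_min (U *m S) U^T; rewrite USU mxrank0 mxrank_tr rU.
  by rewrite mxrankMfree ?rU // row_free_unit.
have [m1 m10 hm1] : exists2 m : 'rV[k]_3, m != 0 & m *m (S *m U^T) = 0.
  exists (nz_row (kermx (S *m U^T))).
    rewrite nz_row_eq0 -mxrank_eq0 mxrank_ker -lt0n subn_gt0.
    by apply: leq_ltn_trans (rank_leq_col _) _.
  by apply/sub_kermxP; apply: nz_row_sub.
have [b10 b12] : b m1 u0 = 0 /\ b m1 u2 = 0.
  move: hm1; rewrite mulmxA tr_col_mx mul_mx_row -[RHS]row_mx0 => /eq_row_mx [e e'].
  by rewrite /b e e' mxE.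
have comb0 x y z : x *: u0 + y *: m1 + z *: u2 = 0 -> [/\ x = 0, y = 0 & z = 0].
  move=> e; have bl w : x * b u0 w + y * b m1 w + z * b u2 w = 0.
    have := congr1 (fun u => b u w) e.
    by rewrite /b !mulmxDl -!scalemxAl !mul0mx !mxE.
  have := bl u2; rewrite b22 b12 !mulr0 !addr0 => /eqP.
  rewrite mulf_eq0 (negbTE beta0) orbF => /eqP x0.
  have := bl u0; rewrite b00 b10 bC !mulr0 !add0r => /eqP.
  rewrite mulf_eq0 (negbTE beta0) orbF => /eqP z0; split => //.
  move/eqP: e; rewrite x0 z0 !scale0r addr0 add0r scaler_eq0 (negbTE m10) orbF.
  by move/eqP.
have unit_rows3 l : l != 0 -> rows3 u0 (l *: m1) u2 \in unitmx.
  move=> l0; rewrite -row_free_unit; apply: inj_row_free => v vN.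
  have [|x0 /eqP y0 z0] := comb0 (v 0 i0) (v 0 i1 * l) (v 0 i2).
    by apply/rowP => j; rewrite -[RHS](congr1 (fun r : 'rV_3 => r 0 j) vN) mul_row3E !mxE /=; ring.
  rewrite mulf_eq0 (negbTE l0) orbF in y0.
  by apply: row3P; rewrite mxE //; apply/eqP.
have e0 : b m1 m1 != 0.
  apply/eqP => e; have mS : m1 *m S != 0 by rewrite mul_unitmx_neq0.
  pose M := rows3 u0 m1 u2.
  have uM : M \in unitmx by rewrite /M -[m1]scale1r unit_rows3 ?oner_neq0.
  suff mSM : m1 *m S *m M^T = 0.
    have uMt : M^T \in unitmx by rewrite unitmx_tr.
    by move/eqP: mS; apply; rewrite -(mulmxK uMt (m1 *m S)) mSM mul0mx.
  have eM j : (m1 *m S *m M^T) 0 j = b m1 (row j M).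
    by rewrite /b !mxE; apply: eq_bigr => i _; rewrite !mxE.
  by apply: row3P; rewrite eM row_rows3 /= ?b10 ?b12 ?e mxE.
(* Along u0 + t l m1 + t^2 u2 only the coefficient of t^2 survives orthogonality, namely 2 b(u0, u2)
   + l^2 b(m1, m1); [l] makes it vanish. *)
have [l hl] := @root_exists k 2 (- (2%:R * b u0 u2) / b m1 m1) isT.
have l0 : l != 0.
  apply: contra_eq_neq hl => ->; rewrite expr0n eq_sym.
  by rewrite !mulf_neq0 ?oppr_eq0 ?invr_eq0 ?mulf_neq0.
pose N := rows3 u0 (l *: m1) u2.
exists N; split; rewrite ?row_rows3 /= ?pt_rep //; split; first exact: unit_rows3.
have two0p : 2%:R != 0 :> {poly k} by rewrite -polyC_natr polyC_eq0.
apply: (mulfI two0p); rewrite hS mulr0 /conic_param.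
have -> : veronese k *m map_mx polyC N *m map_mx polyC S *m (veronese k *m map_mx polyC N)^T =
    veronese k *m map_mx polyC (N *m S *m N^T) *m (veronese k)^T.
  by rewrite !map_mxM -map_trmx trmx_mul !mulmxA.
have NSN i j : (N *m S *m N^T) i j = b (row i N) (row j N).
  by rewrite /b -row_mul !mxE; apply: eq_bigr => l' _; rewrite !mxE.
rewrite mxE sum3E !mul_row3E ![map_mx _ _ _ _]mxE !NSN !row_rows3 /= !mxE.
have bl (u w : 'rV[k]_3) : b (l *: u) w = l * b u w by rewrite /b -!scalemxAl mxE.
rewrite b00 b22 !bl (bC u0) !(bC u2) !bl b10 b12 (bC m1 (l *: m1)) bl.
have -> : l * (l * b m1 m1) = - (2%:R * b u0 u2).
  by rewrite mulrA -expr2 hl divfK.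
rewrite !(mulr0, rmorph0, rmorphN, rmorphM, rmorph_nat) /=; ring.
Qed.

End ConicFrame.

Section TangentParam.

Variables (k : closedFieldType) (Gamma : pcurve k 6) (B : 'M[k]_3).
Hypothesis char5 : 5%N \in [pchar k].
Hypothesis hB : frame Gamma B.
Let h5 : 5%:R = 0 :> k := pcharf0 char5.
Let two0 : 2%:R != 0 :> k := two_neq0 h5.
Implicit Types (K N : 'M[k]_3) (Q : pcurve k 2).

Lemma ev_frame_mul K : exists2 c, c != 0 & forall phi : 'rV[{poly k}]_3,
  ev (fun i => (phi *m map_mx polyC (K *m B)) 0 i) (form Gamma) =
  \sum_i \sum_j phi 0 i * phi 0 j ^+ 5 * (c * herm (row i K) (row j K))%:P.
Proof.
have [_ [c c0 hc]] := hB; exists c => // phi.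
rewrite map_mxM mulmxA hc (herm_mul _ _ _ (polyC_char5 h5)) mulr_sumr.
apply: eq_bigr => i _; rewrite mulr_sumr; apply: eq_bigr => j _.
by rewrite -!map_row (herm_map (polyC : {rmorphism k -> {poly k}})) rmorphM /=; ring.
Qed.

(** Unlike in [shift_mx], the parameter is any element of [k]: contact points are not yet known to
    have parameters in the prime field. *)
Definition translation (t : k) : 'M[k]_3 := \matrix_(i, j)
  nth 0 (nth [::] [:: [:: 1; t; t ^+ 2]; [:: 0; 1; 2%:R * t]; [:: 0; 0; 1]] i) j.

Lemma translation_unit t : translation t \in unitmx.
Proof.
rewrite unitmxE unitfE det3E !mxE /= (_ : _ + _ = 1) ?oner_neq0 //; ring.
Qed.

Lemma conic_param_translation t :
  conic_param (translation t) = \row_j ('X + t%:P) ^+ j.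
Proof.
by apply: row3P; rewrite mul_row3E !mxE /= ?(rmorph0, rmorph1, rmorphXn, rmorphM, rmorph_nat); ring.
Qed.

Lemma conic_param_swap : conic_param (shift_mx k None) = \row_j 'X^(2 - j).
Proof.
by apply: row3P; rewrite mul_row3E !mxE /= ?(rmorph0, rmorph1); ring.
Qed.

Lemma quad_row_exp (R : comNzRingType) (x : R) : quad (\row_j x ^+ j) = 0.
Proof. by rewrite /quad !mxE /=; ring. Qed.

Lemma row_translation t : row i0 (translation t) = \row_j t ^+ j.
Proof. by apply: row3P; rewrite !mxE. Qed.

(** The order of vanishing and the prescribed number 2 are both intersection multiplicities at the
    same point, so they agree. *)
Lemma totally_tangent_ord Q N : totally_tangent Gamma Q -> param_by Q N ->
  points Gamma (pt (row i0 N)) -> ev (fun i => conic_param N 0 i) (form Gamma) != 0 ->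
  'X^2 %| ev (fun i => conic_param N 0 i) (form Gamma).
Proof.
move=> [_ tQ] hQ hP; set F := ev _ _ => F0; have [uN _] := hQ.
have [n [G]] := multiplicity_XsubC F 0; rewrite F0 /= subr0 => G0 FE.
have QP : points Q (pt (row i0 N)).
  apply/(param_by_points hQ); first exact: row_unitmx_neq0.
  by rewrite -row_mul mulmxV // /quad !mxE /=; ring.
have FE' : F = 'X^n * G by rewrite FE mulrC.
have mult := conic_intersection_mult hQ (form_homog Gamma) G0 FE'.
by rewrite FE' (intersection_mult_unique mult (tQ _ (conj QP hP))) dvdp_mulr.
Qed.

(** The coefficients of degree 7, 6 and 1 of the square successively kill those of degree 3, 2 and 1
    of [r]. *)
Lemma deg4_sqr (r : {poly k}) : size r = 5 -> r \is monic -> r`_0 != 0 ->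
  (r ^+ 2)`_1 = 0 -> (r ^+ 2)`_6 = 0 -> (r ^+ 2)`_7 = 0 -> r = 'X^4 + (r`_0)%:P.
Proof.
move=> sr /eqP; rewrite /lead_coef sr /= => r4 r00.
have rE : r = (r`_0)%:P + (r`_1)%:P * 'X + (r`_2)%:P * 'X^2 + (r`_3)%:P * 'X^3 + 'X^4.
  rewrite -{1}(coefK r) sr poly_def !big_ord_recl big_ord0 /= -!mul_polyC r4.
  by rewrite /bump /= expr0; ring.
set a := r`_0 in rE *; set b := r`_1 in rE *; set c := r`_2 in rE *; set d := r`_3 in rE *.
have r2E : r ^+ 2 = (a ^+ 2)%:P + (2%:R * a * b)%:P * 'X + (b ^+ 2 + 2%:R * a * c)%:P * 'X^2
   + (2%:R * (a * d + b * c))%:P * 'X^3 + (2%:R * a + 2%:R * b * d + c ^+ 2)%:P * 'X^4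
   + (2%:R * b + 2%:R * c * d)%:P * 'X^5 + (2%:R * c + d ^+ 2)%:P * 'X^6
   + (2%:R * d)%:P * 'X^7 + 'X^8.
  by rewrite rE !(rmorphM, rmorphD, rmorphXn, rmorph_nat) /=; ring.
rewrite r2E !coefD !coefCM !coefC !coefX !coefXn /= !mulr0 !mulr1 !addr0 !add0r.
move=> /eqP; rewrite !mulf_eq0 (negbTE two0) (negbTE r00) /= => /eqP b0 c0.
move=> /eqP; rewrite mulf_eq0 (negbTE two0) /= => /eqP d0.
move/eqP: c0; rewrite d0 expr0n addr0 mulf_eq0 (negbTE two0) /= => /eqP c0.
by rewrite rE b0 c0 d0; ring.
Qed.

(* Put two of the points of contact at 0 and infinity.  The equation of the curve
   restricted to the conic is then a polynomial with exponents i + 5 j, i, j <= 2,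
   equal to a X^2 r^2 with r of degree 4 by tangency; the gaps between these
   exponents force r = X^4 + b, so the Gram matrix of the conic is antidiagonal
   and becomes the standard one after rescaling. *)
Lemma tangent_conic_param Q : tangent_conics Gamma Q ->
  exists K, unitary 1 K /\ param_by Q (K *m B).
Proof.
move=> [nsQ tQ]; have [cardQ _] := tQ.
have [s [us ss sE]] := has_card_seq cardQ.
case: s us ss sE => [|P1 [|P2 s]] // us [ss] sE.
have inQ P : P \in [:: P1, P2 & s] -> points Q P /\ points Gamma P.
  by move=> hP; have : (points Q `&` points Gamma) P by rewrite sE.
have ins P : P \in s -> points Q P /\ points Gamma P.
  by move=> hP; exact: inQ _ (@mem_behead _ (P1 :: P2 :: s) _ (@mem_behead _ (P2 :: s) _ hP)).
have [QP1 GP1] := inQ P1 (mem_head _ _).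
have [QP2 GP2] : points Q P2 /\ points Gamma P2 by apply: inQ; rewrite !inE eqxx orbT.
have P12 : P1 <> P2 by move=> e; move: us; rewrite e /= inE eqxx.
have [N [hQ N1 N2]] := conic_frame_exists char5 nsQ QP1 QP2 P12.
have [uN _] := hQ; have [uB _] := hB.
pose K := N *m invmx B; have NE : N = K *m B by rewrite mulmxKV.
have uK : K \in unitmx by rewrite unitmx_mul uN unitmx_inv.
have [c c0 hc] := ev_frame_mul K; rewrite -NE in hc.
set h := fun i j => c * herm (row i K) (row j K) in hc.
pose F := ev (fun i => conic_param N 0 i) (form Gamma).
have FE : F = \sum_(i < 3) \sum_(j < 3) (h i j)%:P * 'X^(i + 5 * j).
  rewrite /F hc; apply: eq_bigr => i _; apply: eq_bigr => j _.
  by rewrite !mxE -exprM -exprD mulrC (mulnC j).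
(* The exponents i + 5 j with i, j <= 2 are pairwise distinct, so every Gram entry [h i j] is a
   coefficient of [F]. *)
have Fcoef s' : F`_s' = \sum_(i < 3) \sum_(j < 3) h i j *+ (s' == i + 5 * j)%N.
  rewrite FE coef_sum; apply: eq_bigr => i _; rewrite coef_sum; apply: eq_bigr => j _.
  by rewrite coefCM coefXn mulr_natr.
have F0 : F != 0.
  apply/eqP => F0; have h0 i j : h i j = 0.
    have : F`_(i + 5 * j) = 0 by rewrite F0 coef0.
    rewrite Fcoef !sum3E /=; move: i j.
    by apply: ord3_ind; apply: ord3_ind; rewrite /= !mulr0n !mulr1n ?addr0 ?add0r.
  have := herm_mul (delta_mx 0 i0 *m invmx K) (delta_mx 0 i2 *m invmx K) K h5.
  rewrite !mulmxKV // big1 => [|i _].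
    by rewrite /herm !mxE /= => /eqP; rewrite (_ : _ + _ = 1) ?oner_eq0 //; ring.
  rewrite big1 // => j _; have /eqP := h0 i j.
  by rewrite mulf_eq0 (negbTE c0) => /eqP ->; rewrite mulr0.
have evT t : ev (fun i => conic_param (translation t *m N) 0 i) (form Gamma) = F \Po ('X + t%:P).
  rewrite /conic_param map_mxM mulmxA -[_ *m map_mx _ (translation t)]/(conic_param _).
  rewrite conic_param_translation hc FE rmorph_sum; apply: eq_bigr => i _.
  rewrite rmorph_sum; apply: eq_bigr => j _ /=.
  by rewrite comp_polyM comp_polyC comp_Xn_poly !mxE -exprM -exprD mulrC (mulnC j).
have param_T t : param_by Q (translation t *m N).
  apply: param_by_reparam hQ; first exact: translation_unit.
  by rewrite conic_param_translation quad_row_exp.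
have rowT t : row i0 (translation t *m N) = (\row_j t ^+ j) *m N.
  by rewrite row_mul row_translation.
have dvdF t : points Gamma (pt ((\row_j t ^+ j) *m N)) -> ('X - t%:P) ^+ 2 %| F.
  rewrite -rowT => /(totally_tangent_ord tQ (param_T t)); rewrite evT.
  have F0' : F \Po ('X + t%:P) != 0.
    by apply: contra_neq F0 => e; rewrite -(comp_polyXaddC_K F t) e comp_poly0.
  move=> /(_ F0') /dvdpP [G GE]; apply/dvdpP; exists (G \Po ('X - t%:P)).
  by rewrite -{1}(comp_polyXaddC_K F t) GE comp_polyM comp_Xn_poly.
(* The second contact point sits at infinity; exchanging 0 and infinity reverses [F] in degree 12,
   so tangency there kills the two top coefficients. *)
have F_inf : F`_11 = 0 /\ F`_12 = 0.
  have := totally_tangent_ord tQ (param_by_shift char5 None hQ).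
  rewrite row_mul row_shift_mx.
  have -> : vrow k None *m N = row i2 N by rewrite [vrow k None]/= -rowE.
  rewrite N2; set F' := ev _ _ => /(_ GP2).
  have F'E : F' = \sum_(i < 3) \sum_(j < 3) (h i j)%:P * 'X^(2 - i + 5 * (2 - j)).
    rewrite /F' /conic_param map_mxM mulmxA -[_ *m map_mx _ (shift_mx _ _)]/(conic_param _).
    rewrite conic_param_swap hc; apply: eq_bigr => i _; apply: eq_bigr => j _.
    by rewrite !mxE -exprM -exprD mulrC (mulnC (2 - j)%N).
  have F'coef s' : F'`_s' = \sum_(i < 3) \sum_(j < 3) h i j *+ (s' == 2 - i + 5 * (2 - j))%N.
    rewrite F'E coef_sum; apply: eq_bigr => i _; rewrite coef_sum; apply: eq_bigr => j _.
    by rewrite coefCM coefXn mulr_natr.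
  have F'F : F'`_0 = F`_12 /\ F'`_1 = F`_11.
    by rewrite !Fcoef !F'coef !sum3E /= !mulr0n !mulr1n ?addr0 ?add0r.
  have [F'0|F'0] := eqVneq F' 0.
    by case: F'F => <- <-; rewrite F'0 !coef0.
  by move=> /(_ isT) /dvdpP [G GE]; case: F'F => <- <-; rewrite GE !coefMXn.
have tau_exists P : exists t, P \in s -> P = pt ((\row_j t ^+ j) *m N).
  have [Ps|Ps] := boolP (P \in s); last by exists 0.
  have [QP _] := ins _ Ps.
  have u0 := rep_neq0 P; rewrite -(pt_rep P) (param_by_points hQ u0) in QP.
  set x := rep P *m invmx N in QP; have xE : rep P = x *m N by rewrite mulmxKV.
  have x0 : x != 0 by rewrite mul_unitmx_neq0 ?unitmx_inv.
  have [[a [t [a0 hx]]]|[a a0 hx]] := quad_eq0 x0 QP.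
    exists t => _; rewrite -{1}(pt_rep P); apply: (@pt_eq _ _ _ a) => //.
    by rewrite xE hx scalemxAl.
  exfalso; have PP2 : P = P2.
    rewrite -(pt_rep P) -N2; apply: (@pt_eq _ _ _ a) => //.
    by rewrite xE hx -scalemxAl -rowE.
  by move: us; rewrite /= -PP2 Ps andbF.
have [tau htau] := choice tau_exists.
pose ts := [seq tau P | P <- s].
have uts : uniq ts.
  have us' : uniq s by case/and3P: us.
  rewrite map_inj_in_uniq // => P P' hP hP' e.
  by rewrite (htau P hP) (htau P' hP') e.
have ts0 : 0 \notin ts.
  apply/mapP => -[P hP t0]; have PE := htau P hP.
  have : P = P1.
    rewrite PE -N1 -t0; congr pt; rewrite rowE; congr (_ *m _).
    by apply: row3P; rewrite !mxE ?expr0n.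
  by move=> e; move: us; rewrite /= inE -e hP orbT.
pose r := \prod_(a <- ts) ('X - a%:P).
have dvd_r : ('X * r) ^+ 2 %| F.
  have := @sqr_XsubC_dvd _ (0 :: ts) F; rewrite big_cons subr0; apply.
    by rewrite /= ts0.
  move=> a; rewrite inE => /orP [/eqP ->|/mapP [P hP ->]]; apply: dvdF.
    have -> : (\row_j 0 ^+ j) *m N = row i0 N.
      by rewrite rowE; congr (_ *m _); apply: row3P; rewrite !mxE ?expr0n.
    by rewrite N1.
  by rewrite -(htau _ hP); case: (ins _ hP).
have mr : r \is monic by apply: monic_prod => a _; exact: monicXsubC.
have sr : size r = 5 by rewrite size_prod_XsubC size_map ss.
have r00 : r`_0 != 0.
  by rewrite -horner_coef0 -[_ == _]/(root r 0) root_prod_XsubC.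
have sF : (size F <= 11)%N.
  apply/leq_sizeP => s' hs'; have [->|n11] := eqVneq s' 11; first by case: F_inf.
  have [->|n12] := eqVneq s' 12; first by case: F_inf.
  rewrite Fcoef big1 // => i _; rewrite big1 // => j _.
  have := ltn_ord i; have := ltn_ord j.
  case: eqP => // e; move: e hs' n11 n12; clear; case: i; case: j => /=; lia.
(* The divisor has degree 10 and [F] has degree at most 10, so the cofactor is constant. *)
have [a Fa] : exists a, F = a *: ('X^2 * r ^+ 2).
  move/dvdpP: dvd_r => [G GE]; exists G`_0.
  have G0 : G != 0 by apply: contra_neq F0 => e; rewrite GE e mul0r.
  have mXr : ('X * r) ^+ 2 \is monic by rewrite monic_exp // monicMl ?monicX.
  have sG : (size G <= 1)%N.
    have : (size F <= 11)%N := sF.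
    have r0 := monic_neq0 mr.
    rewrite GE (size_Mmonic G0 mXr) exprMn size_Mmonic ?monic_exp // ?monic_neq0 ?monicXn //.
    rewrite size_polyXn expr2 (size_Mmonic r0 mr) sr; move: (size G) => n; clear; lia.
  by rewrite GE exprMn {1}(size1_polyC sG) mul_polyC.
have a0 : a != 0 by apply: contra_neq F0 => e; rewrite Fa e scale0r.
have coefr s' : F`_(s' + 2) = a * (r ^+ 2)`_s'.
  by rewrite Fa coefZ coefXnM ltnNge leq_addl /= addnK.
(* Exponents 3, 8 and 9 are not of the form i + 5 j; after removal of ['X^2] they are the degrees 1,
   6 and 7 of the square of [r]. *)
have Fz s' : all (fun i => all (fun j => s' != i + 5 * j) (iota 0 3)) (iota 0 3) -> F`_s' = 0.
  move=> hs'; rewrite Fcoef big1 // => i _; rewrite big1 // => j _.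
  move: hs'; case: eqP => // ->; move: i j.
  by apply: ord3_ind; apply: ord3_ind.
have r2z s' : F`_(s' + 2) = 0 -> (r ^+ 2)`_s' = 0.
  by rewrite coefr => /eqP; rewrite mulf_eq0 (negbTE a0) => /eqP.
have rE : r = 'X^4 + (r`_0)%:P.
  by apply: deg4_sqr => //; apply: r2z; apply: Fz.
set b := r`_0 in r00 rE.
have hE i j : h i j = a * (if (i + j == 2)%N then if i == i1 then 2%:R * b else
    if i == i0 then 1 else b ^+ 2 else 0).
  have : F`_(i + 5 * j) = a * ('X^10 + (2%:R * b)%:P * 'X^6 + (b ^+ 2)%:P * 'X^2)`_(i + 5 * j).
    rewrite Fa rE -coefZ; congr (polyseq (_ *: _))`_ _.
    by rewrite !(rmorphM, rmorphXn, rmorph_nat) /=; ring.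
  rewrite !coefD !coefCM !coefXn Fcoef !sum3E /=; move: i j.
  by apply: ord3_ind; apply: ord3_ind; rewrite /= ?mulr0n ?mulr1n ?addr0 ?add0r => ->; ring.
(* Scaling the parameter by [l] turns X^4 + b into a multiple of X^4 - 1, and the common factor [n]
   then normalises the Gram matrix. *)
have [l hl] := @root_exists k 4 (- b) isT.
have l0 : l != 0.
  by apply: contra_eq_neq hl => ->; rewrite expr0n eq_sym oppr_eq0.
have [n hn] := @root_exists k 6 (c / (a * l ^+ 10)) isT.
have n0 : n != 0.
  apply: contra_eq_neq hn => ->; rewrite expr0n eq_sym.
  by rewrite mulf_neq0 ?invr_eq0 ?mulf_neq0 ?expf_neq0.
pose D : 'M[k]_3 := n *: diag_mx (\row_j l ^+ j).
have rowD i : row i (D *m K) = (n * l ^+ i) *: row i K.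
  apply/rowP => j; rewrite /D -scalemxAl mul_diag_mx !mxE; ring.
have uD : D \in unitmx.
  rewrite unitmxZ ?unitfE // unitmxE det_diag unitfE; apply/prodf_neq0 => i _.
  by rewrite mxE expf_neq0.
exists (D *m K); split; first last.
  have hD : quad (conic_param D) = 0; last by rewrite -mulmxA -NE; apply: param_by_reparam uD hD hQ.
  rewrite /quad !mul_row3E !mxE /= !(rmorphM, rmorph0, rmorph_nat) /=; ring.
move=> i j; rewrite !rowD herm_scale.
apply: (mulfI c0); rewrite mulrCA -/(h i j) hE mul1r /gram.
have n6 : n ^+ 6 * (a * l ^+ 10) = c by rewrite hn divfK // mulf_neq0 ?expf_neq0.
have bE : b = - l ^+ 4 by rewrite hl opprK.
rewrite -[X in _ = X * _]n6 bE; move: i j.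
by apply: ord3_ind; apply: ord3_ind; rewrite /= ?mulr0n ?mulr1n; ring.
Qed.

End TangentParam.

(** * Lines through two points *)

Section PlaneLines.

Variable k : closedFieldType.
Implicit Types (u w x : 'rV[k]_3) (L : pcurve k 1).

Definition crossr u w : 'rV[k]_3 := \row_j nth 0
  [:: u 0 i1 * w 0 i2 - u 0 i2 * w 0 i1; u 0 i2 * w 0 i0 - u 0 i0 * w 0 i2;
      u 0 i0 * w 0 i1 - u 0 i1 * w 0 i0] j.

Lemma crossr_eq0 u w : w != 0 -> crossr u w = 0 -> exists c, u = c *: w.
Proof.
move=> w0 /rowP e.
have := e i0; have := e i1; have := e i2; rewrite !mxE /= => /subr0_eq h2 /subr0_eq h1 /subr0_eq h0.
have [w00|w00] := eqVneq (w 0 i0) 0; last first.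
  exists (u 0 i0 / w 0 i0); apply: row3P; rewrite !mxE /=.
  - by rewrite divfK.
  - by rewrite mulrAC h2 mulfK.
  - by rewrite mulrAC -h1 mulfK.
have [w01|w01] := eqVneq (w 0 i1) 0; last first.
  exists (u 0 i1 / w 0 i1); apply: row3P; rewrite !mxE /=.
  - by rewrite mulrAC -h2 mulfK.
  - by rewrite divfK.
  - by rewrite mulrAC h0 mulfK.
have w02 : w 0 i2 != 0 by apply: contra_neq w0 => w02; apply: row3P; rewrite mxE.
exists (u 0 i2 / w 0 i2); apply: row3P; rewrite !mxE /=.
- by rewrite mulrAC h1 mulfK.
- by rewrite mulrAC -h0 mulfK.
- by rewrite divfK.
Qed.

(** The double cross product identity; it makes a linear form vanishing at [u] and [w] proportional
    to their cross product. *)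
Lemma crossr_crossr a u w : crossr a (crossr u w) =
  (\sum_i a 0 i * w 0 i) *: u - (\sum_i a 0 i * u 0 i) *: w.
Proof. by apply: row3P; rewrite !sum3E !mxE /=; ring. Qed.

Definition linear_form (a : 'rV[k]_3) : {mpoly k[3]} := \sum_i a 0 i *: 'X_i.

Lemma mev_linear_form a x : mev (linear_form a) x = \sum_i a 0 i * x 0 i.
Proof.
by rewrite /mev rmorph_sum; apply: eq_bigr => i _ /=; rewrite mevalZ mevalXU.
Qed.

Lemma line_form L u w : u != 0 -> w != 0 -> crossr u w != 0 ->
  points L (pt u) -> points L (pt w) ->
  exists2 c, c != 0 & form L = c *: linear_form (crossr u w).
Proof.
move=> u0 w0 v0; have [a La] := dhomog1_expand (form_homog L).
pose ar : 'rV[k]_3 := \row_i a i.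
have LE : form L = linear_form ar.
  by rewrite La; apply: eq_bigr => i _; rewrite mxE.
rewrite !points_pt // LE !mev_linear_form => hu hw.
have [c ac] : exists c, ar = c *: crossr u w.
  by apply: crossr_eq0 => //; rewrite crossr_crossr hu hw !scale0r subrr.
have lE : form L = c *: linear_form (crossr u w).
  rewrite LE ac /linear_form scaler_sumr; apply: eq_bigr => i _.
  by rewrite mxE scalerA.
exists c; last by rewrite -LE.
by apply: contra_neq (form_neq0 L) => c0; rewrite lE c0 scale0r.
Qed.

Lemma crossr_pt_neq0 P P' : P <> P' -> crossr (rep P) (rep P') != 0.
Proof.
move=> PP'; apply/eqP => /(crossr_eq0 (rep_neq0 P')) [c e].
by apply: PP'; exact: proj_inj e.
Qed.

Lemma line_unique L L' P P' : P <> P' -> points L P -> points L P' ->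
  points L' P -> points L' P' -> L = L'.
Proof.
move=> PP' h1 h2 h3 h4; rewrite -(pt_rep P) in h1 h3; rewrite -(pt_rep P') in h2 h4.
have v0 := crossr_pt_neq0 PP'.
have [c c0 e] := line_form (rep_neq0 P) (rep_neq0 P') v0 h1 h2.
have [c' c'0 e'] := line_form (rep_neq0 P) (rep_neq0 P') v0 h3 h4.
by apply: (@curve_eq _ _ _ _ (c / c')); rewrite e e' scalerA divfK.
Qed.

Lemma line_exists u w : crossr u w != 0 ->
  exists L, forall x, x != 0 -> points L (pt x) <-> \sum_i crossr u w 0 i * x 0 i = 0.
Proof.
move=> v0; have f0 : linear_form (crossr u w) != 0.
  apply: contra_neq v0 => f0; apply/rowP => j; rewrite [RHS]mxE.
  have := congr1 (fun f => mev f (delta_mx 0 j)) f0.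
  rewrite /= mev_linear_form (bigD1 j) //= [delta_mx _ _ _ _]mxE !eqxx mulr1 big1 ?addr0 => [->|i ij].
    by rewrite /mev meval0.
  by rewrite [delta_mx _ _ _ _]mxE eqxx (negbTE ij) mulr0.
have hf : linear_form (crossr u w) \is 1.-homog.
  by apply: rpred_sum => i _; apply: rpredZ; rewrite dhomogX /= mdeg1.
have [L [c c0 hL]] := curve_exists hf f0.
exists L => x x0; rewrite points_pt // hL /mev mevalZ -[meval _ _]/(mev _ x) mev_linear_form.
split=> [/eqP|->]; last by rewrite mulr0.
by rewrite mulf_eq0 (negbTE c0) => /eqP.
Qed.

End PlaneLines.

(** * The field with 25 elements *)

(* [(a, b)] stands for [a + b * sqrt 2]; as 2 is not a square modulo 5 these
   are the elements of the field with 25 elements. *)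
Definition f25 : Type := (nat * nat)%type.
Definition vec : Type := (f25 * f25 * f25)%type.
Definition mat : Type := (vec * vec * vec)%type.

Fixpoint mod5 (n : nat) : nat := if n is m.+4.+1 then mod5 m else n.

Lemma mod5_lt n : (mod5 n < 5)%N.
Proof.
have [m] := ubnP n; elim: m n => // m IH n; case: n => [|[|[|[|[|n]]]]] //= hn.
by apply: IH; move: hn; clear; lia.
Qed.

Definition fadd (x y : f25) : f25 := (mod5 (x.1 + y.1), mod5 (x.2 + y.2)).
Definition fmul (x y : f25) : f25 :=
  (mod5 (x.1 * y.1 + 2 * (x.2 * y.2)), mod5 (x.1 * y.2 + x.2 * y.1)).
Definition fopp (x : f25) : f25 := (mod5 (4 * x.1), mod5 (4 * x.2)).
Definition fsub (x y : f25) : f25 := fadd x (fopp y).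
Definition fconj (x : f25) : f25 := (mod5 x.1, mod5 (4 * x.2)).
(** Components may be unreduced natural numbers, hence the reductions; equality in the field is
    [feq], not equality of pairs. *)
Definition fzero (x : f25) : bool := (mod5 x.1 == 0)%N && (mod5 x.2 == 0)%N.
Definition feq (x y : f25) : bool := fzero (fsub x y).
Definition f0 : f25 := (0, 0)%N.
Definition f1 : f25 := (1, 0)%N.
Definition f25_elements : seq f25 := [seq (a, b) | a <- iota 0 5, b <- iota 0 5].

Definition vdot (u : vec) (a b c : f25) : f25 :=
  fadd (fadd (fmul u.1.1 a) (fmul u.1.2 b)) (fmul u.2 c).

Definition vmul (u : vec) (M : mat) : vec :=
  let: (r0, r1, r2) := M in
  (vdot u r0.1.1 r1.1.1 r2.1.1, vdot u r0.1.2 r1.1.2 r2.1.2, vdot u r0.2 r1.2 r2.2).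

Definition hermc (u v : vec) : f25 :=
  vdot u (fconj v.2) (fmul (3, 0)%N (fconj v.1.2)) (fconj v.1.1).

Definition quadc (u : vec) : f25 := fsub (fmul u.1.1 u.2) (fmul u.1.2 u.1.2).

Definition cross (u v : vec) : vec :=
  (fsub (fmul u.1.2 v.2) (fmul u.2 v.1.2),
   fsub (fmul u.2 v.1.1) (fmul u.1.1 v.2),
   fsub (fmul u.1.1 v.1.2) (fmul u.1.2 v.1.1)).

Definition det3 (u v w : vec) : f25 :=
  let: (a, b, c) := cross u v in vdot w a b c.

Definition vzero (u : vec) : bool := [&& fzero u.1.1, fzero u.1.2 & fzero u.2].

Definition trmat (M : mat) : mat :=
  let: (r0, r1, r2) := M in
  ((r0.1.1, r1.1.1, r2.1.1), (r0.1.2, r1.1.2, r2.1.2), (r0.2, r1.2, r2.2)).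

Definition adjmat (M : mat) : mat :=
  let: (r0, r1, r2) := M in trmat (cross r1 r2, cross r2 r0, cross r0 r1).

Definition proportional (u v : vec) : bool := [&& vzero (cross u v), ~~ vzero u & ~~ vzero v].

Definition unitaryc (M : mat) : bool :=
  let: (r0, r1, r2) := M in
  [&& feq (hermc r0 r0) f0, feq (hermc r0 r1) f0, feq (hermc r0 r2) f1,
      feq (hermc r1 r0) f0, feq (hermc r1 r1) (3, 0)%N, feq (hermc r1 r2) f0,
      feq (hermc r2 r0) f1, feq (hermc r2 r1) f0 & feq (hermc r2 r2) f0].

Section HermitianClasses.

Variables (k : closedFieldType) (Gamma : pcurve k 6) (s : k).
Hypothesis char5 : 5%N \in [pchar k].
Hypothesis s2 : s ^+ 2 = 2%:R.
Let h5 : 5%:R = 0 :> k := pcharf0 char5.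
Implicit Types (B K : 'M[k]_3) (Q : pcurve k 2).

Local Notation tangent := (tangent_conics Gamma).

Definition iota25 (x : f25) : k := x.1%:R + x.2%:R * s.

Lemma natr_mod5 n : (mod5 n)%:R = n%:R :> k.
Proof.
have [m] := ubnP n; elim: m n => // m IH n; case: n => [|[|[|[|[|n]]]]] //=.
move=> /ltnW hn; rewrite IH; last by move: hn; clear; lia.
have -> : n.+4.+1 = (n + 5)%N by rewrite !addnS addn0.
by rewrite natrD h5 addr0.
Qed.

Lemma iota25D x y : iota25 (fadd x y) = iota25 x + iota25 y.
Proof. by rewrite /iota25 /= !natr_mod5 !natrD; ring. Qed.

Lemma iota25M x y : iota25 (fmul x y) = iota25 x * iota25 y.
Proof.
rewrite /iota25 /= !natr_mod5 !natrD !natrM.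
transitivity (x.1%:R * y.1%:R + s ^+ 2 * (x.2%:R * y.2%:R) + (x.1%:R * y.2%:R + x.2%:R * y.1%:R) * s).
  by rewrite s2; ring.
by ring.
Qed.

Lemma iota25N x : iota25 (fopp x) = - iota25 x.
Proof.
rewrite /iota25 /= !natr_mod5 !natrM.
transitivity (5%:R * (x.1%:R + x.2%:R * s) - (x.1%:R + x.2%:R * s)); first by ring.
by rewrite h5 mul0r add0r.
Qed.

Lemma iota25B x y : iota25 (fsub x y) = iota25 x - iota25 y.
Proof. by rewrite iota25D iota25N. Qed.

Lemma iota25_conj x : iota25 (fconj x) = iota25 x ^+ 5.
Proof.
have s5 : s ^+ 5 = - s.
  transitivity (s ^+ 2 * s ^+ 2 * s); first by ring.
  rewrite s2; transitivity (5%:R * s - s); first by ring.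
  by rewrite h5 mul0r add0r.
rewrite /iota25 expr5D // exprMn !natr_expr5 // s5 /= !natr_mod5 natrM.
transitivity (x.1%:R - x.2%:R * s + 5%:R * (x.2%:R * s)); first by ring.
by rewrite h5 mul0r addr0 mulrN.
Qed.

Lemma iota25_exp25 x : iota25 x ^+ 25 = iota25 x.
Proof.
rewrite (exprM _ 5 5) -!iota25_conj /iota25 /= !natr_mod5 !natrM !natr_mod5 !natrM.
transitivity (x.1%:R + x.2%:R * s + 5%:R * (3%:R * (x.2%:R * s))); first by ring.
by rewrite h5 mul0r addr0.
Qed.

Lemma iota25_0 : iota25 f0 = 0. Proof. by rewrite /iota25 /= mul0r addr0. Qed.
Lemma iota25_1 : iota25 f1 = 1. Proof. by rewrite /iota25 /= mul0r addr0. Qed.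

Lemma iota25_eq0 x : (iota25 x == 0) = fzero x.
Proof.
have nat0 n : (n%:R == 0 :> k) = (mod5 n == 0)%N.
  rewrite -natr_mod5; apply/eqP/eqP => [h|->//].
  by apply: (natr_inj5 char5 (mod5_lt n) (isT : (0 < 5)%N)); rewrite h.
have norm0 a b : (a%:R ^+ 2 - 2%:R * b%:R ^+ 2 == 0 :> k) -> (mod5 a == 0)%N && (mod5 b == 0)%N.
  move=> /eqP e; have /eqP : (mod5 a ^ 2 + 3 * mod5 b ^ 2)%:R = 0 :> k.
    rewrite natrD natrM !natrX !natr_mod5.
    transitivity (a%:R ^+ 2 - 2%:R * b%:R ^+ 2 + 5%:R * b%:R ^+ 2 : k); first by ring.
    by rewrite e h5 mul0r addr0.
  rewrite nat0; move: (mod5_lt a) (mod5_lt b); move: (mod5 a) (mod5 b).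
  by case=> [|[|[|[|[|?]]]]] //; case=> [|[|[|[|[|?]]]]].
apply/idP/idP => [/eqP e|/andP [] ]; last first.
  by rewrite -!nat0 /iota25 => /eqP -> /eqP ->; rewrite mul0r addr0.
apply: norm0; have -> : x.1%:R ^+ 2 - 2%:R * x.2%:R ^+ 2 = iota25 x * (x.1%:R - x.2%:R * s) :> k.
  by rewrite /iota25 -s2; ring.
by rewrite e mul0r.
Qed.

Lemma iota25_eq x y : (iota25 x == iota25 y) = feq x y.
Proof. by rewrite -subr_eq0 -iota25B iota25_eq0. Qed.

(** The 25 images are distinct roots of X^25 - X, which has no room for another one. *)
Lemma iota25_surj y : y ^+ 25 = y -> exists2 x, x \in f25_elements & y = iota25 x.
Proof.
move=> hy; pose p : {poly k} := 'X^25 - 'X.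
have sp : size p = 26.
  by rewrite /p size_polyDl ?size_polyXn // size_polyN size_polyX.
have p0 : p != 0 by rewrite -size_poly_eq0 sp.
have roots : all (root p) [seq iota25 x | x <- f25_elements].
  apply/allP => _ /mapP [x hx ->]; rewrite rootE !hornerE subr_eq0.
  rewrite (exprM (iota25 x) 5 5) -!iota25_conj iota25_eq.
  by apply: (allP (_ : all (fun x => feq (fconj (fconj x)) x) f25_elements)).
have us : uniq [seq iota25 x | x <- f25_elements].
  rewrite map_inj_in_uniq // => x y' hx hy' /eqP; rewrite iota25_eq => e.
  have /allP/(_ _ hx)/allP/(_ _ hy') : all (fun x => all (fun y => feq x y ==> (x == y)) f25_elements) f25_elements by [].
  by rewrite e => /eqP.
have [/mapP [x hx ->]|yn] := boolP (y \in [seq iota25 x | x <- f25_elements]); first by exists x.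
have sL : size [seq iota25 x | x <- f25_elements] = 25 by rewrite size_map.
move: roots us yn sL; move: [seq iota25 x | x <- f25_elements] => L rL uL yL sL.
have : (size (y :: L) < size p)%N.
  apply: max_poly_roots p0 _ _; rewrite /= ?yL ?uL // rL andbT.
  by rewrite rootE !hornerE hy subrr.
by rewrite /= sL sp.
Qed.

Lemma iota25_surj' y : y ^+ 25 = y -> exists x, y = iota25 x.
Proof. by move=> /iota25_surj [x _ ->]; exists x. Qed.

Definition irow (u : vec) : 'rV[k]_3 :=
  \row_j iota25 (nth f0 [:: u.1.1; u.1.2; u.2] j).

Definition imx (M : mat) : 'M[k]_3 :=
  \matrix_(i, j) irow (nth M.2 [:: M.1.1; M.1.2; M.2] i) 0 j.

Lemma irow_mul u M : irow (vmul u M) = irow u *m imx M.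
Proof.
case: M => [[r0 r1] r2]; apply: row3P; rewrite mul_row3E !mxE /=.
- by rewrite !(iota25D, iota25M).
- by rewrite !(iota25D, iota25M).
- by rewrite !(iota25D, iota25M).
Qed.

Lemma iota25_herm u v : iota25 (hermc u v) = herm (irow u) (irow v).
Proof.
rewrite /herm !mxE /= /hermc /vdot !(iota25D, iota25M) !iota25_conj.
have -> : iota25 (3, 0)%N = - 2%:R.
  rewrite /iota25 /= mul0r addr0; apply/eqP; rewrite -subr_eq0 opprK -natrD.
  by rewrite -h5.
by ring.
Qed.

Lemma iota25_quad u : iota25 (quadc u) = quad (irow u).
Proof. by rewrite /quad !mxE /= iota25B !iota25M expr2. Qed.

Lemma irow_eq0 u : (irow u == 0) = vzero u.
Proof.
apply/eqP/and3P => [/rowP e|[]].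
  by split; rewrite -iota25_eq0; [have := e i0|have := e i1|have := e i2]; rewrite !mxE /= => ->.
by rewrite -!iota25_eq0 => /eqP h0 /eqP h1 /eqP h2; apply: row3P; rewrite !mxE.
Qed.

Lemma irow_cross u v : irow (cross u v) = crossr (irow u) (irow v).
Proof. by apply: row3P; rewrite !mxE /= iota25B !iota25M. Qed.

Lemma proportionalP u v : proportional u v -> exists2 c, c != 0 & irow u = c *: irow v.
Proof.
rewrite /proportional -!irow_eq0 irow_cross => /and3P [/eqP h u0 v0].
have [c hc] := crossr_eq0 v0 h.
by exists c => //; apply: contra_neq u0 => c0; rewrite hc c0 scale0r.
Qed.

Lemma proportional_scale u v c : c != 0 -> irow u != 0 -> irow u = c *: irow v ->
  proportional u v.
Proof.
move=> c0 u0 e; have v0 : irow v != 0 by apply: contra_neq u0 => v0; rewrite e v0 scaler0.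
rewrite /proportional -!irow_eq0 irow_cross u0 v0 !andbT e; apply/eqP.
by apply: row3P; rewrite !mxE /=; ring.
Qed.

Lemma iota25_det u v w : iota25 (det3 u v w) =
  \det (\matrix_(i, j) irow (nth w [:: u; v; w] i) 0 j).
Proof.
rewrite det3E !mxE /= /det3 /= /vdot /= !(iota25D, iota25M, iota25B); ring.
Qed.

Lemma imx_adj M : imx M *m imx (adjmat M) = (\det (imx M))%:M.
Proof.
case: M => [[r0 r1] r2]; apply/matrixP; rewrite det3E => i j.
rewrite mxE sum3E !mxE /=; move: i j.
by apply: ord3_ind; apply: ord3_ind; rewrite /= ?mulr1n ?mulr0n !iota25B !iota25M; ring.
Qed.

Lemma unitarycP M : unitaryc M <-> unitary 1 (imx M).
Proof.
case: M => [[r0 r1] r2].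
have rowE i : row i (imx (r0, r1, r2)) = irow (nth r2 [:: r0; r1; r2] i).
  by apply/rowP => j; rewrite !mxE.
have gram3 : - 2%:R = iota25 (3, 0)%N.
  rewrite /iota25 /= mul0r addr0; apply/eqP; rewrite eq_sym -subr_eq0 opprK -natrD.
  by rewrite -h5.
split=> [|hM]; last first.
  rewrite /unitaryc -!iota25_eq !iota25_herm iota25_0 iota25_1 -gram3.
  have h (i j : 'I_3) : herm (irow (nth r2 [:: r0; r1; r2] i))
      (irow (nth r2 [:: r0; r1; r2] j)) = gram k i j.
    by rewrite -!rowE hM mul1r.
  have := h i0 i0; have := h i0 i1; have := h i0 i2; have := h i1 i0; have := h i1 i1.
  have := h i1 i2; have := h i2 i0; have := h i2 i1; have := h i2 i2.
  rewrite /gram /= => -> -> -> -> -> -> -> -> ->.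
  by rewrite !eqxx.
rewrite /unitaryc -!iota25_eq !iota25_herm iota25_0 iota25_1 -gram3.
case/and5P => /eqP h00 /eqP h01 /eqP h02 /eqP h10.
case/and5P => /eqP h11 /eqP h12 /eqP h20 /eqP h21 /eqP h22.
by apply: ord3_ind; apply: ord3_ind; rewrite !rowE /gram /= mul1r.
Qed.

(* With [F] the fifth power map and [J] the Gram matrix, K J F(K)^T = J, and the
   image of this equation under [F] yields F(F(K)) = K. *)
Lemma unitary_imx K : unitary 1 K -> exists2 M, unitaryc M & K = imx M.
Proof.
move=> hK; have K25 i j : K i j ^+ 25 = K i j.
  pose K5 := map_mx (fun x => x ^+ 5) K.
  pose J : 'M[k]_3 := \matrix_(i, j) gram k i j.
  have JJ : forall i j, gram k i j ^+ 5 = gram k i j.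
    move=> i' j'; rewrite /gram; case: ifP => _; last by rewrite expr0n.
    case: ifP => _; last by rewrite expr1n.
    have := natr_expr5 char5 2; rewrite -{2}[2%:R]opprK exprNn => e.
    rewrite -[X in _ = - X](natr_expr5 char5 2); ring.
  have KJK : K *m J *m K5^T = J.
    apply/matrixP => a b; rewrite [RHS]mxE -[RHS]mul1r -hK hermE.
    rewrite mxE sum3E !mxE !sum3E !mxE; ring.
  have uJ : J \in unitmx.
    rewrite unitmxE unitfE det3E !mxE /gram /=.
    rewrite (_ : _ + _ = 2%:R) ?(two_neq0 h5) //; ring.
  have KJK' : K5 *m J *m K^T = J.
    have JT : J^T = J.
      apply/matrixP => a b; rewrite !mxE /gram addnC; case: eqP => // ab.
      by move: a b ab; apply: ord3_ind; apply: ord3_ind.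
    by have := congr1 trmx KJK; rewrite !trmx_mul trmxK JT mulmxA.
  have KJK5 : K5 *m J *m (map_mx (fun x => x ^+ 5) K5)^T = J.
    apply/matrixP => a b; have := congr1 (fun M : 'M_3 => M a b ^+ 5) KJK.
    rewrite !mxE !sum3E !mxE !sum3E !mxE JJ => <-.
    by rewrite !(expr5D _ _ h5, exprMn) !JJ.
  have uKJ : K5 *m J \in unitmx.
    by move: uJ; rewrite -{1}KJK' unitmx_mul => /andP [].
  have : (map_mx (fun x => x ^+ 5) K5)^T = K^T.
    by rewrite -(mulKmx uKJ (map_mx _ _)^T) KJK5 -{2}KJK' mulKmx.
  by move=> /matrixP /(_ j i); rewrite !mxE -exprM.
have [e he] := choice (fun ij : 'I_3 * 'I_3 => iota25_surj' (K25 ij.1 ij.2)).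
pose r i := (e (i, i0), e (i, i1), e (i, i2)).
have KE : K = imx (r i0, r i1, r i2).
  apply/matrixP => i j; rewrite (he (i, j)) !mxE; move: i j.
  by apply: ord3_ind; apply: ord3_ind.
by exists (r i0, r i1, r i2) => //; apply/unitarycP; rewrite -KE.
Qed.

(** * Points and components as finite data *)

(** Finite maps on positive binary numbers, with lookups following the binary digits; this keeps the
    computations below feasible. *)
Inductive trie (A : Type) := Leaf | Node of trie A & A & trie A.
Arguments Leaf {A}.

Fixpoint get_pos (A : Type) (d : A) (t : trie A) (p : positive) : A :=
  match t, p with
  | Leaf, _ => d
  | Node _ x _, xH => x
  | Node l _ _, xO q => get_pos d l q
  | Node _ _ r, xI q => get_pos d r q
  end.

Definition get (A : Type) (d : A) (t : trie A) (n : N) : A :=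
  if n is Npos p then get_pos d t p else d.

Fixpoint set_pos (A : Type) (d : A) (t : trie A) (p : positive) (y : A) : trie A :=
  let: (l, x, r) := if t is Node l x r then (l, x, r) else (Leaf, d, Leaf) in
  match p with
  | xH => Node l y r
  | xO q => Node (set_pos d l q y) x r
  | xI q => Node l x (set_pos d r q y)
  end.

Definition trie_of (A : Type) (d : A) (ks : seq N) (xs : seq A) : trie A :=
  foldl (fun t kx => if kx.1 is Npos p then set_pos d t p kx.2 else t) Leaf (zip ks xs).

Definition keys (n : nat) : seq N := [seq bin_of_nat i | i <- iota 1 n].

(* The rational points, and the 150 components of G, are numbered from 1; the
   first component contains the conic x0 x2 = x1^2. *)
Definition points126 : seq N := Eval vm_compute in keys 126.

Definition classes150 : seq N := Eval vm_compute in keys 150.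

(** One vector per point, with leading entry 1. An isotropic vector with x0 = 0 also has x1 = 0,
    whence the single vector at the head; it receives the number 1. *)
Definition isotropic_vectors : seq vec :=
  (f0, f0, f1) ::
  [seq u <- [seq (f1, y, z) | y <- f25_elements, z <- f25_elements] | fzero (hermc u u)].

(** Here and below [Eval vm_compute] stores the table itself, so that later computations do not
    rebuild it. *)
Definition point_trie : trie vec :=
  Eval vm_compute in trie_of (f0, f0, f0) points126 isotropic_vectors.

Definition vpt (p : N) : vec := get (f0, f0, f0) point_trie p.

(** The conjugate divided by the norm; the inverse of a nonzero residue n modulo 5 is n^3. *)
Definition finv (x : f25) : f25 :=
  let n := mod5 (x.1 * x.1 + 3 * (x.2 * x.2)) in fmul (n * n * n, 0)%N (fconj x).

Definition vnormalize (u : vec) : vec :=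
  let x := if fzero u.1.1 then if fzero u.1.2 then u.2 else u.1.2 else u.1.1 in
  let y := finv x in (fmul y u.1.1, fmul y u.1.2, fmul y u.2).

Definition point_index (u : vec) : N :=
  let v := vnormalize u in nth N0 points126 (find (fun p => vpt p == v) points126).

Definition point_perm (M : mat) : trie N :=
  trie_of N0 points126 [seq point_index (vmul (vpt p) M) | p <- points126].

(** A translation and a diagonal matrix, each followed by its inverse, and the swap of the outer
    coordinates. The first four fix the point (0, 0, 1). *)
Definition generators : seq mat :=
  [:: (((1, 0), (1, 0), (1, 0)), ((0, 0), (1, 0), (2, 0)), ((0, 0), (0, 0), (1, 0)));
      (((1, 0), (4, 0), (1, 0)), ((0, 0), (1, 0), (3, 0)), ((0, 0), (0, 0), (1, 0)));
      (((1, 2), (0, 0), (0, 0)), ((0, 0), (1, 0), (0, 0)), ((0, 0), (0, 0), (2, 4)));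
      (((2, 1), (0, 0), (0, 0)), ((0, 0), (1, 0), (0, 0)), ((0, 0), (0, 0), (1, 3)));
      (((0, 0), (0, 0), (1, 0)), ((0, 0), (1, 0), (0, 0)), ((1, 0), (0, 0), (0, 0)))]%N.

Definition perms : seq (trie N) := Eval vm_compute in map point_perm generators.

Definition perm_at (g : nat) (p : N) : N := get N0 (nth Leaf perms g) p.

(* A matrix [M] encodes the image of the conic x0 x2 = x1^2 under [u |-> u M]. *)
Definition on_conic (M : mat) (p : N) : bool := fzero (quadc (vmul (vpt p) (adjmat M))).

Definition mmul (A B : mat) : mat :=
  let: (r0, r1, r2) := A in (vmul r0 B, vmul r1 B, vmul r2 B).

Definition block_of (M : mat) : seq N := [seq p <- points126 | on_conic M p].

(** On the parameter of the conic x0 x2 = x1^2 these act as a translation, the inversion and a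
    scaling by an element of the prime field. *)
Definition conic_stabilizer : seq mat :=
  [:: nth (nth (f0, f0, f0, (f0, f0, f0), (f0, f0, f0)) generators 0) generators 0;
      (((0, 0), (0, 0), (1, 0)), ((0, 0), (1, 0), (0, 0)), ((1, 0), (0, 0), (0, 0)));
      (((2, 0), (0, 0), (0, 0)), ((0, 0), (1, 0), (0, 0)), ((0, 0), (0, 0), (3, 0)))]%N.

(* Many matrices define the same conic; one is kept for each block. *)
Fixpoint conic_orbit (n i : nat) (s : seq (seq N * mat)) : seq (seq N * mat) :=
  if n is n'.+1 then
    let M := (nth (([::], (f0, f0, f0, (f0, f0, f0), (f0, f0, f0))) : seq N * mat) s i).2 in
    if (i < size s)%N then
      conic_orbit n' i.+1 (foldl (fun s' S =>
        let M' := mmul M S in let b := block_of M' in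
        if b \in map fst s' then s' else rcons s' (b, M')) s conic_stabilizer)
    else s
  else s.

Definition orbit_matrices (Ms : seq mat) : seq mat :=
  map snd (conic_orbit 100 0 [seq (block_of M, M) | M <- Ms]).

Definition id_mat : mat :=
  (((1, 0), (0, 0), (0, 0)), ((0, 0), (1, 0), (0, 0)), ((0, 0), (0, 0), (1, 0)))%N.

(** Seeds and orbits carry no proof by themselves: what is used about these lists is certified
    afterwards by computation. *)
Definition neighbor_matrices : seq mat := Eval vm_compute in orbit_matrices
  [:: (((1, 0), (0, 0), (0, 4)), ((0, 0), (1, 0), (0, 0)), ((0, 1), (0, 0), (4, 0)))]%N.

Definition class_matrices : seq mat := Eval vm_compute in
  id_mat :: neighbor_matrices ++ orbit_matrices
  [:: (((1, 0), (0, 4), (3, 0)), ((0, 3), (0, 0), (0, 1)), ((3, 0), (0, 3), (4, 0)))]%N.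

(** Together with [neighbor_matrices] these account for all conics sharing exactly three secants
    with the base conic; they meet it in at most two points and must be told apart from its
    neighbours. *)
Definition bitangent_matrices : seq mat := Eval vm_compute in orbit_matrices
  [:: (((1, 0), (0, 0), (0, 0)), ((0, 0), (2, 2), (0, 0)), ((0, 0), (0, 0), (1, 0)));
      (((1, 0), (0, 0), (0, 0)), ((0, 0), (2, 3), (0, 0)), ((0, 0), (0, 0), (1, 0)));
      (((1, 0), (0, 0), (0, 2)), ((0, 0), (2, 2), (0, 0)), ((0, 2), (0, 0), (4, 0)));
      (((1, 0), (0, 0), (0, 2)), ((0, 0), (2, 3), (0, 0)), ((0, 2), (0, 0), (4, 0)))]%N.

(* A partition of the points is given by the sequence of the smallest
   elements of the blocks of the points 1, ..., 126. *)
Definition base_labels : seq N :=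
  let bs := map block_of class_matrices in
  [seq head N0 (nth [::] bs (find (fun b => p \in b) bs)) | p <- points126].

Definition inverse_generator (g : nat) : nat := nth g [:: 1; 0; 3; 2; 4]%N g.

(** The new key of a point is the old label of its preimage. As [foldr] writes smaller points last,
    [first] keeps the smallest point of each block, so that equal partitions give equal
    sequences. *)
Definition act_labels (g : nat) (ls : seq N) : seq N :=
  let t := trie_of N0 points126 ls in
  let h := inverse_generator g in
  let key p := get N0 t (perm_at h p) in
  let first := foldr (fun p u => if key p is Npos q then set_pos N0 u q p else u)
    Leaf points126 in
  [seq get N0 first (key p) | p <- points126].

Fixpoint label_orbit (n i : nat) (s : seq (seq N)) : seq (seq N) :=
  if n is n'.+1 then
    if (i < size s)%N then
      label_orbit n' i.+1 (foldl (fun s' g =>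
        let ls := act_labels g (nth [::] s i) in
        if ls \in s' then s' else rcons s' ls) s (iota 0 5))
    else s
  else s.

Definition labels_list : seq (seq N) := Eval vm_compute in label_orbit 151 0 [:: base_labels].

Definition label_trie : trie (trie N) := Eval vm_compute in
  trie_of Leaf classes150 (map (trie_of N0 points126) labels_list).

(* A component is identified with the partition of the points cut out by its
   conics, and [label a p] names the block of [p]. *)
Definition label (a p : N) : N := get N0 (get Leaf label_trie a) p.

Definition class_perms : seq (trie N) := Eval vm_compute in
  [seq trie_of N0 classes150
    [seq nth N0 classes150 (index (act_labels g ls) labels_list) | ls <- labels_list]
  | g <- iota 0 5].

Definition class_at (g : nat) (a : N) : N := get N0 (nth Leaf class_perms g) a.

Definition representatives (a : N) : seq N := [seq p <- points126 | label a p == p].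

Definition block (a b : N) : seq N := [seq p <- points126 | label a p == b].

Definition first_blocks : seq (seq N) := Eval vm_compute in
  [seq block (Npos xH) b | b <- representatives (Npos xH)].

(* Number of blocks of a class meeting [bl] in [m] points, given the labels
   [rs] of its blocks and the labels [ls] of the points of [bl]. *)
Definition meet_number (rs ls : seq N) (m : nat) : nat :=
  count (fun r => count_mem r ls == m) rs.

Definition is_alpha (rs ls : seq N) : bool :=
  (meet_number rs ls 2 == 3)%N && (meet_number rs ls 0 == 18)%N.

Definition is_gamma (rs ls : seq N) : bool :=
  (meet_number rs ls 1 == 6)%N && (meet_number rs ls 0 == 15)%N.

(* 1 stands for alpha^15 gamma^6, 2 for alpha^3 gamma^18. *)
Definition first_type (a : N) : nat :=
  let rs := representatives a in
  let lss := [seq map (label a) bl | bl <- first_blocks] in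
  let x := count (is_alpha rs) lss in let y := count (is_gamma rs) lss in
  if (x == 15)%N && (y == 6)%N then 1%N
  else if (x == 3)%N && (y == 18)%N then 2%N else 0%N.

Definition first_types : trie nat := Eval vm_compute in
  trie_of 0%N classes150 (map first_type classes150).

(** Only the row of the first class comes from the geometry; the others follow from T(g a, c) = T(a,
    g^-1 c). Classes are numbered in the order in which [label_orbit] finds them, so a row is filled
    before it is used. *)
Fixpoint type_orbit (ord : seq N) (rows : trie (trie nat)) : trie (trie nat) :=
  if ord is a :: ord' then
    let row := get Leaf rows a in
    type_orbit ord' (foldl (fun t g =>
      if class_at g a is Npos b then
        if get_pos Leaf t b is Leaf then
          set_pos Leaf t b (trie_of 0%N classes150
            [seq get 0%N row (class_at (inverse_generator g) c) | c <- classes150])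
        else t
      else t) rows (iota 0 5))
  else rows.

Definition type_trie : trie (trie nat) := Eval vm_compute in
  type_orbit classes150 (set_pos Leaf Leaf xH first_types).

Definition pair_type_code (a b : N) : nat := get 0%N (get Leaf type_trie a) b.

Fixpoint reach (n : nat) (next : N -> seq N) (seen front : seq N) : seq N :=
  if n is n'.+1 then
    let new := undup [seq x <- flatten (map next front) | x \notin seen] in
    reach n' next (seen ++ new) new
  else seen.

Definition first_component : seq N := Eval vm_compute in
  reach 10 (fun a => [seq b <- classes150 | pair_type_code a b == 1%N]) [:: Npos xH] [:: Npos xH].

Definition other_classes : seq N := Eval vm_compute in
  [seq a <- classes150 | a \notin first_component].

Definition component_edges : seq (N * N) := Eval vm_compute in
  [seq ab <- [seq (a, b) | a <- first_component, b <- first_component] |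
    (pair_type_code ab.1 ab.2 == 1)%N &&
    (index ab.1 first_component < index ab.2 first_component)%N].

(* A vertex of H'' is encoded by [(a, b)] for an edge and by [(a, a)] for
   a class outside the first component. *)
Definition h_vertices : seq (N * N) := Eval vm_compute in
  component_edges ++ [seq (a, a) | a <- other_classes].

Definition h_adj (x y : N * N) : bool :=
  let t := pair_type_code in
  if x.1 == x.2 then
    if y.1 == y.2 then (x.1 != y.1) && ((t x.1 y.1 == 1) || (t x.1 y.1 == 2))%N
    else (t y.1 x.1 == 2)%N && (t y.2 x.1 == 2)%N
  else
    if y.1 == y.2 then (t x.1 y.1 == 2)%N && (t x.2 y.1 == 2)%N
    else [&& x.1 != y.1, x.1 != y.2, x.2 != y.1, x.2 != y.2 &
          [|| t x.1 y.1 == 1, t x.1 y.2 == 1, t x.2 y.1 == 1 | t x.2 y.2 == 1]%N].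

Fixpoint common (r q : seq bool) : nat :=
  match r, q with
  | b :: r', c :: q' => if b && c then (common r' q').+1 else common r' q'
  | _, _ => 0%N
  end.

(** Adjacency rows are computed once as Boolean sequences; common neighbours are counted by running
    along two of them. *)
Definition srg_check : bool :=
  let rows := [seq (x, [seq h_adj x y | y <- h_vertices]) | x <- h_vertices] in
  all (fun x => let: (v, r) := x in (common r r == 112)%N &&
    all (fun y => let: (w, q) := y in
       (common r q ==
         (if v == w then 112 else if h_adj v w then 30 else 56))%N) rows) rows.

(** * Certificates obtained by computation *)

Notation pt1 := (Npos xH).
Notation pt2 := (Npos (xO xH)).

Definition no_mat : mat := (f0, f0, f0, (f0, f0, f0), (f0, f0, f0)).
Definition generator (g : nat) : mat := nth no_mat generators g.

Lemma vpt_isotropic : map vpt points126 = isotropic_vectors.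
Proof. by vm_compute. Qed.

Lemma vpt_check : all (fun p => ~~ vzero (vpt p) && fzero (hermc (vpt p) (vpt p))) points126.
Proof. by vm_compute. Qed.

Lemma points126_uniq : uniq points126. Proof. by vm_compute. Qed.

Lemma vpt_proportional : all (fun p => all (fun q =>
  proportional (vpt p) (vpt q) ==> (p == q)) points126) points126.
Proof. by vm_compute. Qed.

Definition perm_check (M : mat) (f : N -> N) : bool :=
  [&& unitaryc M,
      all (fun p => (f p \in points126) && proportional (vpt (f p)) (vmul (vpt p) M)) points126
    & all (fun q => has (fun p => f p == q) points126) points126].

Lemma generators_perm : all (fun g => perm_check (generator g) (perm_at g)) (iota 0 5).
Proof. by vm_compute. Qed.

Lemma generators_inverse : all (fun g => (inverse_generator g < 5)%N &&
  (mmul (generator (inverse_generator g)) (generator g) == id_mat)) (iota 0 5).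
Proof. by vm_compute. Qed.

Lemma label_representative : all (fun a => all (fun p =>
  (label a p \in points126) && (label a (label a p) == label a p)) points126) classes150.
Proof. by vm_compute. Qed.

(** The image of each block of [a] lies in one block of [b], and different blocks go to different
    blocks. *)
Definition maps_class (f : N -> N) (a b : N) : bool :=
  all (fun p => label b (f p) == label b (f (label a p))) points126 &&
  uniq [seq label b (f r) | r <- representatives a].

Lemma class_perms_check : all (fun g => all (fun a =>
  [&& class_at g a \in classes150, maps_class (perm_at g) a (class_at g a)
    & class_at (inverse_generator g) (class_at g a) == a]) classes150) (iota 0 5).
Proof. by vm_compute. Qed.

Lemma classes_reach : all (fun a => a \in
  reach 20 (fun a => [seq class_at g a | g <- iota 0 5]) [:: pt1] [:: pt1]) classes150.
Proof. by vm_compute. Qed.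

Lemma points_reach : all (fun p => p \in
  reach 20 (fun p => [seq perm_at g p | g <- iota 0 5]) [:: pt1] [:: pt1]) points126.
Proof. by vm_compute. Qed.

(** With [points_reach] this is double transitivity on the rational points. *)
Lemma points_reach_stabilizer : all (fun p => (p == pt1) || (p \in
  reach 20 (fun p => [seq perm_at g p | g <- iota 0 4]) [:: pt2] [:: pt2])) points126 &&
  all (fun g => perm_at g pt1 == pt1) (iota 0 4).
Proof. by vm_compute. Qed.

(** The conic x0 x2 = d x1^2, which passes through the points numbered 1 and 2; for d^6 = 1 these
    are the conics that [good_diagonal] meets. *)
Definition diagonal_conic (d : f25) (p : N) : bool :=
  feq (fmul (vpt p).1.1 (vpt p).2) (fmul d (fmul (vpt p).1.2 (vpt p).1.2)).

Definition find_class (f : N -> bool) : N * N :=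
  let bl := filter f points126 in
  (head N0 [seq a <- classes150 |
     all (fun p => (p \in bl) == (label a p == head N0 bl)) points126],
   head N0 bl).

Definition diagonal_classes : seq (f25 * (N * N)) := Eval vm_compute in
  [seq (d, find_class (diagonal_conic d)) |
    d <- [seq d <- f25_elements | feq (fmul d (fmul d (fmul d (fmul d (fmul d d))))) f1]].

Lemma diagonal_conics_check :
  all (fun d => feq (fmul d (fmul d (fmul d (fmul d (fmul d d))))) f1 ==>
    has (fun e => e.1 == d) diagonal_classes) f25_elements &&
  all (fun e => [&& e.2.1 \in classes150, e.2.2 \in representatives e.2.1 &
    all (fun p => diagonal_conic e.1 p == (label e.2.1 p == e.2.2)) points126]) diagonal_classes.
Proof. by vm_compute. Qed.

Definition matrix_classes (Ms : seq mat) : seq (mat * (N * N)) :=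
  [seq (M, find_class (on_conic M)) | M <- Ms].

Definition neighbor_classes := Eval vm_compute in matrix_classes neighbor_matrices.
Definition bitangent_classes := Eval vm_compute in matrix_classes bitangent_matrices.
Definition first_class : seq (mat * (N * seq N)) := Eval vm_compute in
  [seq (M, (head N0 (block_of M), [seq point_index (vmul (vpt p) M) | p <- points126])) |
    M <- class_matrices].

Definition perm_of (ps : seq N) (p : N) : N := nth N0 ps (index p points126).

Definition matrix_class_check (e : mat * (N * N)) : bool :=
  [&& unitaryc e.1, e.2.1 \in classes150, e.2.2 \in representatives e.2.1 &
    all (fun p => on_conic e.1 p == (label e.2.1 p == e.2.2)) points126].

Lemma neighbor_classes_check : all matrix_class_check neighbor_classes.
Proof. by vm_compute. Qed.

Lemma neighbor_first_class : all (fun e => e.2.1 == pt1) neighbor_classes.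
Proof. by vm_compute. Qed.

Lemma bitangent_classes_check : all matrix_class_check bitangent_classes.
Proof. by vm_compute. Qed.

Lemma first_class_check : all (fun e =>
   [&& matrix_class_check (e.1, (pt1, e.2.1)), perm_check e.1 (perm_of e.2.2)
     & maps_class (perm_of e.2.2) pt1 pt1]) first_class.
Proof. by vm_compute. Qed.

Lemma first_class_complete :
  all (fun b => has (fun e => e.2.1 == b) first_class) (representatives pt1).
Proof. by vm_compute. Qed.

(** Neighbours of the conic with block [b], obtained by carrying those of the base conic along a
    matrix that sends the base conic to it. *)
Definition first_class_step (b : N) : seq N :=
  flatten [seq [seq label pt1 (perm_of e.2.2 c.2.2) | c <- neighbor_classes] |
    e <- first_class & e.2.1 == b].

Definition base_block : N := Eval vm_compute in head N0 (block_of id_mat).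

Lemma first_class_connected : all (fun b => b \in
  reach 5 first_class_step [:: base_block] [:: base_block]) (representatives pt1).
Proof. by vm_compute. Qed.

Lemma base_block_check : matrix_class_check (id_mat, (pt1, base_block)).
Proof. by vm_compute. Qed.

Definition pairs (s : seq N) : seq (N * N) :=
  [seq pq <- [seq (p, q) | p <- s, q <- s] | (index pq.1 s < index pq.2 s)%N].

Definition base_points : seq N := Eval vm_compute in block pt1 base_block.

Definition base_lines : seq (N * N * seq N) := Eval vm_compute in
  [seq (pq, [seq r <- points126 | fzero (det3 (vpt pq.1) (vpt pq.2) (vpt r))]) |
     pq <- pairs base_points].

Lemma base_lines_check : all (fun l => all (fun r =>
   fzero (det3 (vpt l.1.1) (vpt l.1.2) (vpt r)) == (r \in l.2)) points126) base_lines.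
Proof. by vm_compute. Qed.

Lemma base_lines_pairs : map fst base_lines = pairs base_points.
Proof. by vm_compute. Qed.

Lemma base_lines_uniq : uniq base_lines && all (fun l : N * N * seq N =>
  uniq l.2 && all (mem points126) l.2) base_lines.
Proof. by vm_compute. Qed.

(** Makes distinct entries define distinct lines. *)
Lemma base_lines_meet : all (fun l : N * N * seq N => all (fun l' : N * N * seq N =>
  (l'.1.1 \in l.2) && (l'.1.2 \in l.2) ==> (l == l')) base_lines) base_lines.
Proof. by vm_compute. Qed.

Lemma base_pointsE : base_points = block pt1 base_block.
Proof. by vm_compute. Qed.

(* Number of secants of the base conic which are also secants of the conic
   with block [b] of the class [a]. *)
Definition common_secants (a b : N) : nat :=
  count (fun l => 2 <= count (fun p => label a p == b) l.2)%N base_lines.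

(** Serves to show that a neighbour, which has three secants in common with the base conic, differs
    from it. *)
Lemma base_common_secants : (common_secants pt1 base_block != 3)%N.
Proof. by vm_compute. Qed.

Lemma common_secants_check : all (fun a => all (fun b =>
  (common_secants a b == 3)%N ==>
    has (fun e => e.2 == (a, b)) (neighbor_classes ++ bitangent_classes))
  (representatives a)) classes150.
Proof. by vm_compute. Qed.

Lemma neighbor_common_secants : all (fun e => common_secants e.2.1 e.2.2 == 3)%N neighbor_classes.
Proof. by vm_compute. Qed.

(* Coefficients of the restriction of [quad (_ * M)] to the points
   [(x^2, xy, y^2)], as a binary quartic form in [x] and [y]. *)
Definition quartic (M : mat) : seq f25 :=
  let: (r0, r1, r2) := M in
  let b u v := fsub (fadd (fmul u.1.1 v.2) (fmul v.1.1 u.2))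
                    (fmul (2, 0)%N (fmul u.1.2 v.1.2)) in
  [:: quadc r0; b r0 r1; fadd (quadc r1) (b r0 r2); b r1 r2; quadc r2].

Definition mul_linear (a b : f25) (cs : seq f25) : seq f25 :=
  [seq fadd (fmul a c.1) (fmul b c.2) | c <- zip (rcons cs f0) (f0 :: cs)].

(** A root [r] stands for the linear factor [r.2] x - [r.1] y. *)
Definition quartic_of_roots (c : f25) (rs : seq (f25 * f25)) : seq f25 :=
  foldr (fun r cs => mul_linear r.2 (fopp r.1) cs) [:: c] rs.

Definition projective_line : seq (f25 * f25) := (f0, f1) :: [seq (f1, t) | t <- f25_elements].

(** Fewer than four roots are interpreted as two double roots, whence [rs ++ rs]; [quartic_check]
    certifies the resulting factorisation. *)
Definition quartic_data (M : mat) : f25 * seq (f25 * f25) :=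
  let cs := quartic (adjmat M) in
  let eval r := foldr fadd f0 [seq fmul (nth f0 cs i)
    (fmul (iter (4 - i) (fmul r.1) f1) (iter i (fmul r.2) f1)) | i <- iota 0 5] in
  let rs := [seq r <- projective_line | fzero (eval r)] in
  let rs4 := if (size rs == 4)%N then rs else rs ++ rs in
  (head f0 [seq c <- f25_elements | all2 feq cs (quartic_of_roots c rs4)], rs4).

Definition neighbor_quartics : seq (mat * (f25 * seq (f25 * f25))) :=
  Eval vm_compute in [seq (M, quartic_data M) | M <- neighbor_matrices].
Definition bitangent_quartics : seq (mat * (f25 * seq (f25 * f25))) :=
  Eval vm_compute in [seq (M, quartic_data M) | M <- bitangent_matrices].

Definition quartic_check (e : mat * (f25 * seq (f25 * f25))) : bool :=
  [&& (size e.2.2 == 4)%N, ~~ fzero e.2.1,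
      all (fun r => ~~ (fzero r.1 && fzero r.2)) e.2.2 &
      all2 feq (quartic (adjmat e.1)) (quartic_of_roots e.2.1 e.2.2)].

Definition distinct_roots (rs : seq (f25 * f25)) : bool :=
  uniq rs && all (fun r => all (fun r' =>
    (r == r') || ~~ fzero (fsub (fmul r.1 r'.2) (fmul r.2 r'.1))) rs) rs.

Lemma neighbor_quartics_check :
  all (fun e => quartic_check e && distinct_roots e.2.2) neighbor_quartics.
Proof. by vm_compute. Qed.

Lemma bitangent_quartics_check : all (fun e => quartic_check e &&
  (take 2%N e.2.2 == drop 2%N e.2.2)) bitangent_quartics.
Proof. by vm_compute. Qed.

Lemma neighbor_quartics_matrices : map fst neighbor_classes = map fst neighbor_quartics.
Proof. by vm_compute. Qed.

Lemma bitangent_quartics_matrices : map fst bitangent_classes = map fst bitangent_quartics.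
Proof. by vm_compute. Qed.

Lemma first_class_distinct : all (fun a => (a == pt1) || all (fun bl =>
  ~~ all (fun p => label a p == label a (head N0 bl)) bl) first_blocks) classes150.
Proof. by vm_compute. Qed.

Lemma first_blocksE : first_blocks = [seq block pt1 b | b <- representatives pt1].
Proof. by vm_compute. Qed.

Lemma first_typesE : all (fun a => pair_type_code pt1 a == first_type a) classes150.
Proof. by vm_compute. Qed.

Lemma pair_type_invariant : all (fun g => all (fun a => all (fun b =>
  pair_type_code (class_at g a) (class_at g b) == pair_type_code a b)
  classes150) classes150) (iota 0 5).
Proof. by vm_compute. Qed.

Lemma pair_type_sym : all (fun a => (pair_type_code a a == 0)%N && all (fun b =>
  pair_type_code a b == pair_type_code b a) classes150) classes150.
Proof. by vm_compute. Qed.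

Lemma first_component_sub : (pt1 \in first_component) && all (mem classes150) first_component.
Proof. by vm_compute. Qed.

Lemma first_component_closed : all (fun a => all (fun b =>
  (pair_type_code a b == 1)%N ==> (b \in first_component)) classes150) first_component.
Proof. by vm_compute. Qed.

Lemma first_component_connected : all (fun a => a \in
  reach 10 (fun a => [seq b <- classes150 | pair_type_code a b == 1%N]) [:: pt1] [:: pt1])
  first_component.
Proof. by vm_compute. Qed.

Lemma h_verticesE : h_vertices = component_edges ++ [seq (a, a) | a <- other_classes].
Proof. by vm_compute. Qed.

Lemma other_classesE : other_classes = [seq a <- classes150 | a \notin first_component].
Proof. by vm_compute. Qed.

Lemma component_edges_check : all (fun e => [&& e.1 \in first_component,
    e.2 \in first_component, e.1 != e.2, (pair_type_code e.1 e.2 == 1)%N &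
    (e.2, e.1) \notin component_edges]) component_edges &&
  all (fun a => all (fun b => (pair_type_code a b == 1)%N ==>
    ((a, b) \in component_edges) || ((b, a) \in component_edges)) first_component)
  first_component.
Proof. by vm_compute. Qed.

Lemma h_vertices_uniq : uniq h_vertices. Proof. by vm_compute. Qed.

Lemma h_vertices_size : size h_vertices = 275%N. Proof. by vm_compute. Qed.

Lemma srg_checked : srg_check. Proof. by vm_compute. Qed.

Lemma h_adj_sym : all (fun v => ~~ h_adj v v && all (fun w => h_adj v w == h_adj w v)
  h_vertices) h_vertices.
Proof. by vm_compute. Qed.

(** * Rational points and blocks in a frame *)

Definition vrow_of (p : N) : 'rV[k]_3 := irow (vpt p).

Definition at_point B (p : N) : ppoint k := pt (vrow_of p *m B).

Lemma vrow_of_neq0 p : p \in points126 -> vrow_of p != 0.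
Proof.
by move=> hp; rewrite irow_eq0 //; case/andP: (allP vpt_check _ hp).
Qed.

Lemma herm_vrow_of p : p \in points126 -> herm (vrow_of p) (vrow_of p) = 0.
Proof.
move=> hp; rewrite -iota25_herm //; apply/eqP; rewrite iota25_eq0 //.
by case/andP: (allP vpt_check _ hp).
Qed.

Lemma at_row_neq0 B p : B \in unitmx -> p \in points126 -> vrow_of p *m B != 0.
Proof. by move=> uB hp; rewrite mul_unitmx_neq0 ?vrow_of_neq0. Qed.

Lemma at_point_inj B : B \in unitmx -> {in points126 &, injective (at_point B)}.
Proof.
move=> uB p q hp hq /pt_eqP []; rewrite ?at_row_neq0 // => c c0.
rewrite scalemxAl => /(can_inj (mulmxK uB)) e.
have /implyP/(_ _)/eqP := allP (allP vpt_proportional _ hp) _ hq; apply.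
exact: proportional_scale c0 (vrow_of_neq0 hp) e.
Qed.

Lemma at_point_Gamma B p : frame Gamma B -> p \in points126 -> points Gamma (at_point B p).
Proof.
move=> hB hp; have [uB _] := hB; have [c c0 hc] := frame_mev hB.
by apply/points_pt; rewrite ?at_row_neq0 // hc herm_vrow_of ?mulr0.
Qed.

Lemma isotropic_point (u : 'rV[k]_3) : u != 0 -> herm u u = 0 ->
  (forall j, u 0 j ^+ 25 = u 0 j) ->
  exists2 p, p \in points126 & exists2 c, c != 0 & u = c *: vrow_of p.
Proof.
move=> u0 hu u25.
have vptP v : v \in isotropic_vectors -> exists2 p, p \in points126 & v = vpt p.
  by rewrite -vpt_isotropic => /mapP [p hp ->]; exists p.
have [u00|u00] := eqVneq (u 0 i0) 0.
  have u01 : u 0 i1 = 0.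
    move/eqP: hu; rewrite /herm u00 !mul0r expr0n /= mulr0 addr0 add0r oppr_eq0.
    by rewrite -mulrA -exprS mulf_eq0 (negbTE (two_neq0 h5)) expf_eq0 => /eqP.
  have [p hp vE] := vptP (f0, f0, f1) (mem_head _ _).
  exists p => //; exists (u 0 i2).
    by apply: contra_neq u0 => u02; apply: row3P; rewrite mxE.
  apply: row3P; rewrite !mxE -vE /= ?(iota25_0, iota25_1) ?mulr0 ?mulr1 //.
have ratio j : exists2 x, x \in f25_elements & u 0 j / u 0 i0 = iota25 x.
  by apply: iota25_surj => //; rewrite expr_div_n !u25.
have [y hy yE] := ratio i1; have [z hz zE] := ratio i2.
have uE : u = u 0 i0 *: irow (f1, y, z).
  apply: row3P; rewrite !mxE /= ?iota25_1 ?mulr1 // -?yE -?zE mulrC divfK //.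
have [|p hp vE] := vptP (f1, y, z).
  rewrite inE mem_filter; apply/orP; right; apply/andP; split.
    rewrite -iota25_eq0 iota25_herm //.
    move/eqP: hu; rewrite uE herm_scale mulf_eq0 => /orP [|//].
    by rewrite -exprS expf_eq0 /= (negbTE u00).
  by apply: allpairs_f.
by exists p => //; exists (u 0 i0); rewrite // /vrow_of -vE.
Qed.

Lemma perm_check_at M f B p : perm_check M f -> B \in unitmx -> p \in points126 ->
  at_point (imx M *m B) p = at_point B (f p).
Proof.
move=> /and3P [_ /allP hf _] uB hp; have /andP [hfp] := hf _ hp.
move=> /proportionalP [c c0]; rewrite irow_mul // => e.
apply: esym; apply: (@pt_eq _ _ _ c); first by rewrite at_row_neq0.
by rewrite mulmxA scalemxAl -e.
Qed.

Lemma frame_imx M B : unitaryc M -> frame Gamma B -> frame Gamma (imx M *m B).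
Proof.
by move=> hM; apply: (frame_unitary char5 (oner_neq0 _)); apply/unitarycP.
Qed.

Lemma unitary_mul K M : unitary 1 K -> unitary 1 M -> unitary 1 (K *m M : 'M[k]_3).
Proof. by move=> hK hM i j; rewrite !row_mul (unitary_herm _ _ h5 hM) mul1r hK. Qed.

(** Rows 0 and 2 of a unitary matrix are isotropic with entries in the field with 25 elements, so
    they are tabulated; the number found does not depend on the frame. *)
Lemma unitary_row_point K i : unitary 1 K -> (i == i0) || (i == i2) ->
  exists2 p, p \in points126 & forall B, B \in unitmx -> pt (row i (K *m B)) = at_point B p.
Proof.
move=> hK hi; have uK := unitary_unitmx h5 (oner_neq0 _) hK.
have [M hM KE] := unitary_imx hK.
have [||j|p hp [c c0 e]] := @isotropic_point (row i K).
- exact: row_unitmx_neq0.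
- by rewrite hK mul1r /gram; move: i hi; apply: ord3_ind.
- by rewrite mxE KE !mxE iota25_exp25.
exists p => // B uB; rewrite row_mul.
apply: (@pt_eq _ _ _ c); last by rewrite e scalemxAl.
by rewrite mul_unitmx_neq0 ?row_unitmx_neq0.
Qed.

Lemma reach_ind (A : N -> Prop) (n : nat) (next : N -> seq N) (seen front : seq N) :
  {in seen, forall x, A x} -> {in front, forall x, A x} ->
  (forall x y, A x -> y \in next x -> A y) ->
  {in reach n next seen front, forall x, A x}.
Proof.
move=> hs hf hn; elim: n seen front hs hf => //= n IH seen front hs hf.
have hnew : {in undup [seq x <- flatten [seq next i | i <- front] | x \notin seen],
    forall x, A x}.
  move=> x; rewrite mem_undup mem_filter => /andP [_ /flattenP [_ /mapP [y hy ->]]].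
  exact: hn (hf _ hy).
apply: IH => // x; rewrite mem_cat => /orP [/hs //|]; exact: hnew.
Qed.

Lemma uniq_map_in_inj (T U : eqType) (f : T -> U) (r : seq T) :
  uniq (map f r) -> {in r &, injective f}.
Proof.
elim: r => //= x r IH /andP [fx /IH fI] y z; rewrite !inE.
move=> /orP [/eqP ->|ys] /orP [/eqP ->|zs] // e.
- by case/mapP: fx; exists z.
- by case/mapP: fx; exists y.
exact: fI.
Qed.

Lemma label_rep a p : a \in classes150 -> p \in points126 ->
  label a p \in representatives a.
Proof.
move=> ha hp; have /andP [h1 h2] := allP (allP label_representative _ ha) _ hp.
by rewrite mem_filter h1 h2.
Qed.

Lemma rep_label a b : b \in representatives a -> b \in points126 /\ label a b = b.
Proof. by rewrite mem_filter => /andP [/eqP]. Qed.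

Lemma generator_perm g : (g < 5)%N -> perm_check (generator g) (perm_at g).
Proof. by move=> hg; apply: (allP generators_perm); rewrite mem_iota. Qed.

Lemma class_perm_check g a : (g < 5)%N -> a \in classes150 ->
  [/\ class_at g a \in classes150, maps_class (perm_at g) a (class_at g a)
    & class_at (inverse_generator g) (class_at g a) = a].
Proof.
move=> hg ha; have hi : g \in iota 0 5 by rewrite mem_iota.
by have /and3P [? ? /eqP] := allP (allP class_perms_check _ hi) _ ha.
Qed.

Lemma inverse_generator_lt g : (g < 5)%N -> (inverse_generator g < 5)%N.
Proof.
move=> hg; have hi : g \in iota 0 5 by rewrite mem_iota.
by case/andP: (allP generators_inverse _ hi).
Qed.

Lemma imx_mul M M' : imx (mmul M M') = imx M *m imx M'.
Proof.
case: M => [[r0 r1] r2]; apply/row_matrixP => i; rewrite row_mul.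
have rowE a b c : row i (imx (a, b, c)) = irow (nth c [:: a; b; c] i).
  by apply/rowP => j; rewrite !mxE.
rewrite !rowE; move: i {rowE}; apply: ord3_ind => /=; exact: irow_mul.
Qed.

Lemma imx1 : imx id_mat = 1%:M.
Proof.
apply/matrixP; apply: ord3_ind; apply: ord3_ind;
  by rewrite !mxE /= /iota25 /= ?mul0r ?addr0.
Qed.

Lemma generator_mulV g B : (g < 5)%N ->
  imx (generator (inverse_generator g)) *m (imx (generator g) *m B) = B.
Proof.
move=> hg; have hi : g \in iota 0 5 by rewrite mem_iota.
have /andP [_ /eqP e] := allP generators_inverse _ hi.
by rewrite mulmxA -imx_mul e imx1 mul1mx.
Qed.

Lemma unitary_generator g : (g < 5)%N -> unitary 1 (imx (generator g)).
Proof. by move=> /generator_perm /and3P [hu _ _]; apply/unitarycP. Qed.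

Lemma frame_generator g B : (g < 5)%N -> frame Gamma B ->
  frame Gamma (imx (generator g) *m B).
Proof.
by move=> hg hB; apply: frame_imx => //; have /and3P [] := generator_perm hg.
Qed.

Definition has_block B Q (a b : N) : Prop :=
  {in points126, forall p, points Q (at_point B p) <-> label a p = b}.

(** Changing the frame by [M] renumbers the points by [f]. One implication is constancy of labels on
    images of blocks, the other that images of distinct blocks stay distinct. *)
Lemma has_block_transport M f B Q a b c : perm_check M f -> maps_class f a c ->
  a \in classes150 -> c \in classes150 -> b \in representatives a -> B \in unitmx ->
  has_block (imx M *m B) Q a b ->
  has_block B Q c (label c (f b)) /\ label c (f b) \in representatives c.
Proof.
move=> hM /andP [/allP hf uf] ha hc hb uB hQ; have [hbp lb] := rep_label hb.
have [_ fM fsurj] := and3P hM.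
split; last by apply: label_rep => //; have /andP [] := allP fM _ hbp.
move=> q hq; have /hasP [p hp /eqP fp] := allP fsurj _ hq.
rewrite -fp -(perm_check_at hM uB hp) (hQ _ hp) (eqP (hf _ hp)).
split=> [->//|e]; apply: (uniq_map_in_inj uf) => //; exact: label_rep.
Qed.

Definition good B Q : Prop :=
  exists a b, [/\ a \in classes150, b \in representatives a & has_block B Q a b].

Lemma good_generator g B Q : (g < 5)%N -> B \in unitmx ->
  good (imx (generator g) *m B) Q -> good B Q.
Proof.
move=> hg uB [a [b [ha hb hQ]]]; have [hc hmap _] := class_perm_check hg ha.
have [h1 h2] := has_block_transport (generator_perm hg) hmap ha hc hb uB hQ.
by exists (class_at g a), (label (class_at g a) (perm_at g b)).
Qed.

Lemma quadZ (R : comNzRingType) (c : R) (x : 'rV[R]_3) : quad (c *: x) = c ^+ 2 * quad x.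
Proof. by rewrite /quad !mxE; ring. Qed.

Lemma points_at B Q K p : K \in unitmx -> B \in unitmx -> param_by Q (K *m B) ->
  p \in points126 ->
  points Q (at_point B p) <-> quad (vrow_of p *m invmx K) = 0.
Proof.
move=> uK uB hQ hp.
rewrite (param_by_points hQ (at_row_neq0 uB hp)).
have -> : invmx (K *m B) = invmx B *m invmx K.
  have uKB : K *m B \in unitmx by rewrite unitmx_mul uK.
  rewrite -[RHS](mulmxK uKB) -[X in _ = X *m _]mulmxA.
  by rewrite (mulmxA (invmx K)) mulVmx // mul1mx mulVmx // mul1mx.
by rewrite mulmxA mulmxK.
Qed.

(** The adjugate differs from the inverse by the determinant, which multiplies the quadratic form by
    a nonzero square. *)
Lemma points_on_conic M B Q p : unitaryc M -> B \in unitmx -> param_by Q (imx M *m B) ->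
  p \in points126 -> points Q (at_point B p) <-> on_conic M p.
Proof.
move=> /unitarycP hM uB hQ hp.
have uM := unitary_unitmx h5 (oner_neq0 _) hM.
rewrite (points_at uM uB hQ hp).
have d0 : \det (imx M) != 0 by rewrite -unitfE -unitmxE.
have -> : invmx (imx M) = (\det (imx M))^-1 *: imx (adjmat M).
  rewrite -[RHS](mulKmx uM) -scalemxAr imx_adj scale_scalar_mx mulVf //.
  by rewrite mulmx1.
rewrite -scalemxAr -irow_mul // quadZ -iota25_quad // /on_conic -iota25_eq0.
split=> [/eqP|/eqP ->]; last by rewrite mulr0.
by rewrite mulf_eq0 expf_eq0 invr_eq0 (negbTE d0).
Qed.

Lemma vrow_of1 : vrow_of pt1 = delta_mx 0 i2.
Proof. by apply: row3P; rewrite !mxE /= /iota25 /= ?mul0r ?addr0. Qed.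

Lemma vrow_of2 : vrow_of pt2 = delta_mx 0 i0.
Proof. by apply: row3P; rewrite !mxE /= /iota25 /= ?mul0r ?addr0. Qed.

(** Unitarity makes [K] diagonal with entries a, b, c, so the conic is x0 x2 = d x1^2 with d = a c /
    b^2. The relations a c^5 = c a^5 = b^6 = 1 give d^6 = 1, and these values of d are tabulated. *)
Lemma good_diagonal B K Q : B \in unitmx -> unitary 1 K -> param_by Q (K *m B) ->
  pt (row i2 (K *m B)) = at_point B pt1 -> pt (row i0 (K *m B)) = at_point B pt2 ->
  good B Q.
Proof.
move=> uB hK hQ; have uK := unitary_unitmx h5 (oner_neq0 _) hK.
have [uKB _] := hQ.
have hpt1 : pt1 \in points126 by [].
have hpt2 : pt2 \in points126 by [].
move=> /pt_eqP []; rewrite ?row_unitmx_neq0 ?at_row_neq0 // => c c0.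
rewrite row_mul scalemxAl vrow_of1 => /(can_inj (mulmxK uB)) K2.
move=> /pt_eqP []; rewrite ?row_unitmx_neq0 ?at_row_neq0 // => a a0.
rewrite row_mul scalemxAl vrow_of2 => /(can_inj (mulmxK uB)) K0.
have e02 := hK i0 i2; have e20 := hK i2 i0.
have e10 := hK i1 i0; have e12 := hK i1 i2; have e11 := hK i1 i1.
rewrite K2 K0 !herm_scale /gram /= !mulr1 in e02 e20.
have h02 : herm (delta_mx 0 i0) (delta_mx 0 i2 : 'rV[k]_3) = 1.
  by rewrite /herm !mxE /=; ring.
have h20 : herm (delta_mx 0 i2) (delta_mx 0 i0 : 'rV[k]_3) = 1.
  by rewrite /herm !mxE /=; ring.
rewrite h02 mulr1 in e02; rewrite h20 mulr1 in e20.
set r := row i1 K in e10 e12 e11.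
have r2 : r 0 i2 = 0.
  move/eqP: e10; rewrite K0 /gram /= mulr0 /herm !mxE /= !mulr1 !mulr0 expr0n /=.
  rewrite !mulr0 subrr add0r mulf_eq0 expf_eq0 (negbTE a0) orbF.
  by move/eqP.
have r0 : r 0 i0 = 0.
  move/eqP: e12; rewrite K2 /gram /= mulr0 /herm !mxE /= !mulr1 !mulr0 expr0n /=.
  rewrite !mulr0 subr0 addr0 mulf_eq0 expf_eq0 (negbTE c0) orbF.
  by move/eqP.
have b6 : (r 0 i1) ^+ 6 = 1.
  apply: (mulfI (two_neq0 h5)); apply: oppr_inj; rewrite mulr1.
  move: e11; rewrite mul1r /gram /= => <-; rewrite /herm r0 r2; ring.
set b := r 0 i1 in b6.
have b0 : b != 0 by apply: contra_eq_neq b6 => ->; rewrite expr0n eq_sym oner_eq0.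
pose d := a * c / b ^+ 2.
have d6 : d ^+ 6 = 1.
  rewrite /d expr_div_n exprMn -exprM mulnC exprM b6 expr1n divr1.
  by transitivity ((a * c ^+ 5) * (c * a ^+ 5)); [ring | rewrite e02 e20 mulr1].
have [|d' hd' dE] := iota25_surj (y := d).
  by transitivity ((d ^+ 6) ^+ 4 * d); [ring | rewrite d6 expr1n mul1r].
have [/allP/(_ _ hd')/implyP h1 /allP h2] := andP diagonal_conics_check.
have /h1 /hasP [e he /eqP e1] : feq (fmul d' (fmul d' (fmul d' (fmul d' (fmul d' d'))))) f1.
  rewrite -iota25_eq !iota25M // -dE iota25_1; apply/eqP.
  by rewrite -d6; ring.
have /and3P [ha hb /allP hab] := h2 _ he.
exists e.2.1, e.2.2; split => // p hp.
rewrite (points_at uK uB hQ hp).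
have invK : vrow_of p *m invmx K =
    \row_j nth 0 [:: vrow_of p 0 i0 / a; vrow_of p 0 i1 / b; vrow_of p 0 i2 / c] j.
  have rE : K = \matrix_(i, j) nth 0 (nth [::] [:: [:: a; 0; 0]; [:: 0; b; 0]; [:: 0; 0; c]] i) j.
    apply/row_matrixP; apply: ord3_ind.
    - by rewrite K0; apply: row3P; rewrite !mxE /= ?mulr1 ?mulr0.
    - by rewrite -/r; apply: row3P; rewrite [RHS]mxE [RHS]mxE.
    - by rewrite K2; apply: row3P; rewrite !mxE /= ?mulr1 ?mulr0.
  rewrite -[RHS](mulmxK uK); congr (_ *m _); rewrite {1}rE.
  by apply: row3P; rewrite mul_row3E !mxE /= !mulr0 ?addr0 ?add0r divfK.
have -> : (quad (vrow_of p *m invmx K) = 0) <-> diagonal_conic e.1 p.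
  rewrite /diagonal_conic e1 -iota25_eq !iota25M // -dE invK /quad !mxE /=.
  rewrite -!/(vpt p).
  split => [/eqP|/eqP h].
    rewrite subr_eq0 => /eqP h; apply/eqP.
    transitivity (a * c * (iota25 (vpt p).1.1 / a * (iota25 (vpt p).2 / c))); first by field; rewrite a0 c0.
    by rewrite h /d; field.
  apply/eqP; rewrite subr_eq0; apply/eqP.
  transitivity (iota25 (vpt p).1.1 * iota25 (vpt p).2 / (a * c)); first by field; rewrite a0 c0.
  by rewrite h /d; field; rewrite a0 b0 c0.
by rewrite (eqP (hab _ hp)); split => /eqP.
Qed.

(** By double transitivity the contact points at infinity and 0 can be moved to the points 1 and 2.
    A generator is absorbed by [B] and its inverse by [K], so the matrix [K *m B] of the conic never
    changes. *)
Lemma tangent_good B Q : frame Gamma B -> tangent_conics Gamma Q -> good B Q.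
Proof.
move=> hB hQ; have [K [hK hQK]] := tangent_conic_param char5 hB hQ.
have [uB _] := hB.
have step g B' K' : (g < 5)%N -> B' \in unitmx -> unitary 1 K' ->
  [/\ imx (generator g) *m B' \in unitmx,
      unitary 1 (K' *m imx (generator (inverse_generator g)))
    & K' *m imx (generator (inverse_generator g)) *m (imx (generator g) *m B') = K' *m B'].
  move=> hg uB' hK'; split.
  - by rewrite unitmx_mul uB' andbT (unitary_unitmx h5 (oner_neq0 _) (unitary_generator hg)).
  - by apply: unitary_mul => //; apply: unitary_generator; apply: inverse_generator_lt.
  - by rewrite -mulmxA generator_mulV.
have perm_mem g p : (g < 5)%N -> p \in points126 -> perm_at g p \in points126.
  by move=> hg hp; have /and3P [_ /allP/(_ _ hp)/andP []] := generator_perm hg.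
(* With one contact point already at point 1, only the generators fixing it are used to move the
   other. *)
pose A2 p := p \in points126 /\ forall B K, B \in unitmx -> unitary 1 K ->
  param_by Q (K *m B) -> pt (row i2 (K *m B)) = at_point B pt1 ->
  pt (row i0 (K *m B)) = at_point B p -> good B Q.
have hA2 p : p \in points126 -> p != pt1 -> A2 p.
  have /andP [/allP hreach /allP fix1] := points_reach_stabilizer.
  move=> hp p1; have := hreach _ hp; rewrite (negbTE p1) orFb; move: p {hp p1}.
  have base : A2 pt2 by split=> // B' K'; exact: good_diagonal.
  apply: reach_ind => [x|x|]; [by rewrite inE => /eqP -> | by rewrite inE => /eqP -> |].
  move=> x y [hx IH] /mapP [g hg ->].
  have g5 : (g < 5)%N by move: hg; rewrite mem_iota => /andP [_ /ltnW].
  split; first exact: perm_mem.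
  move=> B' K' uB' hK' hQ' h2 h0; have [uB'' hK'' e] := step _ _ _ g5 uB' hK'.
  apply: (good_generator g5 uB'); apply: (IH _ _ uB'' hK''); rewrite e //.
    rewrite h2 (perm_check_at (generator_perm g5)) //.
    by rewrite (eqP (fix1 _ hg)).
  by rewrite h0 (perm_check_at (generator_perm g5)).
pose A p := p \in points126 /\ forall B K, B \in unitmx -> unitary 1 K ->
  param_by Q (K *m B) -> pt (row i2 (K *m B)) = at_point B p -> good B Q.
have hA p : p \in points126 -> A p.
  move=> hp; have := allP points_reach _ hp; move: p {hp}.
  have base : A pt1.
    split=> // B' K' uB' hK' hQ' h2.
    have [p hp /(_ _ uB') h0] := unitary_row_point (i := i0) hK' isT.
    (* Rows 0 and 2 of an invertible matrix cannot define the same point. *)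
    have [p1|p1] := eqVneq p pt1; last exact: (hA2 p hp p1).2 h2 h0.
    have [uKB _] := hQ'; move: h0; rewrite p1 -h2.
    move=> /pt_eqP []; rewrite ?row_unitmx_neq0 // => c c0 e.
    have := congr1 (fun r : 'rV_3 => (r *m invmx (K' *m B')) 0 i0) e.
    rewrite -scalemxAl -!row_mul mulmxV // !mxE /= mulr0 => /eqP.
    by rewrite oner_eq0.
  apply: reach_ind => [x|x|]; [by rewrite inE => /eqP -> | by rewrite inE => /eqP -> |].
  move=> x y [hx IH] /mapP [g hg ->].
  have g5 : (g < 5)%N by move: hg; rewrite mem_iota.
  split; first exact: perm_mem.
  move=> B' K' uB' hK' hQ' h2; have [uB'' hK'' e] := step _ _ _ g5 uB' hK'.
  apply: (good_generator g5 uB'); apply: (IH _ _ uB'' hK''); rewrite e //.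
  by rewrite h2 (perm_check_at (generator_perm g5)).
have [p hp h2] := unitary_row_point (i := i2) hK isT.
exact: (hA p hp).2 hQK (h2 _ uB).
Qed.

(** * The components of G and of H *)

Lemma has_card_count (I : eqType) (T : Type) (f : I -> T) (r : seq I) (Pd : T -> Prop)
    (pb : pred I) n :
  uniq r -> {in r &, injective f} -> {in r, forall i, Pd (f i) <-> pb i} ->
  has_card [set x | (f @` [set` r]) x /\ Pd x] n <-> count pb r = n.
Proof.
move=> ur fI hP.
have -> : [set x | (f @` [set` r]) x /\ Pd x] = f @` [set` filter pb r].
  apply/seteqP; split => [x [[i ri <-] /(hP _ ri) pi]|_ [i ri <-]].
    by exists i => //=; rewrite mem_filter pi.
  move: ri; rewrite /= mem_filter => /andP [pi ri].
  by split; [exists i | apply/(hP _ ri)].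
have card : has_card (f @` [set` filter pb r]) (size (filter pb r)).
  apply: has_card_image; first exact: filter_uniq.
  by apply: sub_in2 fI => i; rewrite mem_filter => /andP [].
rewrite -size_filter; split => [h|<- //]; exact: has_card_inj card h.
Qed.

(** After a shift a contact point is row 0 of a unitary matrix times the frame, hence one of the
    rational points. *)
Lemma tangent_meet B Q a b : frame Gamma B -> tangent Q -> has_block B Q a b ->
  points Q `&` points Gamma = at_point B @` [set` block a b].
Proof.
move=> hB tQ hQ; have [uB _] := hB; apply/seteqP; split => P; last first.
  move=> [p]; rewrite /= mem_filter => /andP [/eqP lp hp] <-.
  by split; [apply/(hQ _ hp) | exact: at_point_Gamma].
have [K [hK hQK]] := tangent_conic_param char5 hB tQ => hP.
have hKB := frame_unitary char5 (oner_neq0 _) hK hB.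
move: (hP); rewrite (meet_points char5 hQK hKB) => -[o _ PE].
have hoK : unitary 1 (shift_mx k o *m K).
  by apply: unitary_mul hK; exact: unitary_shift_mx.
have [p hp /(_ _ uB)] := unitary_row_point (i := i0) hoK isT.
rewrite -mulmxA row_mul row_shift_mx PE => Pp.
exists p => //=; rewrite mem_filter hp andbT; apply/eqP/(hQ _ hp).
by rewrite -Pp; case: hP.
Qed.

(** On a parametrisation of [Q] the equation of [Q'] has degree at most 4, yet it vanishes at the
    five finite parameters of contact. *)
Lemma has_block_unique B Q Q' a b : frame Gamma B -> tangent Q -> tangent Q' ->
  has_block B Q a b -> has_block B Q' a b -> Q = Q'.
Proof.
move=> hB tQ tQ' hQ hQ'; have [K [hK hQK]] := tangent_conic_param char5 hB tQ.
have hKB := frame_unitary char5 (oner_neq0 _) hK hB.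
have := tangent_meet hB tQ hQ; rewrite -(tangent_meet hB tQ' hQ').
rewrite (meet_points char5 hQK hKB) => mE.
have [uKB _] := hQK; set N := K *m B in hQK hKB mE uKB.
apply: (param_by_unique hQK); split => //.
set F := ev _ _; apply/eqP/negPn/negP => F0.
have roots : all (root F) [seq t%:R | t <- iota 0 5].
  apply/allP => _ /mapP [t ht ->].
  have : (points Q' `&` points Gamma) (pt (vrow k (Some t) *m N)).
    have ht' : Some t \in params by rewrite /params in_cons map_f.
    by rewrite -mE; exists (Some t).
  have n0 : vrow k (Some t) *m N != 0 by rewrite mul_unitmx_neq0 ?(vrow_neq0 char5).
  move=> [/(points_pt Q' n0) e _]; rewrite rootE horner_ev -e /mev.
  apply/eqP; apply: meval_eq => i.
  by rewrite !mul_row3E !mxE !hornerD !hornerM !hornerC !hornerXn.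
have us : uniq [seq t%:R : k | t <- iota 0 5].
  rewrite map_inj_in_uniq ?iota_uniq // => x y; rewrite !mem_iota => hx hy.
  exact: natr_inj5.
have := max_poly_roots F0 roots us; rewrite size_map size_iota.
by rewrite ltnNge (@size_ev _ 2 2 _ _ (form_homog Q')) // => i; exact: size_conic_param.
Qed.

Lemma matrix_class_conic e B : matrix_class_check e -> frame Gamma B ->
  exists Q, [/\ param_by Q (imx e.1 *m B), tangent Q & has_block B Q e.2.1 e.2.2].
Proof.
move=> /and4P [hu _ _ /allP hc] hB; have [uB _] := hB.
have hMB := frame_imx hu hB; have [uMB _] := hMB.
have [Q hQ] := param_by_exists uMB.
exists Q; split => //; first exact: tangent_conic_frame hQ hMB.
move=> p hp; rewrite (points_on_conic hu uB hQ hp).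
by rewrite (eqP (hc _ hp)); split => /eqP.
Qed.

Definition class_conics B a : set (pcurve k 2) :=
  [set Q | tangent Q /\ exists2 b, b \in representatives a & has_block B Q a b].

Lemma class_conics_sub M f B a c : perm_check M f -> maps_class f a c ->
  a \in classes150 -> c \in classes150 -> B \in unitmx ->
  class_conics (imx M *m B) a `<=` class_conics B c.
Proof.
move=> hM hf ha hc uB Q [tQ [b hb hQ]]; split => //.
have [h1 h2] := has_block_transport hM hf ha hc hb uB hQ.
by exists (label c (f b)).
Qed.

Lemma class_conics_generator g B a : (g < 5)%N -> a \in classes150 -> frame Gamma B ->
  class_conics (imx (generator g) *m B) a = class_conics B (class_at g a).
Proof.
move=> hg ha hB; have [uB _] := hB; have [hc hmap ca] := class_perm_check hg ha.
have [uB' _] := frame_generator hg hB.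
apply/seteqP; split; first exact: class_conics_sub (generator_perm hg) hmap ha hc uB.
have hg' := inverse_generator_lt hg.
have [hc' hmap' _] := class_perm_check hg' hc; rewrite ca in hc' hmap'.
have := class_conics_sub (generator_perm hg') hmap' hc hc' uB'.
by rewrite (generator_mulV).
Qed.

Lemma classes_ind (A : N -> Prop) : A pt1 ->
  (forall a g, a \in classes150 -> (g < 5)%N -> A a -> A (class_at g a)) ->
  {in classes150, forall a, A a}.
Proof.
move=> A1 hA a ha; have := allP classes_reach _ ha; move: a {ha}.
suff h : {in reach 20 (fun a => [seq class_at g a | g <- iota 0 5]) [:: pt1] [:: pt1],
    forall a, a \in classes150 /\ A a} by move=> a /h [].
apply: reach_ind => [x|x|x y [hx Ax]]; first by rewrite inE => /eqP ->.
  by rewrite inE => /eqP ->.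
case/mapP => g hg ->; have g5 : (g < 5)%N by move: hg; rewrite mem_iota.
have [hc _ _] := class_perm_check g5 hx; split => //; exact: hA.
Qed.

Lemma first_class_mem b : b \in representatives pt1 ->
  exists2 e, e \in first_class & e.2.1 = b.
Proof. by move=> hb; have /hasP [e he /eqP] := allP first_class_complete _ hb; exists e. Qed.

(** Explicit matrices cover the first class; a block of [class_at g a] is the image of a block of
    [a], whose conic is found in the frame changed by [g]. *)
Lemma block_exists a b B : a \in classes150 -> b \in representatives a ->
  frame Gamma B -> exists Q, tangent Q /\ has_block B Q a b.
Proof.
move=> ha; move: a ha b B.
apply: (@classes_ind (fun a => forall b B, b \in representatives a -> frame Gamma B ->
  exists Q, tangent Q /\ has_block B Q a b)) => [b B hb hB|a g ha hg IH b B hb hB].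
  have [e he eb] := first_class_mem hb.
  have /and3P [hM _ _] := allP first_class_check _ he.
  have [Q [_ tQ]] := matrix_class_conic hM hB; rewrite /= eb; by exists Q.
have [uB _] := hB.
have [hc hmap ca] := class_perm_check hg ha.
have [hbp lb] := rep_label hb.
have /and3P [_ /allP fM /allP fsurj] := generator_perm hg.
have /hasP [q hq /eqP qb] := fsurj _ hbp.
have [Q [tQ hQ]] := IH _ _ (label_rep ha hq) (frame_generator hg hB).
exists Q; split => //.
have [h1 _] := has_block_transport (generator_perm hg) hmap ha hc (label_rep ha hq) uB hQ.
have [/allP hf _] := andP hmap.
by move: h1; rewrite -(eqP (hf _ hq)) qb lb.
Qed.

Lemma tangent_class B Q : frame Gamma B -> tangent Q ->
  exists2 a, a \in classes150 & class_conics B a Q.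
Proof.
move=> hB tQ; have [a [b [ha hb hQ]]] := tangent_good hB tQ.
by exists a => //; split => //; exists b.
Qed.

(** * Common secants of two conics *)

Lemma mem_pairs (r : seq N) p q :
  ((p, q) \in pairs r) = [&& (index p r < index q r)%N, p \in r & q \in r].
Proof.
rewrite mem_filter /=; congr (_ && _); apply/allpairsP/andP => [[[x y] /= [hx hy [-> ->]]]|[hp hq]] //.
by exists (p, q).
Qed.

Lemma secant_exists B p q : B \in unitmx -> p \in points126 -> q \in points126 -> p != q ->
  exists L : pcurve k 1, {in points126, forall r,
    points L (at_point B r) <-> fzero (det3 (vpt p) (vpt q) (vpt r))}.
Proof.
move=> uB hp hq pq.
have v0 : crossr (vrow_of p *m B) (vrow_of q *m B) != 0.
  apply/eqP => /(crossr_eq0 (at_row_neq0 uB hq)) [c e].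
  move/eqP: pq; apply; apply: (at_point_inj uB hp hq).
  exact: pt_eq (at_row_neq0 uB hp) e.
have [L hL] := line_exists v0; exists L => r hr.
rewrite (hL _ (at_row_neq0 uB hr)).
pose D (a b c : 'rV[k]_3) : 'M[k]_3 := \matrix_(i, j) nth 0 [:: a 0 j; b 0 j; c 0 j] i.
have DE (a b c : 'rV[k]_3) : \sum_i crossr a b 0 i * c 0 i = \det (D a b c).
  by rewrite det3E sum3E !mxE /=; ring.
have DB (a b c : 'rV[k]_3) : D (a *m B) (b *m B) (c *m B) = D a b c *m B.
  by apply/matrixP => i j; rewrite !mxE; move: i; apply: ord3_ind => /=;
    apply: eq_bigr => l _; rewrite mxE.
rewrite DE DB det_mulmx -iota25_eq0 iota25_det.
have -> : \matrix_(i, j) irow (nth (vpt r) [:: vpt p; vpt q; vpt r] i) 0 j =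
    D (vrow_of p) (vrow_of q) (vrow_of r).
  by apply/matrixP => i j; rewrite !mxE; move: i; apply: ord3_ind.
have dB : \det B != 0 by rewrite -unitfE -unitmxE.
split=> [/eqP|/eqP ->]; last by rewrite mul0r.
by rewrite mulf_eq0 (negbTE dB) orbF.
Qed.

Lemma joins_at B (A : seq N) (L : pcurve k 1) : B \in unitmx -> {subset A <= points126} ->
  joins (at_point B @` [set` A]) L <->
  exists p q, [/\ p \in A, q \in A, p != q, points L (at_point B p) & points L (at_point B q)].
Proof.
move=> uB sA; split => [[P [P' [PP' [p /= hp pP] [q /= hq qP'] LP LP']]]|].
  exists p, q; rewrite pP qP'; split => //.
  by apply/eqP => pq; apply: PP'; rewrite -pP -qP' pq.
move=> [p [q [hp hq pq Lp Lq]]]; exists (at_point B p), (at_point B q); split => //.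
by move/(at_point_inj uB (sA _ hp) (sA _ hq)) => e; move: pq; rewrite e eqxx.
Qed.

Lemma block_sub a b : {subset block a b <= points126}.
Proof. by move=> p; rewrite mem_filter => /andP []. Qed.

Lemma count_ge2P (T : eqType) (P : pred T) (r : seq T) : uniq r ->
  (2 <= count P r)%N <-> exists x y, [/\ x \in r, y \in r, P x, P y & x != y].
Proof.
move=> ur; split.
  rewrite -size_filter; case E : (filter P r) => [|x [|y l]] // _.
  have hx : x \in filter P r by rewrite E mem_head.
  have hy : y \in filter P r by rewrite E !inE eqxx orbT.
  have := filter_uniq P ur; rewrite E /= inE negb_or => /andP [/andP [xy _] _].
  by exists x, y; move: hx hy; rewrite !mem_filter => /andP [? ?] /andP [? ?].
move=> [x [y [hx hy Px Py xy]]]; rewrite -size_filter.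
have /uniq_leq_size : uniq [:: x; y] by rewrite /= inE xy.
apply=> z; rewrite !inE => /orP [] /eqP ->; by rewrite mem_filter ?Px ?Py.
Qed.

(** The secants of the base conic correspond to the entries of [base_lines]; such a line is also a
    secant of [Q'] when two of its rational points lie in the block of [Q']. *)
Lemma secants_common B Q Q' a b : frame Gamma B ->
  tangent_conics Gamma Q -> tangent_conics Gamma Q' ->
  has_block B Q pt1 base_block -> has_block B Q' a b ->
  (forall n, has_card (secants Gamma Q `&` secants Gamma Q') n <-> common_secants a b = n).
Proof.
move=> hB tQ tQ' hQ hQ' n; have [uB _] := hB.
have secE Q0 a0 b0 : tangent_conics Gamma Q0 -> has_block B Q0 a0 b0 ->
    secants Gamma Q0 = [set L | joins (at_point B @` [set` block a0 b0]) L].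
  move=> tQ0 hQ0; have [K [hK hQK]] := tangent_conic_param char5 hB tQ0.
  rewrite (secants_frame char5 hQK (frame_unitary char5 (oner_neq0 _) hK hB)).
  by rewrite (tangent_meet hB tQ0 hQ0).
rewrite (secE _ _ _ tQ hQ) (secE _ _ _ tQ' hQ') -base_pointsE.
have [ubl /allP hbl] := andP base_lines_uniq.
have hpairs l : l \in base_lines -> [/\ l.1.1 \in base_points, l.1.2 \in base_points &
    (index l.1.1 base_points < index l.1.2 base_points)%N].
  move=> hl; have : l.1 \in pairs base_points by rewrite -base_lines_pairs map_f.
  by case: (l.1) => x y; rewrite mem_pairs => /and3P [].
have bp_sub : {subset base_points <= points126} by rewrite base_pointsE; apply: block_sub.
have line_ex l : exists L : pcurve k 1, l \in base_lines -> {in points126, forall r,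
    points L (at_point B r) <-> r \in l.2}.
  (* [choice] asks for a line at every index, so an arbitrary one serves outside [base_lines]. *)
  have [hl|hl] := boolP (l \in base_lines); last first.
    have v0 : crossr (delta_mx 0 i0) (delta_mx 0 i1) != 0 :> 'rV[k]_3.
      apply/eqP => /rowP /(_ i2); rewrite !mxE /= => /eqP.
      by rewrite mulr1 mulr0 subr0 oner_eq0.
    by have [L _] := line_exists v0; exists L.
  have [h1 h2 lt12] := hpairs _ hl.
  have l12 : l.1.1 != l.1.2 by apply/eqP => e; move: lt12; rewrite e ltnn.
  have [L hL] := secant_exists uB (bp_sub _ h1) (bp_sub _ h2) l12.
  exists L => _ r hr; rewrite (hL _ hr).
  by rewrite (eqP (allP (allP base_lines_check _ hl) _ hr)).
have [f hf] := choice line_ex.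
have on_line l l' : l \in base_lines -> l' \in base_lines ->
    points (f l) (at_point B l'.1.1) -> points (f l) (at_point B l'.1.2) -> l = l'.
  move=> hl hl'; have [h1 h2 _] := hpairs _ hl'.
  rewrite !(hf _ hl) ?bp_sub // => m1 m2.
  by have /implyP := allP (allP base_lines_meet _ hl) _ hl'; rewrite m1 m2 => /(_ isT) /eqP.
have self_line l : l \in base_lines ->
    points (f l) (at_point B l.1.1) /\ points (f l) (at_point B l.1.2).
  move=> hl; have [h1 h2 lt12] := hpairs _ hl.
  have z1 : fzero (det3 (vpt l.1.1) (vpt l.1.2) (vpt l.1.1)).
    by rewrite -iota25_eq0 iota25_det det3E !mxE /=; apply/eqP; ring.
  have z2 : fzero (det3 (vpt l.1.1) (vpt l.1.2) (vpt l.1.2)).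
    by rewrite -iota25_eq0 iota25_det det3E !mxE /=; apply/eqP; ring.
  split; apply/(hf _ hl); rewrite ?bp_sub //.
    by rewrite -(eqP (allP (allP base_lines_check _ hl) _ (bp_sub _ h1))).
  by rewrite -(eqP (allP (allP base_lines_check _ hl) _ (bp_sub _ h2))).
have f_inj : {in base_lines &, injective f}.
  move=> l l' hl hl' e; apply: on_line => //; have [h1 h2] := self_line _ hl'; by rewrite e.
have joinsE : [set L | joins (at_point B @` [set` base_points]) L] = f @` [set` base_lines].
  apply/seteqP; split => L /=.
    move/(joins_at _ uB bp_sub) => [p [q [hp hq pq Lp Lq]]].
    have [l hl e] : exists2 l, l \in base_lines & l.1 = (p, q) \/ l.1 = (q, p).
      have : ((p, q) \in pairs base_points) || ((q, p) \in pairs base_points).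
        rewrite !mem_pairs hp hq !andbT -neq_ltn.
        by apply: contra_neq pq => /(congr1 (nth N0 base_points)); rewrite !nth_index.
      rewrite -!base_lines_pairs => /orP [] /mapP [l hl e]; exists l => //.
        by left.
      by right.
    exists l => //; have [h1 h2] := self_line _ hl.
    have pq' : at_point B p <> at_point B q.
      by move/(at_point_inj uB (bp_sub _ hp) (bp_sub _ hq)) => e'; move: pq; rewrite e' eqxx.
    by case: e => e; rewrite e /= in h1 h2; apply: line_unique pq' _ _ _ _.
  move=> [l hl <-]; apply/(joins_at _ uB bp_sub); have [h1 h2 lt12] := hpairs _ hl.
  have [L1 L2] := self_line _ hl.
  exists l.1.1, l.1.2; split => //; apply/eqP => e; move: lt12; by rewrite e ltnn.
rewrite joinsE; apply: has_card_count => // l hl.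
have /andP [ul /allP sl] := hbl _ hl.
have sl' : {subset l.2 <= points126} by move=> r /sl.
split.
  move=> /(joins_at _ uB (@block_sub a b)) [p [q [hp hq pq Lp Lq]]].
  apply/(count_ge2P _ ul); exists p, q.
  move: hp hq; rewrite !mem_filter => /andP [lp hp] /andP [lq hq].
  by split => //; apply/(hf _ hl).
move=> /(count_ge2P _ ul) [p [q [hp hq lp lq pq]]].
apply/(joins_at _ uB (@block_sub a b)); exists p, q.
rewrite !mem_filter lp lq !sl' //; split => //; apply/(hf _ hl) => //; exact: sl'.
Qed.

Lemma component_eq (T : Type) (G : graph T) (x : T) (S : set T) :
  S x -> S `<=` vertices G ->
  (forall y z, S y -> vertices G z -> adj G y z \/ adj G z y -> S z) ->
  (forall y, S y -> clos_refl_sym_trans T (induced_adj G) x y) ->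
  component G x = S.
Proof.
move=> Sx SG closedS connS; apply/seteqP; split => [y [_ hxy]|y Sy]; last first.
  by split; [apply: SG | apply: connS].
suff h a b : clos_refl_sym_trans T (induced_adj G) a b -> S a <-> S b by apply/(h _ _ hxy).
elim=> {a b} [a b [va vb ab]|//|a b _ [h1 h2]|a b c _ h1 _ h2]; last 2 first.
- by split.
- by split=> [/h1 /h2|/h2 /h1].
by split=> h; apply: (closedS _ _ h) => //; [left|right].
Qed.

(** * Common points of two conics *)

Definition binary (x y : k) : 'rV[k]_3 := \row_j nth 0 [:: x ^+ 2; x * y; y ^+ 2] j.

Lemma quad_binary_mul M x y : quad (binary x y *m imx M) =
  let c i := iota25 (nth f0 (quartic M) i) in
  c 0%N * x ^+ 4 + c 1%N * (x ^+ 3 * y) + c 2%N * (x ^+ 2 * y ^+ 2)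
  + c 3%N * (x * y ^+ 3) + c 4%N * y ^+ 4.
Proof.
case: M => [[r0 r1] r2]; rewrite /quad !mul_row3E !mxE /= /quadc.
have i2E : iota25 (2, 0)%N = 2%:R by rewrite /iota25 /= mul0r addr0.
by rewrite !(iota25D, iota25B, iota25M) i2E; ring.
Qed.

Lemma quad_binary_roots e x y : quartic_check e ->
  quad (binary x y *m imx (adjmat e.1)) =
  iota25 e.2.1 * \prod_(r <- e.2.2) (iota25 r.2 * x - iota25 r.1 * y).
Proof.
case: e => M [c rs] /and4P [/= srs _ _]; rewrite quad_binary_mul /=.
case: rs srs => [|r1 [|r2 [|r3 [|r4 [|]]]]] //= _.
case: (adjmat M) => [[a0 a1] a2] /=.
rewrite andbT -!iota25_eq => /and5P [/eqP -> /eqP -> /eqP -> /eqP -> /eqP ->].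
rewrite !big_cons big_nil !(iota25D, iota25N, iota25M) !iota25_0.
by ring.
Qed.

(** A point of [Q] is the image of some (x^2, x y, y^2), and it lies on [Q'] when the quartic
    vanishes there, that is when (x : y) is one of the listed roots. *)
Lemma meet_quartic B e Q Q' : B \in unitmx -> unitaryc e.1 -> quartic_check e ->
  param_by Q B -> param_by Q' (imx e.1 *m B) ->
  points Q `&` points Q' =
  (fun r => pt (binary (iota25 r.1) (iota25 r.2) *m B)) @` [set` e.2.2].
Proof.
move=> uB hu he hQ hQ'; have /and4P [_ c0 /allP rs0 _] := he.
have hM : unitary 1 (imx e.1) by apply/unitarycP.
have uM := unitary_unitmx h5 (oner_neq0 _) hM; have [uMB _] := hQ'.
have d0 : \det (imx e.1) != 0 by rewrite -unitfE -unitmxE.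
have bin0 x y : (x != 0) || (y != 0) -> binary x y != 0.
  move=> xy; apply/eqP => /rowP b0; have := b0 i0; have := b0 i2; rewrite !mxE /=.
  move=> /eqP; rewrite expf_eq0 /= => /eqP y0 /eqP; rewrite expf_eq0 /= => /eqP x0.
  by move: xy; rewrite x0 y0 eqxx.
have on_Q' x y : binary x y != 0 -> points Q' (pt (binary x y *m B)) <->
    exists2 r, r \in e.2.2 & iota25 r.2 * x = iota25 r.1 * y.
  move=> xy0; rewrite (param_by_points hQ'); last by rewrite mul_unitmx_neq0.
  have -> : binary x y *m B *m invmx (imx e.1 *m B) =
     (\det (imx e.1))^-1 *: (binary x y *m imx (adjmat e.1)).
    rewrite -[RHS](mulmxK uMB); congr (_ *m _).
    rewrite -scalemxAl mulmxA -[X in _ = _ *: (X *m B)]mulmxA.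
    have -> : imx (adjmat e.1) *m imx e.1 = (\det (imx e.1))%:M.
      rewrite -[LHS](mulKmx uM) [imx e.1 *m (_ *m _)]mulmxA imx_adj mul_scalar_mx -scalemxAr.
      by rewrite mulVmx // scalemx1.
    by rewrite mul_mx_scalar -scalemxAl scalerA mulVf // scale1r.
  rewrite quadZ (quad_binary_roots _ _ he).
  have ic0 : iota25 e.2.1 != 0 by rewrite iota25_eq0.
  split.
    move=> /eqP; rewrite mulf_eq0 expf_eq0 invr_eq0 (negbTE d0) mulf_eq0 (negbTE ic0) /=.
    rewrite prodf_seq_eq0 => /hasP [r hr].
    by rewrite subr_eq0 => /eqP; exists r.
  move=> [r hr rE]; rewrite (_ : \prod_(r <- _) _ = 0) ?mulr0 //.
  by apply/eqP; rewrite prodf_seq_eq0; apply/hasP; exists r => //; rewrite rE subrr eqxx.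
apply/seteqP; split => P.
  rewrite -(pt_rep P) => -[].
  rewrite (param_by_points hQ (rep_neq0 P)) => hq.
  set x := rep P *m invmx B in hq.
  have xE : rep P = x *m B by rewrite mulmxKV.
  have x0 : x != 0 by rewrite mul_unitmx_neq0 ?unitmx_inv ?rep_neq0.
  have [a [b [c [xy0 c0' hx]]]] : exists a b c, [/\ binary a b != 0, c != 0 & x = c *: binary a b].
    have [[c [t [c0' ->]]]|[c c0' ->]] := quad_eq0 x0 hq.
      exists 1, t, c; split => //; first by rewrite bin0 ?oner_neq0.
      by congr (_ *: _); apply: row3P; rewrite !mxE /=; ring.
    exists 0, 1, c; split => //; first by rewrite bin0 ?oner_neq0 ?orbT.
    by congr (_ *: _); apply: row3P; rewrite !mxE /=; ring.
  have PE : pt (rep P) = pt (binary a b *m B).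
    by apply: (@pt_eq _ _ _ c); rewrite ?rep_neq0 // xE hx scalemxAl.
  rewrite PE => /(on_Q' _ _ xy0) [r hr rE]; exists r => //.
  have r0 : binary (iota25 r.1) (iota25 r.2) != 0.
    by apply: bin0; rewrite !iota25_eq0 -negb_and; apply: rs0.
  have [w [w0 aE bE]] : exists w, [/\ w != 0, a = w * iota25 r.1 & b = w * iota25 r.2].
    have := rs0 _ hr; rewrite negb_and -!iota25_eq0.
    move: (iota25 r.1) (iota25 r.2) rE => u v rE.
    have ab0 : (a != 0) || (b != 0).
      rewrite -negb_and; apply: contra xy0 => /andP [/eqP -> /eqP ->].
      by apply/eqP; apply: row3P; rewrite !mxE /=; ring.
    have [u0 /= v0|u0 _] := eqVneq u 0.
      have a0 : a = 0.
        by apply: (mulfI v0); rewrite rE u0 mul0r mulr0.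
      rewrite a0 eqxx /= in ab0; exists (b / v); split.
      - by rewrite mulf_neq0 ?invr_eq0.
      - by rewrite u0 a0 mulr0.
      - by rewrite divfK.
    have bE : b = a / u * v by rewrite mulrAC [a * v]mulrC rE mulrAC divff ?mul1r.
    exists (a / u); split => //; last by rewrite divfK.
    rewrite mulf_neq0 ?invr_eq0 //; apply/eqP => a0.
    by move: ab0; rewrite bE a0 !mul0r eqxx.
  (* The vector [binary a b] is quadratic in (a, b), hence the square. *)
  apply: (@pt_eq _ _ _ (w ^- 2)); first by rewrite mul_unitmx_neq0.
  rewrite scalemxAl; congr (_ *m B); rewrite aE bE; apply: row3P; rewrite !mxE /=; field; exact: w0.
move=> [r /= hr <-]; have r0 : binary (iota25 r.1) (iota25 r.2) != 0.
  by apply: bin0; rewrite !iota25_eq0 -negb_and; apply: rs0.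
split; last by apply/(on_Q' _ _ r0); exists r => //; rewrite mulrC.
apply/(param_by_points hQ); first by rewrite mul_unitmx_neq0.
by rewrite mulmxK // /quad !mxE /=; ring.
Qed.

Lemma binary_proportional x y x' y' c : (x != 0) || (y != 0) ->
  binary x y = c *: binary x' y' -> x * y' = y * x'.
Proof.
move=> xy /rowP e; have := e i0; have := e i1; have := e i2; rewrite !mxE /= => e2 e1 e0.
have hx : x * (x * y' - y * x') = 0.
  transitivity (x ^+ 2 * y' - x * y * x'); first by ring.
  by rewrite e0 e1; ring.
have hy : y * (x * y' - y * x') = 0.
  transitivity (x * y * y' - y ^+ 2 * x'); first by ring.
  by rewrite e1 e2; ring.
apply/eqP; rewrite -subr_eq0; case/orP: xy => [x0|y0]; apply/eqP.
  by apply: (mulfI x0); rewrite hx mulr0.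
by apply: (mulfI y0); rewrite hy mulr0.
Qed.

Lemma neighbor_meet B e Q Q' : B \in unitmx -> unitaryc e.1 -> e \in neighbor_quartics ->
  param_by Q B -> param_by Q' (imx e.1 *m B) -> has_card (points Q `&` points Q') 4.
Proof.
move=> uB hu /(allP neighbor_quartics_check) /andP [he /andP [urs /allP hrs]] hQ hQ'.
have /and4P [/eqP srs _ /allP rs0 _] := he.
rewrite (meet_quartic uB hu he hQ hQ').
rewrite (_ : 4%N = size e.2.2); last by rewrite srs.
apply: has_card_image => // r r' hr hr'.
have nz r1 : r1 \in e.2.2 -> (iota25 r1.1 != 0) || (iota25 r1.2 != 0).
  by move=> h1; rewrite !iota25_eq0 -negb_and; apply: rs0.
have bin0 r1 : r1 \in e.2.2 -> binary (iota25 r1.1) (iota25 r1.2) *m B != 0.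
  move=> h1; rewrite mul_unitmx_neq0 //; apply/eqP => /rowP b0.
  have := b0 i0; have := b0 i2; rewrite !mxE /=.
  move=> /eqP; rewrite expf_eq0 /= => /eqP y0 /eqP; rewrite expf_eq0 /= => /eqP x0.
  by move: (nz _ h1); rewrite x0 y0 eqxx.
move=> /pt_eqP [] //; rewrite ?bin0 // => c c0.
rewrite scalemxAl => /(can_inj (mulmxK uB)) /(binary_proportional (nz _ hr)) e0.
have /orP [/eqP //|] := allP (hrs _ hr) _ hr'.
by rewrite -iota25_eq0 iota25B // !iota25M // e0 subrr eqxx.
Qed.

(** The last two of the four roots repeat the first two, so there are at most two common points. *)
Lemma bitangent_meet B e Q Q' : B \in unitmx -> unitaryc e.1 -> e \in bitangent_quartics ->
  param_by Q B -> param_by Q' (imx e.1 *m B) -> ~ has_card (points Q `&` points Q') 4.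
Proof.
move=> uB hu /(allP bitangent_quartics_check) /andP [he /eqP hrs] hQ hQ'.
have /and4P [/eqP srs _ _ _] := he.
rewrite (meet_quartic uB hu he hQ hQ') => /has_card_seq [t [ut st tE]].
set f := (fun r => pt _) in tE.
have : {subset t <= map f (take 2 e.2.2)}.
  move=> P hP; have : [set` t] P by [].
  rewrite -tE => -[r /= hr <-]; apply: map_f.
  by rewrite -(cat_take_drop 2%N e.2.2) -hrs mem_cat orbb in hr.
move=> /(uniq_leq_size ut); rewrite size_map size_take srs st.
by [].
Qed.

(** * Neighbours of a conic and the components of G *)

Lemma base_has_block B Q : frame Gamma B -> param_by Q B ->
  tangent Q /\ has_block B Q pt1 base_block.
Proof.
move=> hB hQ; have [Q' [hQ' tQ' bQ']] := matrix_class_conic base_block_check hB.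
rewrite /= imx1 mul1mx in hQ'.
by rewrite (param_by_unique hQ hQ').
Qed.

Lemma same_block_conic B e Q : frame Gamma B -> matrix_class_check e -> tangent Q ->
  has_block B Q e.2.1 e.2.2 -> param_by Q (imx e.1 *m B).
Proof.
move=> hB he tQ hQ; have [Q' [hQ' tQ' bQ']] := matrix_class_conic he hB.
by rewrite (has_block_unique hB tQ tQ' hQ bQ').
Qed.

(** Three common secants leave only the tabulated neighbours and the conics whose quartic has
    repeated roots; the latter fail the condition of four common points. *)
Lemma adj_base B Q Q' : frame Gamma B -> param_by Q B -> tangent Q' ->
  adj (graphG Gamma) Q Q' <->
  exists2 e, e \in neighbor_classes & has_block B Q' e.2.1 e.2.2.
Proof.
move=> hB hQ tQ'; have [uB _] := hB; have [tQ bQ] := base_has_block hB hQ; split.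
  move=> [_ c4 c3]; have [a [b [ha hb bQ']]] := tangent_good hB tQ'.
  have /(secants_common hB tQ tQ' bQ bQ') c3' := c3.
  have /implyP := allP (allP common_secants_check _ ha) _ hb.
  rewrite c3' => /(_ isT) /hasP [e]; rewrite mem_cat => /orP [he|he] /eqP eab.
    by exists e => //; rewrite eab.
  have hc := allP bitangent_classes_check _ he.
  have hQ' : param_by Q' (imx e.1 *m B) by apply: same_block_conic => //; rewrite eab.
  have : e.1 \in map fst bitangent_quartics by rewrite -bitangent_quartics_matrices map_f.
  case/mapP => e' he' ee'; rewrite ee' in hQ' hc *.
  have hu : unitaryc e'.1 by rewrite -ee'; case/and4P: (allP bitangent_classes_check _ he).
  by case: (bitangent_meet uB hu he' hQ hQ').
move=> [e he bQ']; have hc := allP neighbor_classes_check _ he.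
have hQ' := same_block_conic hB hc tQ' bQ'.
have hsec n := secants_common hB tQ tQ' bQ bQ' n.
split.
- move=> QQ'; rewrite -QQ' in hsec.
  have := secants_common hB tQ tQ bQ bQ 3; rewrite hsec => h.
  by have := base_common_secants; rewrite (h.1 (eqP (allP neighbor_common_secants _ he))) eqxx.
- have : e.1 \in map fst neighbor_quartics by rewrite -neighbor_quartics_matrices map_f.
  case/mapP => e' he' ee'; have /and4P [hu _ _ _] := hc.
  by rewrite ee' in hu hQ'; exact: neighbor_meet hu he' hQ hQ'.
by apply/hsec/eqP/(allP neighbor_common_secants _ he).
Qed.

Lemma adj_graphG_sym Q Q' : adj (graphG Gamma) Q Q' -> adj (graphG Gamma) Q' Q.
Proof. by move=> [h1 h2 h3]; split; rewrite 1?[_ `&` _]setIC //; exact: nesym. Qed.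

Lemma first_class_conic B Q b : frame Gamma B -> tangent Q -> b \in representatives pt1 ->
  has_block B Q pt1 b -> exists2 e, e \in first_class &
  [/\ e.2.1 = b, unitaryc e.1 & param_by Q (imx e.1 *m B)].
Proof.
move=> hB tQ hb hQ; have [e he eb] := first_class_mem hb.
have /and3P [hM _ _] := allP first_class_check _ he.
exists e => //; split => //; first by case/and4P: hM.
by apply: (same_block_conic hB hM tQ); rewrite /= eb.
Qed.

Lemma neighbor_rep e : e \in neighbor_classes -> e.2.1 = pt1 /\ e.2.2 \in representatives pt1.
Proof.
move=> he; have /eqP e1 := allP neighbor_first_class _ he.
by have /and4P [_ _] := allP neighbor_classes_check _ he; rewrite e1.
Qed.

Lemma first_class_stepP x y : y \in first_class_step x -> exists e c,
  [/\ e \in first_class, e.2.1 = x, c \in neighbor_classes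
    & y = label pt1 (perm_of e.2.2 c.2.2)].
Proof.
rewrite /first_class_step; move: first_class neighbor_classes => es cs.
case/flattenP => _ /mapP [e he ->] /mapP [c hc ->].
by move: he; rewrite mem_filter => /andP [/eqP ex he]; exists e, c.
Qed.

(** Each conic of the first class is the base conic of another frame, where [adj_base] applies; this
    yields closure under adjacency. A search through blocks links all of them to the base block. *)
Lemma component_base B Q : frame Gamma B -> param_by Q B ->
  component (graphG Gamma) Q = class_conics B pt1.
Proof.
move=> hB hQ; have [tQ bQ] := base_has_block hB hQ; have [uB _] := hB.
have hpt1 : pt1 \in classes150 by [].
have base_rep : base_block \in representatives pt1 by case/and4P: base_block_check.
apply: component_eq => [|Q' []//|Q1 Q2 [tQ1 [b hb bQ1]] tQ2 h12|Q' [tQ' [b hb bQ']]].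
- by split => //; exists base_block.
- have [e he [_ hu hQ1]] := first_class_conic hB tQ1 hb bQ1.
  have h12' : adj (graphG Gamma) Q1 Q2 by case: h12 => // /adj_graphG_sym.
  have hB' := frame_imx hu hB.
  have /(adj_base hB' hQ1 tQ2) [c hc bQ2] := h12'.
  have [c1 c2] := neighbor_rep hc; rewrite c1 in bQ2.
  have /and3P [_ hp hm] := allP first_class_check _ he.
  apply: (class_conics_sub hp hm hpt1 hpt1 uB).
  by split => //; exists c.2.2.
move: tQ' bQ'; have := allP first_class_connected _ hb; move: b hb Q' => b _ Q'.
pose A b := b \in representatives pt1 /\ forall Q', tangent Q' -> has_block B Q' pt1 b ->
  clos_refl_sym_trans _ (induced_adj (graphG Gamma)) Q Q'.
suff hA : {in reach 5 first_class_step [:: base_block] [:: base_block], forall b, A b}.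
  by move=> /hA [_]; apply.
have A0 : A base_block.
  split => // Q1 tQ1 bQ1; rewrite (has_block_unique hB tQ1 tQ bQ1 bQ).
  exact: rst_refl.
apply: reach_ind => [x|x|x y [hx IH]]; [by rewrite inE => /eqP -> | by rewrite inE => /eqP -> |].
move=> /first_class_stepP [e [c [he ex hc ->]]].
have /and3P [hM hp hm] := allP first_class_check _ he.
have [c1 c2] := neighbor_rep hc.
have [Q1 [hQ1 tQ1 bQ1]] := matrix_class_conic hM hB.
have hu : unitaryc e.1 by case/and4P: hM.
have hB' := frame_imx hu hB.
have [Q2 [hQ2 tQ2 bQ2]] := matrix_class_conic (allP neighbor_classes_check _ hc) hB'.
have bQ2' : has_block (imx e.1 *m B) Q2 pt1 c.2.2 by rewrite -c1.
have [bB hr] := has_block_transport hp hm hpt1 hpt1 c2 uB bQ2'.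
split => // Q3 tQ3 bQ3.
rewrite (has_block_unique hB tQ3 tQ2 bQ3 bB).
apply: (rst_trans _ _ _ Q1); first by apply: IH => //; rewrite -ex.
by apply: rst_step; split => //; apply/(adj_base hB' hQ1 tQ2); exists c.
Qed.

(** In every frame the first class is a component, and changing the frame by a generator permutes
    the classes, so each class is a component. Every totally tangent conic lies in some class, so
    there are no others. *)
Lemma calD_classes B : frame Gamma B ->
  calD Gamma = class_conics B @` [set` classes150].
Proof.
move=> hB.
have inD : {in classes150, forall a, forall B, frame Gamma B -> exists2 Q,
    tangent Q & class_conics B a = component (graphG Gamma) Q}.
  apply: classes_ind => [B' hB'|a g ha hg IH B' hB'].
    have [uB' _] := hB'; have [Q hQ] := param_by_exists uB'.
    have [tQ _] := base_has_block hB' hQ.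
    by exists Q => //; rewrite (component_base hB' hQ).
  have [Q tQ hQ] := IH _ (frame_generator hg hB').
  by exists Q => //; rewrite -hQ (class_conics_generator hg ha hB').
apply/seteqP; split => D.
  move=> [Q tQ ->]; have [a ha Qa] := tangent_class hB tQ.
  exists a => //; have [Q' tQ' aE] := inD _ ha _ hB.
  rewrite aE in Qa *; case: Qa => _ hQ'Q; apply/seteqP; split => Q1 [tQ1 h1]; split => //.
    exact: rst_trans (rst_sym _ _ _ _ hQ'Q) h1.
  exact: rst_trans hQ'Q h1.
move=> [a ha <-]; have [Q tQ ->] := inD _ ha _ hB.
by exists Q.
Qed.

Lemma generator_classV g a : (g < 5)%N -> a \in classes150 ->
  exists2 b, b \in classes150 & a = class_at g b.
Proof.
move=> hg ha; have hg' := inverse_generator_lt hg.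
have [hc _ e] := class_perm_check hg' ha.
exists (class_at (inverse_generator g) a) => //.
have gE : inverse_generator (inverse_generator g) = g by move: g hg {hg' hc e}; do 5?case.
by rewrite -{1}gE e.
Qed.

(** If the classes agree, the base conic belongs to class [a] and its block has a single label
    there; the table excludes this for all other [a]. *)
Lemma first_class_eq B a : frame Gamma B -> a \in classes150 ->
  class_conics B pt1 = class_conics B a -> a = pt1.
Proof.
move=> hB ha e; have /orP [/eqP //|/allP h] := allP first_class_distinct _ ha.
have hb : base_block \in representatives pt1 by case/and4P: base_block_check.
have hpt1 : pt1 \in classes150 by [].
have [Q [tQ bQ]] := block_exists hpt1 hb hB.
have : class_conics B pt1 Q by split => //; exists base_block.
rewrite e => -[_ [c hc cQ]].
have hbl : block pt1 base_block \in first_blocks by rewrite first_blocksE; exact: (map_f (block pt1) hb).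
have [hp lp] := rep_label hb.
have b0 : base_block \in block pt1 base_block by rewrite mem_filter lp eqxx.
have lc p : p \in block pt1 base_block -> label a p = c.
  by rewrite mem_filter => /andP [/eqP l1 h1]; apply/(cQ _ h1)/(bQ _ h1).
case/negP: (h _ hbl); apply/allP => p /lc ->.
rewrite (lc (head N0 _)) //; move: b0; case: (block pt1 base_block) => //= x l _.
Qed.

Lemma class_conics_inj B : frame Gamma B -> {in classes150 &, injective (class_conics B)}.
Proof.
move=> hB a b ha; move: a ha B hB b.
apply: (@classes_ind (fun a => forall B, frame Gamma B -> forall b, b \in classes150 ->
  class_conics B a = class_conics B b -> a = b)) => [B hB b hb e|a g ha hg IH B hB b hb].
  by rewrite (first_class_eq hB hb e).
have [b' hb' ->] := generator_classV hg hb.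
rewrite -!(class_conics_generator hg) // => e.
by rewrite (IH _ (frame_generator hg hB) _ hb' e).
Qed.

Lemma class_conicsE B a : frame Gamma B -> a \in classes150 ->
  exists f : N -> pcurve k 2,
   [/\ class_conics B a = f @` [set` representatives a], {in representatives a &, injective f}
     & {in representatives a, forall b, tangent (f b) /\ has_block B (f b) a b}].
Proof.
move=> hB ha.
have hpt1 : pt1 \in classes150 by [].
have hb1 : base_block \in representatives pt1 by case/and4P: base_block_check.
have [Q0 _] := block_exists hpt1 hb1 hB.
have ex b : exists Q, b \in representatives a -> tangent Q /\ has_block B Q a b.
  have [hb|hb] := boolP (b \in representatives a); last by exists Q0.
  by have [Q hQ] := block_exists ha hb hB; exists Q.
have [f hf] := choice ex; exists f; split => //.
  apply/seteqP; split => [Q [tQ [b hb bQ]]|_ [b hb <-]].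
    exists b => //; have [tf bf] := hf _ hb.
    exact: (has_block_unique hB tf tQ bf bQ).
  by have [tf bf] := hf _ hb; split => //; exists b.
move=> b c hb hc e; have [_ bf] := hf _ hb; have [_ cf] := hf _ hc.
have [hp lp] := rep_label hb; rewrite e in bf.
by rewrite -lp; apply/(cf _ hp)/(bf _ hp).
Qed.

(** * Types of pairs of components *)

Lemma meet_count_block B Q c b a m n : frame Gamma B -> tangent Q -> has_block B Q c b ->
  a \in classes150 ->
  meet_count Gamma Q (class_conics B a) m n <->
  meet_number (representatives a) (map (label a) (block c b)) m = n.
Proof.
move=> hB tQ bQ ha; have [f [-> f_inj hf]] := class_conicsE hB ha; have [uB _] := hB.
apply: has_card_count => //; first exact: filter_uniq points126_uniq.
move=> r hr; have [tr br] := hf _ hr.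
rewrite count_map.
have -> : points Q `&` points (f r) `&` points Gamma =
    [set P | (at_point B @` [set` block c b]) P /\ points (f r) P].
  rewrite -(tangent_meet hB tQ bQ).
  by apply/seteqP; split => P /= => [[[]]|[[]]].
rewrite (@has_card_count _ _ _ _ _ (preim (label a) (pred1 r))).
- by split => /eqP.
- exact: filter_uniq points126_uniq.
- by move=> p q /block_sub hp /block_sub hq; exact: at_point_inj.
by move=> p /block_sub hp; rewrite (br _ hp); split => /eqP.
Qed.

Lemma t_is_alpha B Q c b a : frame Gamma B -> tangent Q -> has_block B Q c b ->
  a \in classes150 -> t_is Gamma Q (class_conics B a) Alpha <->
  is_alpha (representatives a) (map (label a) (block c b)).
Proof.
move=> hB tQ bQ ha; rewrite /= !(meet_count_block _ _ hB tQ bQ ha).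
by split => [[/eqP ? /eqP ?]|/andP [/eqP ? /eqP ?] //]; apply/andP.
Qed.

Lemma t_is_gamma B Q c b a : frame Gamma B -> tangent Q -> has_block B Q c b ->
  a \in classes150 -> t_is Gamma Q (class_conics B a) Gam <->
  is_gamma (representatives a) (map (label a) (block c b)).
Proof.
move=> hB tQ bQ ha; rewrite /= !(meet_count_block _ _ hB tQ bQ ha).
by split => [[/eqP ? /eqP ?]|/andP [/eqP ? /eqP ?] //]; apply/andP.
Qed.

Lemma code15 (x y : nat) :
  (if (x == 15) && (y == 6) then 1 else if (x == 3) && (y == 18) then 2 else 0)%N = 1%N <->
  (x = 15 /\ y = 6)%N.
Proof.
split=> [|[-> ->] //]; case: ifP => [/andP [/eqP -> /eqP ->] //|_]; by case: ifP.
Qed.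

Lemma code3 (x y : nat) :
  (if (x == 15) && (y == 6) then 1 else if (x == 3) && (y == 18) then 2 else 0)%N = 2%N <->
  (x = 3 /\ y = 18)%N.
Proof.
by split=> [|[-> ->] //]; case: ifP => // _; case: ifP => [/andP [/eqP -> /eqP ->] //|].
Qed.

Definition type_code (T : pair_type) : nat :=
  match T with Alpha15Gam6 => 1 | Alpha3Gam18 => 2 | _ => 3 end.

Lemma T_is_first B a T : frame Gamma B -> a \in classes150 ->
  T = Alpha15Gam6 \/ T = Alpha3Gam18 ->
  T_is Gamma (class_conics B pt1) (class_conics B a) T <-> first_type a = type_code T.
Proof.
move=> hB ha hT; have hpt1 : pt1 \in classes150 by [].
have [f [-> f_inj hf]] := class_conicsE hB hpt1.
have uf : uniq (representatives pt1) by apply: filter_uniq points126_uniq.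
have cT t (P : pred (seq N)) : (forall Q b, tangent Q -> has_block B Q pt1 b ->
      t_is Gamma Q (class_conics B a) t <-> P (map (label a) (block pt1 b))) -> forall n,
    has_card [set Q | (f @` [set` representatives pt1]) Q /\ t_is Gamma Q (class_conics B a) t] n
    <-> count P [seq map (label a) bl | bl <- first_blocks] = n.
  move=> hP n; rewrite first_blocksE 2!count_map; apply: (has_card_count _ uf f_inj) => b hb.
  by have [tb bb] := hf _ hb; exact: hP tb bb.
have cA := cT Alpha _ (fun Q b tQ bQ => t_is_alpha hB tQ bQ ha).
have cG := cT Gam _ (fun Q b tQ bQ => t_is_gamma hB tQ bQ ha).
rewrite /first_type; case: hT => ->.
  split=> [[/cA h1 /cG h2]|/code15 [h1 h2]]; first exact/code15.
  by split; [apply/cA | apply/cG].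
split=> [[/cA h1 /cG h2]|/code3 [h1 h2]]; first exact/code3.
by split; [apply/cA | apply/cG].
Qed.

(** Applying a generator to both classes changes neither side: on the left it is a change of frame,
    on the right a check of the table. This reduces to the first class. *)
Lemma T_is_code B a b T : frame Gamma B -> a \in classes150 -> b \in classes150 ->
  T = Alpha15Gam6 \/ T = Alpha3Gam18 ->
  T_is Gamma (class_conics B a) (class_conics B b) T <-> pair_type_code a b = type_code T.
Proof.
move=> hB ha hb hT; move: a ha B hB b hb.
apply: (@classes_ind (fun a => forall B, frame Gamma B -> forall b, b \in classes150 ->
  T_is Gamma (class_conics B a) (class_conics B b) T <-> pair_type_code a b = type_code T))
  => [B hB b hb|a g ha hg IH B hB b hb].
  by rewrite (T_is_first hB hb hT) (eqP (allP first_typesE _ hb)).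
have [b' hb' ->] := generator_classV hg hb.
have hgi : g \in iota 0 5 by rewrite mem_iota.
rewrite (eqP (allP (allP (allP pair_type_invariant _ hgi) _ ha) _ hb')).
rewrite -!(class_conics_generator hg) //.
exact: IH (frame_generator hg hB) _ hb'.
Qed.

(** * Strong regularity of H'' *)

Lemma component_refl (T : Type) (G : graph T) (x : T) : vertices G x -> component G x x.
Proof. by move=> vx; split => //; exact: rst_refl. Qed.

Lemma components_mem (T : Type) (G : graph T) (C : set T) (x : T) :
  components G C -> C x -> C = component G x.
Proof.
move=> [y _ ->] [vx hyx]; apply/seteqP; split => z [vz h]; split => //.
  exact: rst_trans (rst_sym _ _ _ _ hyx) h.
exact: rst_trans hyx h.
Qed.

Lemma commonE (T : Type) (f g : T -> bool) (r : seq T) :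
  common (map f r) (map g r) = count (fun x => f x && g x) r.
Proof. by elim: r => //= x r ->; case: (_ && _). Qed.

Lemma srg_transfer (I : eqType) (T : Type) (G : graph T) (f : I -> T) (r : seq I) (e : rel I)
    (d l m : nat) :
  uniq r -> {in r &, injective f} -> vertices G = f @` [set` r] ->
  {in r &, forall x y, adj G (f x) (f y) <-> e x y} ->
  {in r, forall x, ~~ e x x} -> {in r &, forall x y, e x y = e y x} ->
  {in r, forall x, count (e x) r = d} ->
  {in r &, forall x y, x != y ->
    count (fun z => e x z && e y z) r = if e x y then l else m} ->
  strongly_regular G (size r) d l m.
Proof.
move=> ur fI vG hadj irr sym deg com.
have common_card x y n : x \in r -> y \in r ->
    has_card (common_neighbors G (f x) (f y)) n <-> count (fun z => e x z && e y z) r = n.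
  move=> hx hy; rewrite /common_neighbors vG.
  have -> : [set z | [/\ (f @` [set` r]) z, adj G (f x) z & adj G (f y) z]] =
      [set z | (f @` [set` r]) z /\ (adj G (f x) z /\ adj G (f y) z)].
    by apply/seteqP; split => z [h1]; [move=> h2 h3 | move=> [h2 h3]].
  apply: has_card_count => // z hz; rewrite !hadj //.
  by split => [[-> ->]|/andP].
split; rewrite ?vG.
- by move=> _ [x hx <-] /hadj; rewrite (negbTE (irr _ hx)) => /(_ hx hx).
- by move=> _ _ [x hx <-] [y hy <-] /hadj h; apply/hadj; rewrite // sym // h.
- exact: has_card_image.
- move=> _ [x hx <-]; have hx' : {in r, forall y, adj G (f x) (f y) <-> e x y}.
    by move=> y; exact: hadj.
  by apply/(has_card_count _ ur fI hx'); exact: deg.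
- move=> _ _ [x hx <-] [y hy <-] hxy; apply/common_card => //.
  have exy : e x y by apply/hadj.
  rewrite com ?exy //; apply/eqP => xy; by move: (irr _ hx); rewrite {2}xy exy.
- move=> _ _ [x hx <-] [y hy <-] xy nxy; apply/common_card => //.
  rewrite com //; last by apply/eqP => exy; apply: xy; rewrite exy.
  by case: ifP => // exy; case: nxy; apply/hadj.
Qed.

Lemma srg_checkP : {in h_vertices, forall x, count (h_adj x) h_vertices = 112%N} /\
  {in h_vertices &, forall x y, x != y ->
    count (fun z => h_adj x z && h_adj y z) h_vertices = if h_adj x y then 30%N else 56%N}.
Proof.
move: srg_checked; rewrite /srg_check; move: h_vertices h_adj => vs e.
rewrite all_map => /allP h; split => [x hx|x y hx hy xy]; have /andP [h1 h2] := h _ hx.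
  by rewrite -(eqP h1) commonE; apply: eq_count => y /=; rewrite andbb.
move: h2; rewrite all_map => /allP/(_ _ hy) /=; rewrite commonE (negbTE xy).
by move/eqP.
Qed.

Lemma set2_eq (T : Type) (a b c d : T) : [set a; b] = [set c; d] ->
  a <> b -> (a = c /\ b = d) \/ (a = d /\ b = c).
Proof.
move=> e ab; have : [set c; d] a by rewrite -e; left.
have : [set c; d] b by rewrite -e; right.
by move=> [] /= bE [] /= aE; [case: ab; rewrite aE bE | right | left | case: ab; rewrite aE bE].
Qed.

Section McLaughlin.

Variable B : 'M[k]_3.
Hypothesis hB : frame Gamma B.

Local Notation c := (class_conics B).

Let c_inj := class_conics_inj hB.

Lemma pair_type_symE a b : a \in classes150 -> b \in classes150 ->
  pair_type_code a b = pair_type_code b a.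
Proof.
move=> ha hb; have /andP [_ h] := allP pair_type_sym _ ha.
exact/eqP/(allP h).
Qed.

Lemma T_is15 a b : a \in classes150 -> b \in classes150 ->
  T_is Gamma (c a) (c b) Alpha15Gam6 <-> pair_type_code a b = 1%N.
Proof. by move=> ha hb; apply: T_is_code => //; left. Qed.

Lemma T_is3 a b : a \in classes150 -> b \in classes150 ->
  T_is Gamma (c a) (c b) Alpha3Gam18 <-> pair_type_code a b = 2%N.
Proof. by move=> ha hb; apply: T_is_code => //; right. Qed.

Lemma adj_graphH a b : a \in classes150 -> b \in classes150 ->
  adj (graphH Gamma) (c a) (c b) <-> pair_type_code a b = 1%N.
Proof.
move=> ha hb; split => [[_ /(T_is15 ha hb)] //|h]; split; last exact/T_is15.
move/(c_inj ha hb) => ab; have /andP [/eqP h0 _] := allP pair_type_sym _ ha.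
by move: h; rewrite -ab h0.
Qed.

Lemma first_component_classes a : a \in first_component -> a \in classes150.
Proof. by have /andP [_ /allP h] := first_component_sub; exact: h. Qed.

Lemma component_first :
  component (graphH Gamma) (c pt1) = c @` [set` first_component].
Proof.
have [h1 _] := andP first_component_sub.
have calDE := calD_classes hB.
apply: component_eq => [|D [a ha <-]|D D' [a ha <-]|_ [a ha <-]].
- by exists pt1.
- by rewrite /= calDE; exists a => //; exact: first_component_classes.
- have ha' := first_component_classes ha.
  rewrite /= calDE => -[b hb <-] h; exists b => //.
  have /implyP := allP (allP first_component_closed _ ha) _ hb; apply; apply/eqP.
  case: h => /adj_graphH hab; first exact: hab.
  by rewrite pair_type_symE //; exact: hab.
have := allP first_component_connected _ ha; move: a {ha}.
suff h : {in reach 10 (fun a => [seq b <- classes150 | pair_type_code a b == 1%N]) [:: pt1] [:: pt1],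
    forall a, a \in classes150 /\
      clos_refl_sym_trans _ (induced_adj (graphH Gamma)) (c pt1) (c a)} by move=> a /h [].
have base : pt1 \in classes150 /\
      clos_refl_sym_trans _ (induced_adj (graphH Gamma)) (c pt1) (c pt1).
  by split => //; exact: rst_refl.
apply: reach_ind => [x|x|a b [ha IH]].
- by rewrite inE => /eqP ->.
- by rewrite inE => /eqP ->.
rewrite mem_filter => /andP [/eqP hab hb]; split => //.
apply: rst_trans IH _; apply: rst_step; split; last by apply/adj_graphH.
  by rewrite /= calDE; exists a.
by rewrite /= calDE; exists b.
Qed.

Variables C1 C2 C3 : set (set (pcurve k 2)).
Hypothesis hC : components (graphH Gamma) = [set C1; C2; C3].
Hypothesis hdist : [/\ C1 <> C2, C1 <> C3 & C2 <> C3].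
Hypothesis hC1 : C1 (c pt1).

Lemma C1E : C1 = c @` [set` first_component].
Proof.
by rewrite -component_first; apply: components_mem => //; rewrite hC; left; left.
Qed.

(** Components partition the vertices, so the other two together are the complement of [C1]; H''
    involves them only through their union. *)
Lemma C23E : C2 `|` C3 = c @` [set` other_classes].
Proof.
have [h12 h13 _] := hdist.
have comp1 : components (graphH Gamma) C1 by rewrite hC; left; left.
have comp23 C : C = C2 \/ C = C3 -> components (graphH Gamma) C.
  by rewrite hC => -[] ->; [left; right | right].
apply/seteqP; split => D.
  move=> hD; have [C hC23 CD] : exists2 C, C = C2 \/ C = C3 & C D.
    by case: hD => hD; [exists C2; [left|] | exists C3; [right|]].
  have compC := comp23 _ hC23; have : calD Gamma D by case: compC CD => x _ -> [].
  rewrite (calD_classes hB) => -[a ha aD]; exists a => //=.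
  rewrite other_classesE mem_filter ha andbT; apply/negP => ha1.
  have C1D : C1 D by rewrite C1E -aD; exists a.
  have := components_mem comp1 C1D; rewrite -(components_mem compC CD).
  by case: hC23 => ->.
move=> [a]; rewrite /= other_classesE mem_filter => /andP [ha1 ha] <-.
have hD : vertices (graphH Gamma) (c a) by rewrite /= (calD_classes hB); exists a.
have hDD := component_refl hD.
have : components (graphH Gamma) (component (graphH Gamma) (c a)) by exists (c a).
rewrite hC => -[[]|] /= e; rewrite e in hDD; [|by left|by right].
move: hDD; rewrite C1E => -[b hb] /(c_inj (first_component_classes hb) ha) ba.
by move: ha1; rewrite -ba hb.
Qed.

Definition vertex_of (x : N * N) : set (set (pcurve k 2)) + set (pcurve k 2) :=
  if x.1 == x.2 then inr (c x.1) else inl [set c x.1; c x.2].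

Lemma h_vertex_cases x : x \in h_vertices ->
  (x.1 = x.2 /\ x.1 \in other_classes) \/
  [/\ x.1 != x.2, x \in component_edges, x.1 \in first_component, x.2 \in first_component
    & pair_type_code x.1 x.2 = 1%N].
Proof.
rewrite h_verticesE mem_cat => /orP [hx|/mapP [a ha ->]]; [right|by left].
have /andP [/allP/(_ _ hx)] := component_edges_check.
case/and5P => h1 h2 h3 /eqP h4 _; split; [exact: h3 | exact: hx | exact: h1 | exact: h2 | exact: h4].
Qed.

Lemma other_classes_sub a : a \in other_classes -> a \in classes150.
Proof. by rewrite other_classesE mem_filter => /andP []. Qed.

Lemma h_vertex_classes x : x \in h_vertices -> x.1 \in classes150 /\ x.2 \in classes150.
Proof.
case/h_vertex_cases => [[<- /other_classes_sub]|[_ _]] //.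
by move=> /first_component_classes h1 /first_component_classes h2.
Qed.

Lemma edges1P E : edges1 Gamma C1 E <-> exists a b, [/\ a \in first_component,
  b \in first_component, pair_type_code a b = 1%N & E = [set c a; c b]].
Proof.
rewrite /edges1 C1E; split.
  move=> [_ [_ [[a ha <-] [b hb <-] hab ->]]]; exists a, b; split => //.
  by apply/adj_graphH => //; exact: first_component_classes.
move=> [a [b [ha hb hab ->]]]; exists (c a), (c b); split; [by exists a | by exists b | | by []].
by apply/adj_graphH => //; exact: first_component_classes.
Qed.

Lemma vertices_graphH'' :
  vertices (graphH'' Gamma C1 C2 C3) = vertex_of @` [set` h_vertices].
Proof.
apply/seteqP; split => v.
  case=> [[E /edges1P [a [b [ha hb hab ->]]] <-]|].
    have [/allP ce /allP/(_ _ ha)/allP/(_ _ hb)/implyP] := andP component_edges_check.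
    rewrite hab => /(_ isT) /orP [] hE.
      have xE : (a, b) \in h_vertices by rewrite h_verticesE mem_cat hE.
      exists (a, b) => //; rewrite /vertex_of.
      by have /and5P [_ _ /negbTE -> _ _] := ce _ hE.
    have xE : (b, a) \in h_vertices by rewrite h_verticesE mem_cat hE.
    exists (b, a) => //; rewrite /vertex_of setUC.
    by have /and5P [_ _ /negbTE -> _ _] := ce _ hE.
  move=> [D]; rewrite C23E => -[a ha <-] <-; exists (a, a); last by rewrite /vertex_of eqxx.
  by rewrite /= h_verticesE mem_cat; apply/orP; right; exact: map_f.
move=> [x hx <-]; rewrite /vertex_of; case: (h_vertex_cases hx) => [[<- h]|[/negbTE -> _ h1 h2 h12]].
  by rewrite eqxx; right; exists (c x.1) => //; rewrite C23E; exists x.1.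
by left; exists [set c x.1; c x.2] => //; apply/edges1P; exists x.1, x.2.
Qed.

(** Edges are unordered pairs; injectivity rests on a single orientation of each being listed in
    [component_edges]. *)
Lemma vertex_of_inj : {in h_vertices &, injective vertex_of}.
Proof.
move=> x y hx hy; have [hx1 hx2] := h_vertex_classes hx; have [hy1 hy2] := h_vertex_classes hy.
rewrite /vertex_of; case: (h_vertex_cases hx) => [[x12 _]|[nx ex _ _ _]].
  rewrite x12 eqxx; case: (h_vertex_cases hy) => [[y12 _]|[/negbTE -> //]].
  rewrite y12 eqxx => -[] /(c_inj hx2 hy2) e.
  by rewrite [x]surjective_pairing [y]surjective_pairing x12 y12 e.
rewrite (negbTE nx); case: (h_vertex_cases hy) => [[-> _]|[ny ey _ _ _]]; first by rewrite eqxx.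
have nc : c x.1 <> c x.2 by move/(c_inj hx1 hx2) => e; move: nx; rewrite e eqxx.
rewrite (negbTE ny) => -[] e; case: (set2_eq e nc) => -[].
  move=> /(c_inj hx1 hy1) e1 /(c_inj hx2 hy2) e2.
  by rewrite [x]surjective_pairing [y]surjective_pairing e1 e2.
move=> /(c_inj hx1 hy2) e1 /(c_inj hx2 hy1) e2.
have [/allP/(_ _ ex)/and5P [_ _ _ _ /negP nex] _] := andP component_edges_check.
by case: nex; rewrite e1 e2 -surjective_pairing; exact: ey.
Qed.

Lemma edge_vertexP a b d : a \in classes150 -> b \in classes150 -> d \in classes150 -> a != b ->
  edge_vertex Gamma [set c a; c b] (c d) <->
  (pair_type_code a d == 2%N) && (pair_type_code b d == 2%N).
Proof.
move=> ha hb hd ab; split => [[D1 [D2 [e h1 h2]]]|/andP [/eqP/T_is3 h1 /eqP/T_is3 h2]].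
  have nab : c a <> c b by move/(c_inj ha hb) => e'; move: ab; rewrite e' eqxx.
  case: (set2_eq e nab) => -[aE bE]; rewrite -aE -bE in h1 h2;
    by apply/andP; split; apply/eqP/T_is3.
by exists (c a), (c b); split; [by [] | apply: h1 | apply: h2].
Qed.

(** An edge meeting two disjoint edges joins an endpoint of one to an endpoint of the other, so the
    existence of a linking edge amounts to four tests. *)
Lemma edge_relP a b a' b' : a \in first_component -> b \in first_component ->
  a' \in first_component -> b' \in first_component ->
  ([set c a; c b] <> [set c a'; c b'] /\
   edge_rel Gamma C1 [set c a; c b] [set c a'; c b']) <->
  [&& a != a', a != b', b != a', b != b' &
    [|| pair_type_code a a' == 1, pair_type_code a b' == 1, pair_type_code b a' == 1
      | pair_type_code b b' == 1]%N].
Proof.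
move=> ha hb ha' hb'.
have hc := first_component_classes.
have disj : [set c a; c b] `&` [set c a'; c b'] = set0 <->
    [&& a != a', a != b', b != a' & b != b'].
  split => [e|/and4P [/eqP h1 /eqP h2 /eqP h3 /eqP h4]].
    have ne x y : x \in first_component -> y \in first_component ->
      [set c a; c b] (c x) -> [set c a'; c b'] (c y) -> x != y.
      move=> hx hy h1 h2; apply/eqP => xy; rewrite xy in h1.
      have : ([set c a; c b] `&` [set c a'; c b']) (c y) by [].
      by rewrite e.
    by apply/and4P; split; apply: ne; rewrite //=; (by left) || by right.
  apply/seteqP; split => // D [] [] -> [] /c_inj e.
  - by apply: h1; apply: e; apply: hc.
  - by apply: h2; apply: e; apply: hc.
  - by apply: h3; apply: e; apply: hc.
  by apply: h4; apply: e; apply: hc.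
split.
  move=> [_ [/disj /and4P [n1 n2 n3 n4] [_ /edges1P [x [y [hx hy hxy ->]]]]]].
  move=> [[D1 [h1 h1']] [D2 [h2 h2']]]; rewrite n1 n2 n3 n4 /=.
  have step u v : u \in first_component -> v \in first_component ->
      [set c x; c y] (c u) -> [set c x; c y] (c v) -> u != v -> pair_type_code u v == 1%N.
    move=> hu hv [] /c_inj e1 [] /c_inj e2 uv;
      have {}e1 := e1 (hc _ hu) (hc _ _); have {}e2 := e2 (hc _ hv) (hc _ _).
    - by move: uv; rewrite e1 // e2 // eqxx.
    - by rewrite e1 // e2 // hxy.
    - by rewrite e1 // e2 // pair_type_symE ?hc // hxy.
    - by move: uv; rewrite e1 // e2 // eqxx.
  by case: h1' h2' => -> [] -> in h1 h2 *; rewrite (step _ _ _ _ h1 h2) ?orbT.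
move=> /and5P [h1 h2 h3 h4 h]; have e0 : [set c a; c b] `&` [set c a'; c b'] = set0.
  by apply/disj/and4P.
split.
  move=> e; rewrite -e setIid in e0; have : [set c a; c b] (c a) by left.
  by rewrite e0.
split => //.
have [u [v [hu hv uE vE uv]]] : exists u v, [/\ u \in first_component, v \in first_component,
    [set c a; c b] (c u), [set c a'; c b'] (c v) & pair_type_code u v = 1%N].
  by case/or4P: h => /eqP h; [exists a, a'|exists a, b'|exists b, a'|exists b, b'];
    split => //; (by left) || by right.
exists [set c u; c v]; first by apply/edges1P; exists u, v.
by split; [exists (c u) | exists (c v)]; split => //; [left | right].
Qed.

Lemma adj_graphH'' : {in h_vertices &, forall x y,
  adj (graphH'' Gamma C1 C2 C3) (vertex_of x) (vertex_of y) <-> h_adj x y}.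
Proof.
move=> x y hx hy; have [hx1 hx2] := h_vertex_classes hx; have [hy1 hy2] := h_vertex_classes hy.
rewrite /vertex_of /h_adj; case: (h_vertex_cases hx) => [[x12 _]|[nx _ fx1 fx2 _]].
  rewrite x12 eqxx; case: (h_vertex_cases hy) => [[y12 _]|[ny _ _ _ _]].
    rewrite y12 eqxx; split.
      move=> [ne h]; apply/andP; split; first by apply/eqP => e; apply: ne; rewrite e.
      by case: h => [/T_is15|/T_is3] ->; rewrite ?orbT.
    move=> /andP [/eqP ne h]; split; first by move/c_inj => e; apply: ne; apply: e.
    by case/orP: h => /eqP h; [left; apply/T_is15 | right; apply/T_is3].
  by rewrite (negbTE ny); exact: edge_vertexP.
rewrite (negbTE nx); case: (h_vertex_cases hy) => [[y12 _]|[ny _ fy1 fy2 _]].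
  by rewrite y12 eqxx; exact: edge_vertexP.
by rewrite (negbTE ny); exact: edge_relP.
Qed.

Lemma mclaughlin_first : is_McLaughlin_graph (graphH'' Gamma C1 C2 C3).
Proof.
have [deg com] := srg_checkP; have hsym := allP h_adj_sym.
rewrite /is_McLaughlin_graph -h_vertices_size.
apply: (srg_transfer h_vertices_uniq vertex_of_inj vertices_graphH'' adj_graphH'') => //.
- by move=> x hx; case/andP: (hsym _ hx).
by move=> x y hx hy; apply/eqP; have /andP [_ /allP] := hsym _ hx; apply.
Qed.

End McLaughlin.

Lemma first_frame a : a \in classes150 ->
  forall B, frame Gamma B ->
  exists2 B', frame Gamma B' & class_conics B' pt1 = class_conics B a.
Proof.
move: a; apply: classes_ind => [B hB|a g ha hg IH B hB]; first by exists B.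
have [B' hB' e] := IH _ (frame_generator hg hB).
by exists B' => //; rewrite e (class_conics_generator hg).
Qed.

End HermitianClasses.

Theorem theorem1p12 (k : closedFieldType) (char5 : 5%N \in [pchar k])
  (Gamma : pcurve k 6) (hGamma : is_hermitian Gamma)
  (C1 C2 C3 : set (set (pcurve k 2)))
  (hC : components (graphH Gamma) = [set C1; C2; C3])
  (hdist : [/\ C1 <> C2, C1 <> C3 & C2 <> C3]) :
  is_McLaughlin_graph (graphH'' Gamma C1 C2 C3).
Proof.
have [s s2] : exists s : k, s ^+ 2 = 2%:R by exact: root_exists.
have [B hB] := frame_exists (pcharf0 char5) hGamma.
have hC1 : components (graphH Gamma) C1 by rewrite hC; left; left.
have [D vD C1E] := hC1.
have C1D : C1 D by rewrite C1E; exact: component_refl.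
(* [C1] is the component of [D]; the frame is changed so that [D] becomes the first class, which
   makes [C1] the component computed in the tables. *)
move: (vD); rewrite /= (calD_classes char5 s2 hB) => -[a ha aD].
have [B' hB' e] := first_frame char5 s2 ha hB.
by apply: (mclaughlin_first char5 s2 hB' hC hdist); rewrite e aD.
Qed.
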